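(* Let $\mu,\nu$ be compactly supported probability measures on $\mathbb{R}^d$ and let $d'=2\lfloor d/2\rfloor$. Assume that $S_\lambda(\mu,\nu)-W_2^2(\mu,\nu)=\lambda^2I+O(\lambda^4)$ as $\lambda\to0^+$ for some $I\in\mathbb{R}$. Then with $\lambda\asymp n^{-1/(d'+8)}$ it holds $$\mathbf{E}\big[|\hat R_{\lambda,n}-W_2^2(\mu,\nu)|\big]\lesssim n^{-4/(d'+8)},$$ where $\lesssim$ hides a constant independent of $n$. Moreover, with probability $1-\delta$, this estimator returns an $\epsilon$-accurate estimation of $W_2^2(\mu,\nu)$ with $\tilde O(\epsilon^{-(d'+11)/2})$ computations via Sinkhorn's algorithm (for a suitable choice of $n$ and of the number of iterations), where $\tilde O$ hides poly-log factors in $1/\delta$.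
   Context: For probability measures with finite second moments and $\lambda\ge0$, $T_\lambda(\mu,\nu)=\min_{\gamma\in\Pi(\mu,\nu)}\int\|y-x\|_2^2\,d\gamma+2\lambda H(\gamma,\mu\otimes\nu)$, where $\Pi(\mu,\nu)$ is the set of couplings and $H(\gamma,\pi)=\int\log(d\gamma/d\pi)\,d\gamma$ if $\gamma\ll\pi$, $+\infty$ otherwise; $W_2^2=T_0$; $S_\lambda(\mu,\nu)=T_\lambda(\mu,\nu)-\frac12(T_\lambda(\mu,\mu)+T_\lambda(\nu,\nu))$; $R_\lambda(\mu,\nu)=2S_\lambda(\mu,\nu)-S_{\sqrt2\lambda}(\mu,\nu)$. With $\hat\mu_n,\hat\nu_n$ the empirical distributions of $n$ independent samples from $\mu$ and $n$ independent samples from $\nu$, $\hat R_{\lambda,n}=R_\lambda(\hat\mu_n,\hat\nu_n)$. Sinkhorn's algorithm: for discrete measures $\sum_{i=1}^np_i\delta_{x_i}$ and $\sum_{j=1}^nq_j\delta_{y_j}$ with $c_{i,j}=\frac12\|x_i-y_j\|_2^2$, $v^{(0)}=0$, and for $k\ge1$, $u^{(k)}_i=-\lambda\log(\sum_je^{(v^{(k-1)}_j-c_{i,j})/\lambda}q_j)$, $v^{(k)}_j=-\lambda\log(\sum_ie^{(u^{(k)}_i-c_{i,j})/\lambda}p_i)$; the estimate of $T_\lambda$ after $k$ iterations is $2\sum_i(u^{(k)}_ip_i+v^{(k)}_iq_i)$, and $\hat R_{\lambda,n}$ is computed by applying this to each $T$ term entering its definition. Computations are counted in arithmetic operations ($\exp,\log$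 at unit cost), each iteration costing $O(n^2)$. ''$\epsilon$-accurate'' means absolute error at most $\epsilon$ up to a constant factor. Constants may depend on $\mu,\nu,d$. *)

(* Defs.v *)
From HB Require Import structures.
From mathcomp Require Import all_boot all_order all_algebra.
From mathcomp Require Import all_classical all_reals all_analysis.

Set Implicit Arguments.
Unset Strict Implicit.
Unset Printing Implicit Defensive.

Import Order.TTheory GRing.Theory Num.Theory.
Import numFieldNormedType.Exports.

Local Open Scope classical_set_scope.
Local Open Scope ring_scope.

(* R^d with its Borel sigma-algebra. *)
Definition euclid (R : realType) (d : nat) : measurableType _ :=
  g_sigma_algebraType (@open 'rV[R]_d).

(* The library norm on row vectors is the sup norm, whence this definition. *)
Definition sqdist {R : realType} {d : nat} (x y : 'rV[R]_d) : R :=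
  \sum_(i < d) (x 0 i - y 0 i) ^+ 2.

Definition compactly_supported {R : realType} {d : nat}
    (mu : probability (euclid R d) R) : Prop :=
  exists2 K : set 'rV[R]_d, compact K & mu K = 1%E.

Section optimal_transport.
Context {R : realType}.

(* Measures are functions on all sets; only their values on measurable sets
   are meaningful, hence the explicit measurability conditions. *)
Definition coupling {d1 d2} {T1 : measurableType d1} {T2 : measurableType d2}
    (mu : probability T1 R) (nu : probability T2 R)
    (gamma : probability (T1 * T2)%type R) : Prop :=
  (forall A, measurable A -> gamma (fst @^-1` A) = mu A) /\
  (forall B, measurable B -> gamma (snd @^-1` B) = nu B).

Definition relative_entropy {d0} {T : measurableType d0}
    (gamma pi : probability T R) : \bar R :=
  if pselect (gamma `<< pi) then
    (\int[gamma]_z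
        lne (Radon_Nikodym (charge_of_finite_measure gamma) pi z))%E
  else +oo%E.

Variable d : nat.
Implicit Types (lambda : R) (mu nu : probability (euclid R d) R).

(* For lambda = 0 the entropic term vanishes even if the entropy is infinite,
   since 0 * +oo = 0 in \bar R. *)
Definition transport_objective lambda mu nu
    (gamma : probability (euclid R d * euclid R d)%type R) : \bar R :=
  (\int[gamma]_z (sqdist z.2 z.1)%:E +
   (2 * lambda)%:E * relative_entropy gamma (mu \x nu))%E.

(* The infimum is attained, and it is finite when mu and nu have finite second
   moments. *)
Definition ot_cost lambda mu nu : R :=
  fine (ereal_inf [set transport_objective lambda mu nu gamma
                  | gamma in [set gamma | coupling mu nu gamma]]).

Definition W2sq mu nu : R := ot_cost 0 mu nu.

Definition sinkhorn_div lambda mu nu : R :=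
  ot_cost lambda mu nu
  - 1 / 2 * (ot_cost lambda mu mu + ot_cost lambda nu nu).

Definition richardson_div lambda mu nu : R :=
  2 * sinkhorn_div lambda mu nu - sinkhorn_div (Num.sqrt 2 * lambda) mu nu.

End optimal_transport.

Section empirical_measure.
Context {R : realType} {d0} {T : measurableType d0}.
Variables (n : nat) (x : 'I_n.+1 -> T).

Definition empirical : set T -> \bar R :=
  mscale (n.+1%:R^-1)%:nng (msum (fun i => \d_(x (inord i))) n.+1).

HB.instance Definition _ := Measure.on empirical.

Let empirical_setT : empirical [set: T] = 1%E.
Proof.
have sum1 : (\sum_(i < n.+1) \d_(x (inord i)) [set: T] = n.+1%:R%:E :> \bar R)%E.
  under eq_bigr do rewrite diracT.
  by rewrite sumEFin sumr_const card_ord.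
rewrite /empirical /mscale /= /msum /= sum1.
by rewrite -EFinM mulVf// pnatr_eq0.
Qed.

HB.instance Definition _ :=
  Measure_isProbability.Build _ _ _ empirical empirical_setT.

End empirical_measure.

Section sampling.
Context {R : realType} {dO} {Omega : measurableType dO}.
Context {dT} {T : measurableType dT}.
Variable P : probability Omega R.

Definition mutually_independent {I : finType} (Z : I -> {RV P >-> T}) : Prop :=
  forall (J : {set I}) (B : I -> set T), (forall i, measurable (B i)) ->
    P [set w | forall i, i \in J -> B i (Z i w)] =
    (\prod_(i in J) P (Z i @^-1` B i))%E.

(* All 2 n variables are jointly independent. *)
Definition two_samples n (X Y : 'I_n -> {RV P >-> T})
    (mu nu : probability T R) : Prop :=
  [/\ forall i A, measurable A -> distribution P (X i) A = mu A,
      forall i A, measurable A -> distribution P (Y i) A = nu A &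
      mutually_independent
        (fun s : 'I_n + 'I_n => match s with inl i => X i | inr j => Y j end)].

End sampling.

Definition same_order {R : realType} (u v : nat -> R) : Prop :=
  exists c C : R, [/\ 0 < c, 0 < C &
    forall n, (0 < n)%N -> c * v n <= u n <= C * v n].

(* Real computations with an operation counter: a value together with the number
   of arithmetic operations, exponentials and logarithms used to compute it. *)
Section counted.
Context {R : realType}.

Definition counted (A : Type) : Type := (A * nat)%type.

Definition cret {A} (a : A) : counted A := (a, 0%N).
Definition cbind {A B} (m : counted A) (f : A -> counted B) : counted B :=
  ((f m.1).1, (m.2 + (f m.1).2)%N).

Definition cadd (a b : R) : counted R := (a + b, 1%N).
Definition csub (a b : R) : counted R := (a - b, 1%N).
Definition cmul (a b : R) : counted R := (a * b, 1%N).
Definition cdiv (a b : R) : counted R := (a / b, 1%N).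
Definition copp (a : R) : counted R := (- a, 1%N).
Definition cexp (a : R) : counted R := (expR a, 1%N).
Definition cln (a : R) : counted R := (ln a, 1%N).

(* An array is computed once, entry by entry; reading an entry is free. *)
Definition carray {A} n (m : 'I_n -> counted A) : counted ('I_n -> A) :=
  (fun i => (m i).1, (\sum_(i < n) (m i).2)%N).

Definition csum n (m : 'I_n -> counted R) : counted R :=
  (\sum_(i < n) (m i).1, (\sum_(i < n) (m i).2.+1)%N).

End counted.

Notation "a <~ m ; e" := (cbind m (fun a => e))
  (at level 60, m at next level, right associativity,
   format "'[v' a  <~  m ; '/' e ']'").

Section sinkhorn.
Context {R : realType} {n : nat}.
Variable lambda : R.

Section potentials.
Variables (c : 'I_n -> 'I_n -> R) (p q : 'I_n -> R).

Definition sinkhorn_u (v : 'I_n -> R) : 'I_n -> R := fun i =>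
  - (lambda * ln (\sum_(j < n) expR ((v j - c i j) / lambda) * q j)).

Definition sinkhorn_v (u : 'I_n -> R) : 'I_n -> R := fun j =>
  - (lambda * ln (\sum_(i < n) expR ((u i - c i j) / lambda) * p i)).

Fixpoint sinkhorn_iter (k : nat) : ('I_n -> R) * ('I_n -> R) :=
  if k is k'.+1 then
    let u := sinkhorn_u (sinkhorn_iter k').2 in (u, sinkhorn_v u)
  else (fun=> 0, fun=> 0).

Definition sinkhorn_value (k : nat) : R :=
  let: (u, v) := sinkhorn_iter k in 2 * \sum_(i < n) (u i * p i + v i * q i).

Definition csinkhorn_u (v : 'I_n -> R) : counted ('I_n -> R) :=
  carray (fun i =>
    s <~ csum (fun j =>
           a <~ csub (v j) (c i j);
           b <~ cdiv a lambda;
           e <~ cexp b;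
           cmul e (q j));
    l <~ cln s;
    r <~ cmul lambda l;
    copp r).

Definition csinkhorn_v (u : 'I_n -> R) : counted ('I_n -> R) :=
  carray (fun j =>
    s <~ csum (fun i =>
           a <~ csub (u i) (c i j);
           b <~ cdiv a lambda;
           e <~ cexp b;
           cmul e (p i));
    l <~ cln s;
    r <~ cmul lambda l;
    copp r).

Fixpoint csinkhorn_iter (k : nat) : counted (('I_n -> R) * ('I_n -> R)) :=
  if k is k'.+1 then
    uv <~ csinkhorn_iter k';
    u <~ csinkhorn_u uv.2;
    v <~ csinkhorn_v u;
    cret (u, v)
  else cret (fun=> 0, fun=> 0).

Definition csinkhorn_value (k : nat) : counted R :=
  uv <~ csinkhorn_iter k;
  s <~ csum (fun i =>
         a <~ cmul (uv.1 i) (p i);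
         b <~ cmul (uv.2 i) (q i);
         cadd a b);
  cmul 2 s.

Lemma csinkhorn_valueE k : (csinkhorn_value k).1 = sinkhorn_value k.
Proof.
have iterE : (csinkhorn_iter k).1 = sinkhorn_iter k.
  by elim: k => [|k IH]; [|rewrite [RHS]/= -IH].
by rewrite /csinkhorn_value /sinkhorn_value -iterE /=; case: (csinkhorn_iter k) => -[].
Qed.

End potentials.

Context {d : nat}.
Implicit Types x y : 'I_n -> 'rV[R]_d.

Definition ccost x y : counted ('I_n -> 'I_n -> R) :=
  carray (fun i => carray (fun j =>
    s <~ csum (fun l : 'I_d =>
           a <~ csub (x i 0 l) (y j 0 l);
           cmul a a);
    cdiv s 2)).

Lemma ccostE x y i j : (ccost x y).1 i j = 1 / 2 * sqdist (x i) (y j).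
Proof. by rewrite /ccost /sqdist /= mul1r mulrC. Qed.

(* The k-th Sinkhorn estimate of the entropic cost between the uniform measures
   on x and on y. *)
Definition cot_cost k x y : counted R :=
  w <~ cdiv 1 n%:R;
  c <~ ccost x y;
  csinkhorn_value c (fun=> w) (fun=> w) k.

Lemma cot_costE k x y :
  (cot_cost k x y).1 =
  sinkhorn_value (fun i j => 1 / 2 * sqdist (x i) (y j))
    (fun=> 1 / n%:R) (fun=> 1 / n%:R) k.
Proof.
rewrite [LHS]csinkhorn_valueE; congr sinkhorn_value.
by apply/funext => i; apply/funext => j; rewrite ccostE.
Qed.

Definition csinkhorn_div k x y : counted R :=
  a <~ cot_cost k x y;
  b <~ cot_cost k x x;
  c <~ cot_cost k y y;
  s <~ cadd b c;
  h <~ cdiv s 2;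
  csub a h.

End sinkhorn.

Definition crichardson_div {R : realType} {n d : nat} (lambda : R) (k : nat)
    (x y : 'I_n -> 'rV[R]_d) : counted R :=
  s1 <~ csinkhorn_div lambda k x y;
  lambda2 <~ cmul (Num.sqrt 2) lambda;
  s2 <~ csinkhorn_div lambda2 k x y;
  r <~ cmul 2 s1;
  csub r s2.

(* Main.v *)
Require Import Defs.
From HB Require Import structures.
From mathcomp Require Import all_boot all_order all_algebra.
From mathcomp Require Import all_classical all_reals all_analysis.
From mathcomp Require Import measurable_realfun zify ring lra.

(* All measures live on a box, so up to an arbitrarily small error the points can
   be moved to a dyadic grid and every entropic problem becomes a finite one: weak
   duality and an explicit coupling identify T_lambda with twice the dual value of
   finite Schrodinger potentials. An optimal potential is a softmin
   -lambda log sum_b exp((v_b - |x - z_b|^2 / 2) / lambda) q_b; along coordinate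
   lines its derivatives of order s = floor(d/2) + 1 are O(lambda^(1-s)), whatever
   the weights. Tensor Lagrange interpolation on nested dyadic cubes expands such a
   function into details with square-summable weighted coefficients (because
   d < 2s), so changing mu into mu_n changes the dual value by at most
   lambda^(1-s) times a Euclidean norm of empirical averages, which has
   exponential moments at scale n^(-1/2). With the bias
   2(lambda^2 I) - 2 lambda^2 I + O(lambda^4) = O(lambda^4) this gives the rate.
   Pinsker's inequality makes the dual gap g_k of Sinkhorn's algorithm satisfy
   g_k - g_(k+1) >= c lambda g_k^2, hence g_k = O(1 / (lambda k)). *)

Set Implicit Arguments.
Unset Strict Implicit.
Unset Printing Implicit Defensive.

Import Order.TTheory GRing.Theory Num.Theory.
Import numFieldNormedType.Exports.

Local Open Scope classical_set_scope.
Local Open Scope ring_scope.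

(** * Discretisation of the entropic transport problem *)

(** The exponents match because [s - 1 = d' / 2]: for [lambda] of order [n^(-1/(d'+8))], the
    statistical term [lambda^(-d'/2) n^(-1/2)] and the bias [lambda^4] are both of order
    [n^(-4/(d'+8))]. The obstacle is that the potentials of the empirical problem depend on the
    sample, so concentration for a fixed function does not apply: a bound uniform over all softmin
    potentials is needed, and it must not deteriorate as the mesh shrinks. Cauchy-Schwarz against
    the multiscale coefficients provides it. The sample then enters only through one quadratic form
    in feature averages, which contains no potential, and a single exponential moment of it yields
    both the mean and the tail. No constant depends on the grid level [J], so [J] may be chosen
    afterwards in terms of [n]. Mixed partial derivatives never occur: tensor interpolation moves
    one coordinate at a time, so restrictions to coordinate lines suffice. Working with finite index
    sets also replaces duality for general measures by finite sums. *)

Lemma sum_pair (V : nmodType) (A B : finType) (F : A * B -> V) :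
  \sum_ab F ab = \sum_a \sum_b F (a, b).
Proof. by rewrite pair_bigA; apply: eq_bigr => -[]. Qed.

Section finite_valued.
Context d (T : measurableType d) (R : realType).

Lemma bounded_integrable (m : {finite_measure set T -> \bar R}) (B : R)
    (f : T -> R) (D : set T) : measurable D -> measurable_fun D f ->
  (forall x, `|f x| <= B) -> m.-integrable D (EFin \o f).
Proof.
move=> mD mf fB; apply: measurable_bounded_integrable => //.
  by rewrite -ge0_fin_numE // fin_num_measure.
exists B; split; first by rewrite num_real.
by move=> y By x _ /=; apply: le_trans (fB x) (ltW By).
Qed.

Variables (A : finType) (psi : T -> A).
Hypothesis mpsi : forall a, measurable (psi @^-1` [set a]).

Lemma finite_valuedE (f : A -> R) x :
  f (psi x) = \sum_a f a * \1_(psi @^-1` [set a]) x.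
Proof.
rewrite (bigD1 (psi x)) //= indicE mem_set // mulr1 big1 ?addr0 //.
by move=> a ax; rewrite indicE memNset ?mulr0 //= => e; rewrite e eqxx in ax.
Qed.

Lemma measurable_finite_valued (f : A -> R) (D : set T) :
  measurable_fun D (f \o psi).
Proof.
apply: measurable_funTS.
rewrite (_ : f \o psi = fun x => \sum_a f a * \1_(psi @^-1` [set a]) x); last first.
  by apply/funext => x /=; exact: finite_valuedE.
apply: measurable_sum => a; apply: measurable_funM => //.
Qed.

Lemma finite_valued_integrable (m : {finite_measure set T -> \bar R})
    (f : A -> R) (D : set T) : measurable D ->
  m.-integrable D (EFin \o (f \o psi)).
Proof.
move=> mD; apply: (@bounded_integrable _ (\sum_a `|f a|)) => //.
  exact: measurable_finite_valued.
by move=> x /=; rewrite (bigD1 (psi x)) //= lerDl sumr_ge0.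
Qed.

Lemma integral_finite_valued (m : {finite_measure set T -> \bar R})
    (f : A -> R) (D : set T) : measurable D ->
  (\int[m]_(x in D) (f (psi x))%:E)%E =
  (\sum_a f a * fine (m (D `&` psi @^-1` [set a])))%:E.
Proof.
move=> mD.
under eq_integral do rewrite finite_valuedE -sumEFin.
rewrite integral_sum //; last first.
  move=> a; apply: (@bounded_integrable _ (`|f a|)) => //.
    by apply: measurable_funM => //; exact: measurable_indic.
  move=> x; rewrite normrM indicE; case: (_ \in _); rewrite ?normr1 ?mulr1 //.
  by rewrite normr0 mulr0.
rewrite -sumEFin; apply: eq_bigr => a _.
under eq_integral do rewrite EFinM.
rewrite integralZl //; last first.
  apply: (@bounded_integrable _ 1) => //.
  by move=> x; rewrite indicE; case: (_ \in _); rewrite ?normr1 ?normr0.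
rewrite integral_indic // EFinM setIC fineK //.
by apply: fin_num_measure; apply: measurableI.
Qed.

Lemma measure_finite_valued (m : {finite_measure set T -> \bar R}) (D : set T) :
  measurable D ->
  m D = (\sum_a fine (m (D `&` psi @^-1` [set a])))%:E.
Proof.
move=> mD; have := integral_finite_valued m (fun=> 1) mD.
rewrite integral_cst // mul1e => ->.
by congr (_%:E); apply: eq_bigr => a _; rewrite mul1r.
Qed.

End finite_valued.

Lemma ae_imp d (T : measurableType d) (R : realType) (m : set T -> \bar R)
    (P Q : T -> Prop) : (forall x, P x -> Q x) ->
  {ae m, forall x, P x} -> {ae m, forall x, Q x}.
Proof.
move=> PQ [N [mN mN0 PN]]; exists N; split => // x nQ; apply: PN => Px.
by apply: nQ; exact: PQ.
Qed.

Section relative_entropy_bounds.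
Context d (T : measurableType d) (R : realType).

Lemma measurable_lne (D : set T) (f : T -> \bar R) : (forall x, f x \is a fin_num) ->
  measurable_fun D f -> measurable_fun D (fun x => lne (f x)).
Proof.
move=> ffin mf.
rewrite (_ : (fun x => lne (f x)) =
  fun x => if (f x <= 0%:E)%E then -oo%E else (ln (fine (f x)))%:E); last first.
  apply/funext => x; have := ffin x; case: (f x) => // r _; rewrite lee_fin.
move=> mD; apply: measurable_fun_if => //.
- exact: measurable_fun_lee.
- apply/measurable_EFinP; apply: measurableT_comp => //.
  apply: measurableT_comp => //.
  by apply: measurable_funS mf => // x [].
Qed.

(** Positive and negative parts are compared separately, so [F] may have an infinite integral, as
    the logarithm of a density can. *)
Lemma integral_ge_ae (m : {finite_measure set T -> \bar R}) (G F : T -> \bar R) :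
  m.-integrable setT G -> measurable_fun setT F ->
  {ae m, forall x, (G x <= F x)%E} ->
  (\int[m]_x G x <= \int[m]_x F x)%E.
Proof.
move=> iG mF GF; rewrite [leLHS]integralE [leRHS]integralE.
have mG := measurable_int _ iG.
apply: leeB.
  apply: ae_ge0_le_integral => //; try exact: measurable_funepos.
  apply: filterS GF => x GFx _; rewrite !funeposE.
  by rewrite ge_max le_max GFx /= le_max lexx orbT.
apply: ae_ge0_le_integral => //; try exact: measurable_funeneg.
apply: filterS GF => x GFx _; rewrite !funenegE.
by rewrite ge_max le_max leeN2 GFx /= le_max lexx orbT.
Qed.

(* Gibbs' variational inequality, from ln f >= g + 1 - exp g / f. *)
Lemma relative_entropy_ge (gamma pi : probability T R) (B : R) (g : T -> R) :
  measurable_fun setT g -> (forall x, `|g x| <= B) ->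
  (\int[gamma]_x (g x)%:E + 1 - \int[pi]_x (expR (g x))%:E
   <= relative_entropy gamma pi)%E.
Proof.
move=> mg gB; rewrite /relative_entropy; destruct (pselect (gamma `<< pi)) as [gp|ngp]; last by rewrite leey.
set f := Radon_Nikodym _ _.
have ffin x : f x \is a fin_num by exact: Radon_Nikodym_fin_num.
have mf : measurable_fun setT f by apply: measurable_int; exact: Radon_Nikodym_integrable.
(* [h] is [exp g / f], set to 0 where [f] vanishes. Its [gamma]-integral is the [pi]-integral of
   [exp g] over the set where [f] is positive, whence an inequality below rather than an
   equality. *)
pose h x := (if (f x <= 0%:E)%E then 0 else expR (g x - ln (fine (f x)))) : R.
have h0 x : 0 <= h x.
  by rewrite /h; case: ifPn => // fx0; rewrite expR_ge0.
have mh : measurable_fun setT h.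
  apply: measurable_fun_ifT => //; first exact: measurable_fun_lee.
  apply: measurableT_comp => //; apply: measurable_funB => //.
  by do 2 apply: measurableT_comp => //.
have meg : measurable_fun setT (fun x => expR (g x)) by exact: measurableT_comp.
have egB x : `|expR (g x)| <= expR B.
  by rewrite ger0_norm ?expR_ge0 // ler_expR (le_trans _ (gB x)) // ler_norm.
have ieg : pi.-integrable setT (EFin \o (fun x => expR (g x))).
  exact: (@bounded_integrable _ _ _ _ (expR B)).
(* [gamma] does not charge the zero set of its own density, so the value [-oo] of [lne] there does
   no harm. *)
have fneg : gamma [set x | (f x <= 0%:E)%E] = 0%E.
  have mN : measurable [set x | (f x <= 0%:E)%E].
    rewrite -[X in measurable X]setTI; exact: measurable_lee.
  apply/eqP; rewrite eq_le measure_ge0 andbT.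
  have -> : gamma [set x | (f x <= 0)%E] =
     (\int[pi]_(x in [set x | (f x <= 0%:E)%E]) f x)%E.
    exact: (Radon_Nikodym_integral (nu := charge_of_finite_measure gamma)).
  rewrite integralE (eq_integral (cst 0%E)); last first.
    by move=> x xN; exact: (le0_funeposE (D := [set x | (f x <= 0%:E)%E])).
  by rewrite integral0 sub0e oppe_le0 integral_ge0.
have ih_le : (\int[gamma]_x (h x)%:E <= \int[pi]_x (expR (g x))%:E)%E.
  have := @Radon_Nikodym_SigmaFinite.change_of_variables _ _ _ gamma pi gp
     (fun x => (h x)%:E) setT.
  move=> <- //; last by exact/measurable_EFinP.
  have mSF : measurable_fun setT (Radon_Nikodym_SigmaFinite.f gamma pi).
    apply: measurable_int; exact: Radon_Nikodym_SigmaFinite.f_integrable.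
  apply: ae_ge0_le_integral => //.
  - by move=> x _; rewrite mule_ge0 ?lee_fin // Radon_Nikodym_SigmaFinite.f_ge0.
  - by apply: emeasurable_funM => //; exact/measurable_EFinP.
  - exact/measurable_EFinP.
  - have := ae_eq_Radon_Nikodym_SigmaFinite gp measurableT.
    apply: filterS => x /(_ I) -> _; rewrite -/f /h.
    case: ifPn => [_|]; first by rewrite mul0e lee_fin expR_ge0.
    rewrite -ltNge => fx0; rewrite -[in leLHS](fineK (ffin x)) -EFinM lee_fin.
    have fx0' : 0 < fine (f x) by rewrite fine_gt0 // fx0 ltey_eq ffin.
    by rewrite /= expRB lnK ?posrE // divfK // gt_eqF.
have ih : gamma.-integrable setT (EFin \o h).
  apply/integrableP; split; first exact/measurable_EFinP.
  under eq_integral do rewrite /= ger0_norm //.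
  by apply: le_lt_trans ih_le _; apply: integrable_lty.
have ig : gamma.-integrable setT (EFin \o g).
  exact: (@bounded_integrable _ _ _ _ B).
have i1 : gamma.-integrable setT (EFin \o (fun=> 1 : R)).
  by apply: (@bounded_integrable _ _ _ _ 1) => // x; rewrite normr1.
have ig1 : gamma.-integrable setT (EFin \o (fun x => g x + 1)).
  exact: (integrableD measurableT ig i1).
have igh : gamma.-integrable setT (EFin \o (fun x => g x + 1 - h x)).
  exact: (integrableB measurableT ig1 ih).
have ighE : (\int[gamma]_x (g x + 1 - h x)%:E =
    \int[gamma]_x (g x)%:E + 1 - \int[gamma]_x (h x)%:E)%E.
  have -> := integralB measurableT ig1 ih.
  have -> := integralD measurableT ig i1.
  by rewrite integral_cst // mul1e; congr (_ + _ - _)%E; exact: probability_setT.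
apply: (@le_trans _ _ (\int[gamma]_x (g x + 1 - h x)%:E)%E).
  by rewrite ighE leeB.
apply: integral_ge_ae.
- exact: igh.
- exact: measurable_lne.
- exists [set x | (f x <= 0%:E)%E]; split => //.
    rewrite -[X in measurable X]setTI; exact: measurable_lee.
  move=> x /= Hx; apply: contrapT => /negP; rewrite -ltNge => fx0; apply: Hx.
  have fx0' : 0 < fine (f x) by rewrite fine_gt0 // fx0 ltey_eq ffin.
  have -> : h x = expR (g x - ln (fine (f x))) by rewrite /h leNgt fx0.
  rewrite -[X in lne X](fineK (ffin x)) lne_EFin // lee_fin.
  set t := fine (f x).
  by have := expR_ge1Dx (g x - ln t); lra.
Qed.

End relative_entropy_bounds.

Section density.
Context d (T : measurableType d) (R : realType).
Variables (pi : probability T R) (A : finType) (psi : T -> A) (w : A -> R).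
Hypothesis mpsi : forall a, measurable (psi @^-1` [set a]).
Hypothesis w_ge0 : forall a, 0 <= w a.
Hypothesis w1 : \sum_a w a * fine (pi (psi @^-1` [set a])) = 1.

Definition density_measure (E : set T) : \bar R :=
  (\int[pi]_(x in E) (w (psi x))%:E)%E.

Let density0 : density_measure set0 = 0%E.
Proof. by rewrite /density_measure integral_set0. Qed.

Let density_ge0 E : (0 <= density_measure E)%E.
Proof. by apply: integral_ge0 => x _; rewrite lee_fin. Qed.

Let density_sigma_additive : semi_sigma_additive density_measure.
Proof.
move=> E mE tE mUE.
rewrite /density_measure ge0_integral_bigcup //=; last 2 first.
  by apply/measurable_EFinP; exact: measurable_finite_valued.
  by move=> x _; rewrite lee_fin.
by apply: is_cvg_ereal_nneg_natsum_cond => n _ _; exact: density_ge0.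
Qed.

HB.instance Definition _ := isMeasure.Build _ _ _
  density_measure density0 density_ge0 density_sigma_additive.

Let density_setT : density_measure [set: T] = 1%E.
Proof.
rewrite /density_measure integral_finite_valued //.
by under eq_bigr do rewrite setTI; rewrite w1.
Qed.

HB.instance Definition _ :=
  @Measure_isProbability.Build _ _ R density_measure density_setT.

Lemma density_exists : exists gamma : probability T R,
  forall E, measurable E -> gamma E = (\int[pi]_(x in E) (w (psi x))%:E)%E.
Proof. by exists (density_measure : probability T R). Qed.

End density.

Section relative_entropy_density.
Context d (T : measurableType d) (R : realType).

(** The Radon-Nikodym derivative is determined only [pi]-almost everywhere; domination transfers its
    equality with [exp g] to [gamma]-almost every point, where its logarithm is integrated. *)
Lemma relative_entropy_density (gamma pi : probability T R) (A : finType)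
    (psi : T -> A) (g : A -> R) : (forall a, measurable (psi @^-1` [set a])) ->
  (forall E, measurable E ->
    gamma E = (\int[pi]_(x in E) (expR (g (psi x)))%:E)%E) ->
  relative_entropy gamma pi = (\int[gamma]_x (g (psi x))%:E)%E.
Proof.
move=> mpsi gammaE.
have meg E : measurable_fun E (fun x => (expR (g (psi x)))%:E).
  apply/measurable_EFinP.
  exact: (measurable_finite_valued mpsi (fun a => expR (g a))).
have gp : gamma `<< pi.
  apply/null_content_dominatesP => E mE piE; rewrite gammaE //.
  exact: null_set_integral.
have mf : measurable_fun setT (Radon_Nikodym (charge_of_finite_measure gamma) pi).
  by apply: measurable_int; exact: Radon_Nikodym_integrable.
have ffin x : Radon_Nikodym (charge_of_finite_measure gamma) pi x \is a fin_num.
  exact: Radon_Nikodym_fin_num.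
have ae_f : {ae pi, forall x, setT x ->
    Radon_Nikodym (charge_of_finite_measure gamma) pi x = (expR (g (psi x)))%:E}.
  apply: integral_ae_eq => //; first exact: Radon_Nikodym_integrable.
  move=> E _ mE; rewrite -Radon_Nikodym_integral //; exact: gammaE.
rewrite /relative_entropy; destruct (pselect (gamma `<< pi)) as [gp'|ngp] => //=.
apply: ae_eq_integral => //.
- exact: measurable_lne.
- by apply/measurable_EFinP; exact: measurable_finite_valued.
- have [N [mN piN fN]] := ae_f; exists N; split => //.
    by have /null_content_dominatesP := gp; apply.
  move=> x Hx; apply: fN => /= Hf; apply: Hx => _.
  by rewrite /= Hf // lne_EFin ?expR_gt0 // expRK.
Qed.

End relative_entropy_density.

(** * Identification of the entropic cost with a finite dual value *)

Section ot_cost_finite.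
Context (R : realType) (d : nat).

Lemma measurable_coord (i : 'I_d) :
  measurable_fun [set: euclid R d] (fun x : euclid R d => (x : 'rV[R]_d) 0 i).
Proof.
apply: (measurability _ (RGenOpens.measurableE R)).
move=> _ [_ [a [b ->] <-]]; rewrite setTI.
apply: sub_sigma_algebra.
apply: open_comp; last exact: interval_open.
by move=> x _; exact: coord_continuous.
Qed.

Lemma measurable_sqdist :
  measurable_fun setT
    (fun z : euclid R d * euclid R d => sqdist (z.2 : 'rV[R]_d) z.1).
Proof.
apply: measurable_sum => i; apply: measurable_funX; apply: measurable_funB.
  exact: (measurableT_comp (measurable_coord i)).
exact: (measurableT_comp (measurable_coord i)).
Qed.

Lemma sqdistC (x y : 'rV[R]_d) : sqdist x y = sqdist y x.
Proof. by apply: eq_bigr => i _; rewrite -sqrrN opprB. Qed.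

Lemma sqdist_ge0 (x y : 'rV[R]_d) : 0 <= sqdist x y.
Proof. by apply: sumr_ge0 => i _; exact: sqr_ge0. Qed.

Variables (lam eta : R) (mu nu : probability (euclid R d) R) (A : finType).
Variables (alpha : euclid R d -> A) (c : A -> A -> R) (K : set (euclid R d)).
Hypothesis lam_gt0 : 0 < lam.
Hypothesis malpha : forall a, measurable (alpha @^-1` [set a]).
Hypothesis mK : measurable K.
Hypothesis muK : mu K = 1%E.
Hypothesis nuK : nu K = 1%E.
Hypothesis c_ge0 : forall a b, 0 <= c a b.
Hypothesis eta_ge0 : 0 <= eta.
Hypothesis c_eta : forall x y, K x -> K y ->
  `|sqdist (x : 'rV[R]_d) y - 2 * c (alpha x) (alpha y)| <= 2 * eta.
Let p a := fine (mu (alpha @^-1` [set a])).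
Let q a := fine (nu (alpha @^-1` [set a])).
Variables (u v : A -> R).
Hypothesis rows1 : forall a,
  \sum_b expR ((u a + v b - c a b) / lam) * q b = 1.
Hypothesis cols1 : forall b,
  \sum_a expR ((u a + v b - c a b) / lam) * p a = 1.

Local Notation E := (euclid R d).
Let psi (z : E * E) := (alpha z.1, alpha z.2).

Let mpsi ab : measurable (psi @^-1` [set ab]).
Proof.
rewrite (_ : _ @^-1` _ = (alpha @^-1` [set ab.1]) `*` (alpha @^-1` [set ab.2])).
  exact: measurableX.
by case: ab => a b; apply/seteqP; split => -[x y] /= [ea eb]; [split|congr pair].
Qed.

Section one_coupling.
Variable gamma : probability (E * E)%type R.
Hypothesis cgamma : coupling mu nu gamma.

Let G ab := fine (gamma (psi @^-1` [set ab])).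

Lemma coupling_rowE a : \sum_b G (a, b) = p a.
Proof.
rewrite /p -cgamma.1 //.
have m1 : measurable (fst @^-1` (alpha @^-1` [set a]) : set (E * E)).
  by rewrite -[X in measurable X]setTI; exact: measurable_fst.
have m2 b : measurable ((alpha \o snd : E * E -> A) @^-1` [set b]).
  rewrite -[X in measurable X]setTI comp_preimage; exact: measurable_snd.
rewrite (measure_finite_valued m2 gamma m1) /=; apply: eq_bigr => b _.
rewrite /G; congr (fine (gamma _)); apply/seteqP.
by split => -[x y] /= [ea eb]; [split|congr pair].
Qed.

Lemma coupling_colE b : \sum_a G (a, b) = q b.
Proof.
rewrite /q -cgamma.2 //.
have m1 : measurable (snd @^-1` (alpha @^-1` [set b]) : set (E * E)).
  by rewrite -[X in measurable X]setTI; exact: measurable_snd.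
have m2 a : measurable ((alpha \o fst : E * E -> A) @^-1` [set a]).
  rewrite -[X in measurable X]setTI comp_preimage; exact: measurable_fst.
rewrite (measure_finite_valued m2 gamma m1) /=; apply: eq_bigr => a _.
rewrite /G; congr (fine (gamma _)); apply/seteqP.
by split => -[x y] /= [ea eb]; [split|congr pair].
Qed.

Lemma coupling_sum1 : \sum_ab G ab = 1.
Proof.
have := @probability_setT _ _ _ gamma.
by rewrite (measure_finite_valued mpsi gamma measurableT) => -[] <-;
   apply: eq_bigr => ab _; rewrite setTI.
Qed.

Lemma coupling_int (f : A * A -> R) :
  (\int[gamma]_z (f (psi z))%:E = (\sum_ab f ab * G ab)%:E)%E.
Proof.
rewrite (integral_finite_valued mpsi gamma f measurableT).
by congr EFin; apply: eq_bigr => ab _; rewrite setTI.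
Qed.

(** A sum of one function of each variable has the same integral under every coupling; this is the
    source of weak duality. *)
Lemma coupling_potentials :
  \sum_ab (u ab.1 + v ab.2) * G ab = \sum_a u a * p a + \sum_b v b * q b.
Proof.
under eq_bigr do rewrite mulrDl; rewrite big_split /=; congr (_ + _).
  rewrite sum_pair /=.
  by apply: eq_bigr => a _; rewrite -mulr_sumr coupling_rowE.
rewrite sum_pair exchange_big /=.
by apply: eq_bigr => b _; rewrite -mulr_sumr coupling_colE.
Qed.

Lemma coupling_ae : {ae gamma, forall z,
  `|sqdist (z.2 : 'rV[R]_d) z.1 - 2 * c (alpha z.1) (alpha z.2)| <= 2 * eta}.
Proof.
have mK' : measurable (~` K) by exact: measurableC.
have m1 : measurable (fst @^-1` (~` K) : set (E * E)).
  by rewrite -[X in measurable X]setTI; exact: measurable_fst.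
have m2 : measurable (snd @^-1` (~` K) : set (E * E)).
  by rewrite -[X in measurable X]setTI; exact: measurable_snd.
exists ((fst @^-1` (~` K)) `|` (snd @^-1` (~` K))); split.
- exact: measurableU.
- apply: null_set_setU => //.
    transitivity (mu (~` K)); first exact: cgamma.1.
    by rewrite probability_setC // muK subee.
  transitivity (nu (~` K)); first exact: cgamma.2.
  by rewrite probability_setC // nuK subee.
- move=> z /= zc; apply: contrapT => zK; apply: zc; rewrite sqdistC; apply: c_eta.
    by apply: contrapT => h; apply: zK; left.
  by apply: contrapT => h; apply: zK; right.
Qed.

Lemma coupling_cost_ge :
  ((\sum_ab (2 * c ab.1 ab.2 - 2 * eta) * G ab)%:E <=
   \int[gamma]_z (sqdist (z.2 : 'rV[R]_d) z.1)%:E)%E.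
Proof.
rewrite -(coupling_int (fun ab => 2 * c ab.1 ab.2 - 2 * eta)).
apply: integral_ge_ae.
- exact: (finite_valued_integrable mpsi gamma (fun ab => 2 * c ab.1 ab.2 - 2 * eta)).
- by apply/measurable_EFinP; exact: measurable_sqdist.
- apply: ae_imp coupling_ae => z /=; rewrite lee_fin ler_norml => /andP[+ _].
  lra.
Qed.

Lemma coupling_cost_le :
  (\int[gamma]_z (sqdist (z.2 : 'rV[R]_d) z.1)%:E <=
   (\sum_ab (2 * c ab.1 ab.2 + 2 * eta) * G ab)%:E)%E.
Proof.
rewrite -(coupling_int (fun ab => 2 * c ab.1 ab.2 + 2 * eta)).
apply: ae_ge0_le_integral => //.
- by move=> z _; rewrite lee_fin sqdist_ge0.
- by apply/measurable_EFinP; exact: measurable_sqdist.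
- by move=> z _; rewrite lee_fin addr_ge0 ?mulr_ge0.
- apply/measurable_EFinP.
  exact: (measurable_finite_valued mpsi (fun ab => 2 * c ab.1 ab.2 + 2 * eta)).
- apply: ae_imp coupling_ae => z /= + _; rewrite lee_fin ler_norml => /andP[_].
  lra.
Qed.

End one_coupling.

(** The log-density with respect to [mu \x nu] of the coupling that is optimal for the discretised
    cost. *)
Let g ab := (u ab.1 + v ab.2 - c ab.1 ab.2) / lam.
Let pi := (mu \x nu)%E : probability (E * E)%type R.
Let D := \sum_a u a * p a + \sum_b v b * q b.

Let piX S S' : measurable S -> measurable S' ->
  pi (S `*` S') = (mu S * nu S')%E.
Proof. by move=> mS mS'; exact: product_measure1E. Qed.

Let piE ab : fine (pi (psi @^-1` [set ab])) = p ab.1 * q ab.2.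
Proof.
rewrite (_ : psi @^-1` _ = (alpha @^-1` [set ab.1]) `*` (alpha @^-1` [set ab.2])).
  by rewrite piX // fineM // fin_num_measure.
by case: ab => a b; apply/seteqP; split => -[x y] /= [ea eb]; [split|congr pair].
Qed.

Let sum_p : \sum_a p a = 1.
Proof.
have := @probability_setT _ _ _ mu.
by rewrite (measure_finite_valued malpha mu measurableT) => -[] <-;
   apply: eq_bigr => ab _; rewrite setTI.
Qed.

Let mass1 : \sum_ab expR (g ab) * fine (pi (psi @^-1` [set ab])) = 1.
Proof.
under eq_bigr do rewrite piE.
rewrite sum_pair /=.
rewrite -sum_p; apply: eq_bigr => a _.
by rewrite -[RHS]mul1r -(rows1 a) mulr_suml; apply: eq_bigr => b _; rewrite mulrCA mulrC.
Qed.

(** Weak duality: Gibbs' inequality is applied to [g], whose exponential integrates to 1 by the row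
    equations. Since [2 c + 2 lam g = 2 (u + v)], the cost disappears and only the potentials
    remain. *)
Lemma transport_objective_ge gamma : coupling mu nu gamma ->
  ((2 * D - 2 * eta)%:E <= transport_objective lam mu nu gamma)%E.
Proof.
move=> cg; pose G ab := fine (gamma (psi @^-1` [set ab])).
have Hrel : ((\sum_ab g ab * G ab)%:E <= relative_entropy gamma pi)%E.
  have := @relative_entropy_ge _ _ _ gamma pi (\sum_ab `|g ab|) (g \o psi).
  have mg : measurable_fun setT (g \o psi) by exact: measurable_finite_valued.
  have bg x : `|(g \o psi) x| <= \sum_ab `|g ab|.
    by rewrite (bigD1 (psi x)) //= lerDl sumr_ge0.
  move=> /(_ mg bg); rewrite coupling_int.
  have -> : (\int[pi]_x (expR ((g \o psi) x))%:E = 1)%E.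
    rewrite (integral_finite_valued mpsi pi (fun ab => expR (g ab)) measurableT).
    by rewrite -[in RHS]mass1; congr EFin; apply: eq_bigr => ab _; rewrite setTI.
  by rewrite addeK.
apply: le_trans (leeD (coupling_cost_ge cg) (lee_wpmul2l _ Hrel)); last first.
  by rewrite lee_fin mulr_ge0 // ltW.
rewrite -EFinM -EFinD lee_fin /D -(coupling_potentials cg).
have -> : 2 * (\sum_ab (u ab.1 + v ab.2) * G ab) - 2 * eta =
    \sum_ab (2 * ((u ab.1 + v ab.2) * G ab) - 2 * eta * G ab).
  by rewrite sumrB -!mulr_sumr coupling_sum1 mulr1.
rewrite mulr_sumr -big_split /=.
apply: ler_sum => ab _; rewrite /G /g le_eqVlt; apply/orP; left; apply/eqP.
by field; rewrite gt_eqF.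
Qed.

(** The measure of density [exp g] couples [mu] and [nu] themselves and not only their cell masses:
    the density is constant on products of cells, so integrating out one variable multiplies any
    subset of a cell by a row or column sum, that is by 1. *)
Lemma transport_objective_le : exists2 gamma, coupling mu nu gamma &
  (transport_objective lam mu nu gamma <= (2 * D + 2 * eta)%:E)%E.
Proof.
have [gamma gammaE] := density_exists mpsi (fun ab => expR_ge0 (g ab)) mass1.
have cg : coupling mu nu gamma.
  split=> S mS.
    rewrite gammaE; last by rewrite -[X in measurable X]setTI; exact: measurable_fst.
    rewrite (integral_finite_valued mpsi pi (fun ab => expR (g ab))); last first.
      by rewrite -[X in measurable X]setTI; exact: measurable_fst.
    rewrite (measure_finite_valued malpha mu mS); congr EFin.
    rewrite sum_pair.
    apply: eq_bigr => a _; rewrite -[RHS]mul1r -(rows1 a) mulr_suml.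
    apply: eq_bigr => b _; rewrite -mulrA; congr (_ * _).
    rewrite (_ : _ `&` _ = (S `&` alpha @^-1` [set a]) `*` (alpha @^-1` [set b])).
      transitivity (fine (mu (S `&` alpha @^-1` [set a]) * nu (alpha @^-1` [set b]))%E).
        by congr fine; apply: piX => //; exact: measurableI.
      have mI := measurableI _ _ mS (malpha a).
      rewrite fineM; [exact: mulrC|exact: fin_num_measure|exact: fin_num_measure].
    apply/seteqP; split => -[x y] /=; first by case=> ? [ea eb]; split.
    by case=> -[? ea] eb; split => //; congr pair.
  rewrite gammaE; last by rewrite -[X in measurable X]setTI; exact: measurable_snd.
  rewrite (integral_finite_valued mpsi pi (fun ab => expR (g ab))); last first.
    by rewrite -[X in measurable X]setTI; exact: measurable_snd.
  rewrite (measure_finite_valued malpha nu mS); congr EFin.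
  rewrite sum_pair exchange_big /=.
  apply: eq_bigr => b _; rewrite -[RHS]mul1r -(cols1 b) mulr_suml.
  apply: eq_bigr => a _; rewrite -mulrA; congr (_ * _).
  rewrite (_ : _ `&` _ = (alpha @^-1` [set a]) `*` (S `&` alpha @^-1` [set b])).
    transitivity (fine (mu (alpha @^-1` [set a]) * nu (S `&` alpha @^-1` [set b]))%E).
      by congr fine; apply: piX => //; exact: measurableI.
    have mI := measurableI _ _ mS (malpha b).
    by rewrite fineM; [|exact: fin_num_measure|exact: fin_num_measure].
  apply/seteqP; split => -[x y] /=; first by case=> ? [ea eb]; split.
  by case=> ea [? eb]; split => //; congr pair.
exists gamma => //; rewrite /transport_objective.
rewrite (relative_entropy_density (g := g) mpsi gammaE) coupling_int -EFinM.
apply: le_trans (leeD (coupling_cost_le cg) (lexx _)) _.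
rewrite -EFinD lee_fin /D -(coupling_potentials cg).
pose G ab := fine (gamma (psi @^-1` [set ab])).
have -> : 2 * (\sum_ab (u ab.1 + v ab.2) * G ab) + 2 * eta =
    \sum_ab (2 * ((u ab.1 + v ab.2) * G ab) + 2 * eta * G ab).
  by rewrite big_split /= -!mulr_sumr coupling_sum1 mulr1.
rewrite mulr_sumr -big_split /=.
apply: ler_sum => ab _; rewrite /g /G le_eqVlt; apply/orP; left; apply/eqP.
by field; rewrite gt_eqF.
Qed.

Lemma ot_cost_finite : `|ot_cost lam mu nu - 2 * D| <= 2 * eta.
Proof.
rewrite /ot_cost; set S := [set _ | _ in _].
have lo : ((2 * D - 2 * eta)%:E <= ereal_inf S)%E.
  apply: le_ereal_inf_tmp => _ [gamma cg <-]; exact: transport_objective_ge.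
have hi : (ereal_inf S <= (2 * D + 2 * eta)%:E)%E.
  have [gamma cg] := transport_objective_le; apply: le_trans.
  by apply: ereal_inf_lbound; exists gamma.
(* The two bounds exclude an infinite infimum, which [fine] would send to 0. *)
move: lo hi; case: (ereal_inf S) => [r| |] //=; rewrite !lee_fin ler_norml.
by move=> lo hi; apply/andP; split; lra.
Qed.

End ot_cost_finite.

(** * Finite entropic transport and Sinkhorn's algorithm *)

Section softmin.
Context (R : realType) (I : Type) (J : finType).
Variables (lam : R) (c : I -> J -> R) (q : J -> R).
Hypothesis lam_gt0 : 0 < lam.
Hypothesis q_ge0 : forall j, 0 <= q j.
Hypothesis q1 : \sum_j q j = 1.

Definition gibbs (u : I -> R) (v : J -> R) i j : R :=
  expR ((u i + v j - c i j) / lam).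

(** The formula of [sinkhorn_u] over general index types. [I] need not be finite, so the same
    definition gives functions on the whole space. *)
Definition softmin (v : J -> R) : I -> R := fun i =>
  - (lam * ln (\sum_j expR ((v j - c i j) / lam) * q j)).

Lemma weighted_expR_gt0 (f : J -> R) : 0 < \sum_j expR (f j) * q j.
Proof.
rewrite lt0r sumr_ge0 ?andbT => [|j _]; last by rewrite mulr_ge0 ?expR_ge0.
apply/negP => /eqP s0; have : \sum_j q j = 0; last by rewrite q1 => /eqP; rewrite oner_eq0.
apply: big1 => j _.
have /eqP : expR (f j) * q j = 0.
  by apply: (psumr_eq0P _ s0) => // k _; rewrite mulr_ge0 ?expR_ge0.
by rewrite mulf_eq0 gt_eqF ?expR_gt0 //= => /eqP.
Qed.

Lemma gibbs_softmin v i : \sum_j gibbs (softmin v) v i j * q j = 1.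
Proof.
rewrite /gibbs /softmin; pose S := \sum_j expR ((v j - c i j) / lam) * q j.
rewrite -/S; have S0 : 0 < S by exact: weighted_expR_gt0.
transitivity (\sum_j S^-1 * (expR ((v j - c i j) / lam) * q j)).
  apply: eq_bigr => j _; rewrite mulrA; congr (_ * _).
  have -> : S^-1 = expR (- ln S) by rewrite expRN lnK ?posrE.
  by rewrite -expRD; congr expR; field; rewrite gt_eqF.
by rewrite -mulr_sumr mulVf // gt_eqF.
Qed.

(** A row equation determines [u i]; hence each potential of a Schrodinger system is a softmin of
    the other one, also at indices of zero weight. *)
Lemma softminE u v i : \sum_j gibbs u v i j * q j = 1 -> u i = softmin v i.
Proof.
move=> rows; rewrite /softmin; pose S := \sum_j expR ((v j - c i j) / lam) * q j.
rewrite -/S; have S0 : 0 < S by exact: weighted_expR_gt0.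
have -> : S = expR (- (u i / lam)).
  rewrite -[RHS]mulr1 -rows mulr_sumr; apply: eq_bigr => j _.
  by rewrite mulrA -expRD /gibbs; congr (expR _ * _); field; rewrite gt_eqF.
by rewrite expRK; field; rewrite gt_eqF.
Qed.

(** Each term of the sum changes by at most a factor [exp (C / lam)]. The oscillation is thus
    controlled by the cost alone, whatever [v] is. *)
Lemma softmin_le v i i' (C : R) : (forall j, c i j - c i' j <= C) ->
  softmin v i - softmin v i' <= C.
Proof.
move=> cC; rewrite /softmin; pose S i0 := \sum_j expR ((v j - c i0 j) / lam) * q j.
rewrite -/(S i) -/(S i'); have S0 : 0 < S i by exact: weighted_expR_gt0.
have S'0 : 0 < S i' by exact: weighted_expR_gt0.
suff : ln (S i') - ln (S i) <= C / lam.
  rewrite ler_pdivlMr // => h; rewrite (le_trans _ h) //; lra.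
rewrite lerBlDr -ler_expR lnK ?posrE // expRD lnK ?posrE // /S mulr_sumr.
apply: ler_sum => j _; rewrite mulrA -expRD ler_wpM2r // ler_expR -mulrDl.
rewrite ler_pM2r ?invr_gt0 //; have := cC j; lra.
Qed.

End softmin.

Section entropic_dual.
Context (R : realType) (I J : finType).
Variables (lam : R) (c : I -> J -> R) (p : I -> R) (q : J -> R).
Hypothesis lam_gt0 : 0 < lam.
Hypothesis p_ge0 : forall i, 0 <= p i.
Hypothesis q_ge0 : forall j, 0 <= q j.
Hypothesis p1 : \sum_i p i = 1.
Hypothesis q1 : \sum_j q j = 1.

Local Notation gibbs := (gibbs lam c).

(** The entropic dual objective without its term [lam * (1 - mass)]; the condition on the mass is
    carried as a hypothesis instead. *)
Definition dual_value (u : I -> R) (v : J -> R) : R :=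
  \sum_i u i * p i + \sum_j v j * q j.

(* The concave dual lies below its tangent; the competitor (u', v') only needs
   total mass at most 1, and the v-gradient vanishes at (u, v). *)
Lemma dual_value_tangent u v u' v' :
  \sum_i \sum_j gibbs u' v' i j * q j * p i <= 1 ->
  (forall j, \sum_i gibbs u v i j * p i = 1) ->
  dual_value u' v' - dual_value u v <=
  \sum_i (u' i - u i) * (1 - \sum_j gibbs u v i j * q j) * p i.
Proof.
move=> mass cols.
pose a i := \sum_j gibbs u v i j * q j.
have tangent i j : gibbs u v i j * (1 + ((u' i - u i) + (v' j - v j)) / lam)
    <= gibbs u' v' i j.
  rewrite /gibbs; set x := (u i + _ - _) / lam.
  rewrite (_ : (u' i + v' j - c i j) / lam =
    x + (((u' i - u i) + (v' j - v j)) / lam)); last by rewrite /x; field; rewrite gt_eqF.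
  by rewrite expRD ler_wpM2l ?expR_ge0 // expR_ge1Dx.
have mass1 : \sum_i \sum_j gibbs u v i j * q j * p i = 1.
  rewrite exchange_big /= -[RHS]q1; apply: eq_bigr => j _.
  by under eq_bigr do rewrite mulrAC; rewrite -mulr_suml cols mul1r.
have H : \sum_i \sum_j gibbs u v i j * (1 + ((u' i - u i) + (v' j - v j)) / lam) * q j * p i <= 1.
  apply: le_trans mass; apply: ler_sum => i _; apply: ler_sum => j _.
  by rewrite ler_wpM2r // ler_wpM2r.
have E : \sum_i \sum_j gibbs u v i j * (1 + ((u' i - u i) + (v' j - v j)) / lam) * q j * p i
   = 1 + (\sum_i (u' i - u i) * a i * p i + \sum_j (v' j - v j) * q j) / lam.
  rewrite -[X in _ = X + _]mass1 mulrDl.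
  have -> : (\sum_i (u' i - u i) * a i * p i) / lam =
    \sum_i \sum_j gibbs u v i j * ((u' i - u i) / lam) * q j * p i.
    rewrite mulr_suml; apply: eq_bigr => i _.
    rewrite /a mulr_sumr !mulr_suml; apply: eq_bigr => j _; ring.
  have -> : (\sum_j (v' j - v j) * q j) / lam =
    \sum_i \sum_j gibbs u v i j * ((v' j - v j) / lam) * q j * p i.
    rewrite exchange_big mulr_suml /=; apply: eq_bigr => j _.
    rewrite -[LHS]mulr1 -(cols j) mulr_sumr; apply: eq_bigr => i _; ring.
  rewrite addrA -!big_split; apply: eq_bigr => i _ /=.
  rewrite -!big_split; apply: eq_bigr => j _ /=; ring.
have : (\sum_i (u' i - u i) * a i * p i + \sum_j (v' j - v j) * q j) <= 0.
  by move: H; rewrite E gerDl pmulr_lle0 ?invr_gt0.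
rewrite /dual_value -/a.
have -> : \sum_i (u' i - u i) * (1 - \sum_j gibbs u v i j * q j) * p i =
   (\sum_i u' i * p i - \sum_i u i * p i) - \sum_i (u' i - u i) * a i * p i.
  by rewrite -!sumrB; apply: eq_bigr => i _; rewrite -/(a i); ring.
have -> : \sum_j (v' j - v j) * q j = \sum_j v' j * q j - \sum_j v j * q j.
  by rewrite -sumrB; apply: eq_bigr => j _; ring.
lra.
Qed.

(** The equations are required at every index, also where the weight vanishes. This is what makes
    potentials for one marginal admissible for another. *)
Definition schrodinger u v :=
  (forall i, \sum_j gibbs u v i j * q j = 1) /\
  (forall j, \sum_i gibbs u v i j * p i = 1).

Lemma rows_mass u v : (forall i, \sum_j gibbs u v i j * q j = 1) ->
  \sum_i \sum_j gibbs u v i j * q j * p i = 1.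
Proof. by move=> rows; rewrite -[RHS]p1; apply: eq_bigr => i _; rewrite -mulr_suml rows mul1r. Qed.

Lemma schrodinger_max u v u' v' : schrodinger u v ->
  \sum_i \sum_j gibbs u' v' i j * q j * p i <= 1 ->
  dual_value u' v' <= dual_value u v.
Proof.
move=> [rows cols] mass; rewrite -subr_le0.
apply: le_trans (dual_value_tangent mass cols) _.
by rewrite big1 // => i _; rewrite rows subrr mulr0 mul0r.
Qed.

End entropic_dual.

Section finite_sums.
Context (R : realType) (I : Type).
Implicit Types (r : seq I) (P : pred I).

Lemma sum_cauchy_schwarz r P (x y : I -> R) :
  (\sum_(i <- r | P i) x i * y i) ^+ 2 <=
  (\sum_(i <- r | P i) x i ^+ 2) * (\sum_(i <- r | P i) y i ^+ 2).
Proof.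
set X := \sum_(i <- r | P i) x i ^+ 2; set Y := \sum_(i <- r | P i) y i ^+ 2.
set Z := \sum_(i <- r | P i) x i * y i.
have Y0 : 0 <= Y by apply: sumr_ge0 => i _; exact: sqr_ge0.
have key : Y * (X * Y - Z ^+ 2) = \sum_(i <- r | P i) (Y * x i - Z * y i) ^+ 2.
  have -> : Y * (X * Y - Z ^+ 2) = Y ^+ 2 * X - (2 * Y * Z) * Z + Z ^+ 2 * Y by ring.
  transitivity (\sum_(i <- r | P i)
      (Y ^+ 2 * x i ^+ 2 - 2 * Y * Z * (x i * y i) + Z ^+ 2 * y i ^+ 2)).
    by rewrite big_split sumrB -!mulr_sumr.
  by apply: eq_bigr => i _; ring.
have [Y_gt0|] := ltP 0 Y.
  rewrite -subr_ge0 -(pmulr_rge0 _ Y_gt0) key.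
  by apply: sumr_ge0 => i _; exact: sqr_ge0.
move=> Yle0; have Y_0 : Y = 0 by apply/eqP; rewrite eq_le Yle0.
suff -> : Z = 0 by rewrite expr0n /= mulr_ge0 // sumr_ge0 // => i _; exact: sqr_ge0.
have : forall t, 2 * t * Z <= t ^+ 2 * X.
  move=> t; have : 0 <= \sum_(i <- r | P i) (t * x i - y i) ^+ 2.
    by apply: sumr_ge0 => i _; exact: sqr_ge0.
  suff -> : \sum_(i <- r | P i) (t * x i - y i) ^+ 2 = t ^+ 2 * X - 2 * t * Z + Y.
    by rewrite Y_0; lra.
  transitivity (\sum_(i <- r | P i)
      (t ^+ 2 * x i ^+ 2 - 2 * t * (x i * y i) + y i ^+ 2)).
    by apply: eq_bigr => i _; ring.
  by rewrite big_split sumrB -!mulr_sumr.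
have X0 : 0 <= X by apply: sumr_ge0 => i _; exact: sqr_ge0.
move=> H; apply/eqP; apply: contraT => Z0.
(* A small multiple of [Z] contradicts [H]; the [+ 1] keeps the denominator positive when
   [X = 0]. *)
have := H (Z / (X + 1)).
have X1 : 0 < X + 1 by lra.
rewrite expr_div_n.
have -> : 2 * (Z / (X + 1)) * Z = 2 * (X + 1) * (Z ^+ 2 / (X + 1) ^+ 2).
  by field; rewrite gt_eqF.
rewrite [leRHS]mulrC.
rewrite ler_pM2r; first lra.
by rewrite divr_gt0 ?(exprn_gt0 _ X1) // exprn_even_gt0.
Qed.

End finite_sums.

Section sinkhorn_step.
Context (R : realType) (I J : finType).
Variables (lam : R) (c : I -> J -> R) (p : I -> R) (q : J -> R).
Hypothesis lam_gt0 : 0 < lam.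
Hypothesis p_ge0 : forall i, 0 <= p i.
Hypothesis q_ge0 : forall j, 0 <= q j.
Hypothesis p1 : \sum_i p i = 1.
Hypothesis q1 : \sum_j q j = 1.

Lemma prob_inhabited : exists i : I, true.
Proof.
case: (pickP I) => [i _|I0]; first by exists i.
have : \sum_i p i = 0 by rewrite big_pred0.
by rewrite p1 => /eqP; rewrite oner_eq0.
Qed.

(* Pinsker's inequality up to a constant, through the Hellinger distance
   \sum_i (1 - sqrt (a i))^2 p i. *)
Lemma pinsker (a : I -> R) : (forall i, 0 < a i) -> \sum_i a i * p i = 1 ->
  (\sum_i `|1 - a i| * p i) ^+ 2 <= 4 * \sum_i (- ln (a i)) * p i.
Proof.
move=> a0 a1; pose s i := Num.sqrt (a i).
have s0 i : 0 < s i by rewrite sqrtr_gt0.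
have sE i : a i = s i ^+ 2 by rewrite sqr_sqrtr // ltW.
set N := \sum_i _; pose X := \sum_i (1 - s i) ^+ 2 * p i.
have N0 : 0 <= N by apply: sumr_ge0 => i _; rewrite mulr_ge0.
(* Since [p] and [a p] both have mass 1, [X] equals [\sum_i 2 (1 - s i) p i]; then [1 - s <= - ln s]
   is used. *)
have XL : X <= \sum_i (- ln (a i)) * p i.
  have -> : X = \sum_i (2 * (1 - s i)) * p i.
    have : \sum_i (1 - a i) * p i = 0.
      by under eq_bigr do rewrite mulrBl mul1r; rewrite sumrB p1 a1 subrr.
    move=> e; rewrite -[RHS]subr0 -[X in _ - X]e -sumrB; apply: eq_bigr => i _.
    by rewrite sE; ring.
  apply: ler_sum => i _; rewrite ler_wpM2r // sE lnXn //.
  have := expR_ge1Dx (ln (s i)); rewrite lnK ?posrE // -mulr_natl; lra.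
apply: le_trans (ler_wpM2l _ XL) => //.
(* Cauchy-Schwarz for [|1 - a| = |1 - s| (1 + s)], kept with a free [t]. The 4 comes from
   [(1 + s)^2 <= 2 (1 + a)], whose mean is 4; [t = 4 / N] then gives [N^2 <= 4 X]. *)
have key t : 2 * t * N <= t ^+ 2 * X + 4.
  have -> : t ^+ 2 * X + 4 = \sum_i (t ^+ 2 * (1 - s i) ^+ 2 + 2 * (1 + a i)) * p i.
    under eq_bigr do rewrite mulrDl; rewrite big_split /=; congr (_ + _).
      by rewrite /X mulr_sumr; apply: eq_bigr => i _; rewrite mulrA.
    transitivity (2 * \sum_i p i + 2 * \sum_i a i * p i).
      by rewrite p1 a1; ring.
    by rewrite !mulr_sumr -big_split; apply: eq_bigr => i _ /=; ring.
  rewrite /N mulr_sumr; apply: ler_sum => i _; rewrite mulrA ler_wpM2r //.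
  have -> : 1 - a i = (1 - s i) * (1 + s i) by rewrite sE; ring.
  rewrite normrM (ger0_norm (x := 1 + s i)); last by rewrite addr_ge0 // ltW.
  rewrite sE -[(1 - s i) ^+ 2]real_normK ?num_real //.
  have := sqr_ge0 (t * `|1 - s i| - (1 + s i)).
  have := sqr_ge0 (1 - s i); nra.
have [Npos|] := ltP 0 N; last first.
  move=> Nle; have -> : N = 0 by apply/eqP; rewrite eq_le Nle.
  rewrite expr0n /= mulr_ge0 // sumr_ge0 // => i _; rewrite mulr_ge0 ?sqr_ge0 //.
have := key (4 / N).
have -> : 2 * (4 / N) * N = 8 by field; rewrite gt_eqF.
rewrite expr_div_n -lerBlDr => H.
have H2 : 4 * N ^+ 2 <= 4 ^+ 2 * X.
  have := ler_wpM2r (sqr_ge0 N) H.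
  have -> : 4 ^+ 2 / N ^+ 2 * X * N ^+ 2 = 4 ^+ 2 * X by field; rewrite gt_eqF.
  lra.
lra.
Qed.

(** The gain of a half-step is exactly [lam] times the relative entropy of [p] with respect to the
    current first marginal, and Pinsker's inequality turns it into a squared marginal error. *)
Lemma half_step u v : \sum_i (\sum_j gibbs lam c u v i j * q j) * p i = 1 ->
  lam / 4 * (\sum_i `|1 - \sum_j gibbs lam c u v i j * q j| * p i) ^+ 2 <=
  dual_value p q (softmin lam c q v) v - dual_value p q u v.
Proof.
move=> mass; pose a i := \sum_j gibbs lam c u v i j * q j.
have a0 i : 0 < a i by exact: weighted_expR_gt0.
have uE i : softmin lam c q v i - u i = lam * (- ln (a i)).
  rewrite /softmin; pose S := \sum_j expR ((v j - c i j) / lam) * q j.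
  rewrite -/S; have -> : a i = expR (u i / lam) * S.
    rewrite /a /S mulr_sumr; apply: eq_bigr => j _.
    by rewrite mulrA -expRD /gibbs; congr (expR _ * _); field; rewrite gt_eqF.
  have S0 : 0 < S by exact: weighted_expR_gt0.
  by rewrite lnM ?posrE ?expR_gt0 // expRK; field; rewrite gt_eqF.
have -> : dual_value p q (softmin lam c q v) v - dual_value p q u v =
    lam * \sum_i (- ln (a i)) * p i.
  rewrite /dual_value opprD addrACA subrr addr0 -sumrB mulr_sumr.
  by apply: eq_bigr => i _; rewrite -mulrBl uE mulrA.
rewrite -mulrA ler_pM2l // ler_pdivrMl //; exact: pinsker.
Qed.

End sinkhorn_step.

Lemma continuous_sum (R : realType) (T : topologicalType) (I : Type) (r : seq I)
    (f : I -> T -> R) (x : T) : (forall i, {for x, continuous (f i)}) ->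
  {for x, continuous (fun y => \sum_(i <- r) f i y)}.
Proof.
move=> cf; elim: r => [|i r IH].
  rewrite (_ : (fun y => _) = (fun=> 0)); last first.
    by apply/funext => y; rewrite big_nil.
  exact: cst_continuous.
rewrite (_ : (fun y => _) = (fun y => f i y + \sum_(j <- r) f j y)); last first.
  by apply/funext => y; rewrite big_cons.
exact: (continuousD (cf i) IH).
Qed.

(** * Existence of Schrodinger potentials *)

Section schrodinger_existence.
Context (R : realType) (I J : finType).
Variables (lam : R) (c : I -> J -> R) (p : I -> R) (q : J -> R) (C : R).
Hypothesis lam_gt0 : 0 < lam.
Hypothesis p_ge0 : forall i, 0 <= p i.
Hypothesis q_ge0 : forall j, 0 <= q j.
Hypothesis p1 : \sum_i p i = 1.
Hypothesis q1 : \sum_j q j = 1.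
Hypothesis c_osc : forall i j j', c i j - c i j' <= C.

Let sm v := softmin lam c q v.
Let smT u := softmin lam (fun j i => c i j) p u.

Lemma gibbsC u v i j :
  gibbs lam (fun j i => c i j) v u j i = gibbs lam c u v i j.
Proof. by rewrite /gibbs [v j + _]addrC. Qed.

Lemma dual_valueC u v : dual_value q p v u = dual_value p q u v.
Proof. by rewrite /dual_value addrC. Qed.

Lemma softmin_shift v t i : sm (fun j => v j - t) i = sm v i + t.
Proof.
rewrite /sm /softmin; set S := \sum_(j in J) _; pose S' := \sum_j expR ((v j - c i j) / lam) * q j.
have -> : S = expR (- (t / lam)) * S'.
  rewrite mulr_sumr; apply: eq_bigr => j _; rewrite mulrA -expRD.
  by congr (expR _ * _); field; rewrite gt_eqF.
rewrite lnM ?posrE ?expR_gt0 //; last exact: weighted_expR_gt0.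
by rewrite expRK -/S'; field; rewrite gt_eqF.
Qed.

(** Constants can be exchanged between the two potentials; normalising [v] at one index is what
    brings the maximisation back to a compact box. *)
Lemma dual_value_shift v t :
  dual_value p q (sm (fun j => v j - t)) (fun j => v j - t) = dual_value p q (sm v) v.
Proof.
rewrite /dual_value.
under eq_bigr do rewrite softmin_shift mulrDl.
under [X in _ + X]eq_bigr do rewrite mulrBl.
by rewrite big_split sumrB /= -!mulr_sumr p1 q1 addrACA subrr addr0.
Qed.

Let vec (r : 'rV[R]_#|J|) : J -> R := fun j => r 0 (enum_rank j).

Lemma softmin_dual_continuous :
  continuous (fun r => dual_value p q (sm (vec r)) (vec r) : R).
Proof.
have cvec j : continuous (fun r => vec r j) by exact: coord_continuous.
move=> r; rewrite /dual_value.
apply: continuousD; apply: continuous_sum => i; last first.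
  by apply: continuousM; [exact: cvec|exact: cst_continuous].
apply: continuousM; last exact: cst_continuous.
apply: continuousN; apply: continuousM; first exact: cst_continuous.
apply: (continuous_comp (g := @ln R)); last first.
  by apply: continuous_ln; exact: weighted_expR_gt0.
apply: continuous_sum => j.
apply: continuousM; last exact: cst_continuous.
apply: (continuous_comp (g := @expR R)); last exact: continuous_expR.
apply: continuousM; last exact: cst_continuous.
by apply: continuousB; [exact: cvec|exact: cst_continuous].
Qed.

Lemma softmin_cols_mass v :
  \sum_j (\sum_i gibbs lam (fun j i => c i j) v (sm v) j i * p i) * q j = 1.
Proof.
rewrite -[RHS](rows_mass p1 (u := sm v) (v := v) (lam := lam) (c := c) (q := q));
  last exact: gibbs_softmin.
rewrite exchange_big /=; apply: eq_bigr => j _; rewrite mulr_suml.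
by apply: eq_bigr => i _; rewrite gibbsC mulrAC.
Qed.

(* The dual maximum over a box of normalised potentials is a fixed point,
   since a Sinkhorn step stays in the box and strictly improves otherwise. *)
Lemma schrodinger_exists : exists u v, schrodinger lam c p q u v.
Proof.
have [j0 _] := prob_inhabited q1.
have C0 : 0 <= C by have [i _] := prob_inhabited p1; have := c_osc i j0 j0; rewrite subrr.
pose K := [set r : 'rV[R]_#|J| | forall k, `[- C, C]%classic (r 0 k)].
have cK : compact K by apply: (@rV_compact _ _ (fun=> `[- C, C]%classic)) => k; exact: segment_compact.
have K0 : K !=set0 by exists 0 => k /=; rewrite mxE in_itv /= C0 oppr_le0 C0.
have [r _ rmax] := compact_EVT_max K0 cK
  (continuous_subspaceT softmin_dual_continuous).
pose v0 := vec r; pose v1 := smT (sm v0).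
have v1K : dual_value p q (sm v1) v1 <= dual_value p q (sm v0) v0.
  rewrite -(dual_value_shift v1 (v1 j0)).
  pose r1 : 'rV[R]_#|J| := \row_k (v1 (enum_val k) - v1 j0).
  have -> : (fun j => v1 j - v1 j0) = vec r1.
    by apply/funext => j; rewrite /vec mxE enum_rankK.
  apply: rmax; rewrite inE => k /=; rewrite mxE in_itv /=.
  have osc j j' : v1 j - v1 j' <= C by apply: softmin_le => // i; exact: c_osc.
  by rewrite osc andbT lerNl opprB osc.
have step1 := half_step lam_gt0 q_ge0 p_ge0 q1 p1 (softmin_cols_mass v0).
rewrite !dual_valueC -/(smT _) -/v1 in step1.
have mass1 : \sum_i (\sum_j gibbs lam c (sm v0) v1 i j * q j) * p i = 1.
  under eq_bigr do rewrite mulr_suml; rewrite exchange_big /= -[RHS]q1.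
  apply: eq_bigr => j _; under eq_bigr do rewrite mulrAC -gibbsC.
  by rewrite -mulr_suml gibbs_softmin // mul1r.
have step2 := half_step lam_gt0 p_ge0 q_ge0 p1 q1 mass1.
pose b j := \sum_i gibbs lam (fun j i => c i j) v0 (sm v0) j i * p i.
have bq : \sum_j `|1 - b j| * q j = 0.
  apply/eqP; rewrite -sqrf_eq0 eq_le sqr_ge0 andbT.
  have sq : 0 <= (\sum_i `|1 - \sum_j gibbs lam c (sm v0) v1 i j * q j| * p i) ^+ 2 by exact: sqr_ge0.
  rewrite -(pmulr_rle0 _ (x := lam / 4)); last by rewrite divr_gt0.
  have := mulr_ge0 (ltW (divr_gt0 lam_gt0 (ltr0n R 4))) sq; rewrite /b.
  by move: step1 step2 v1K; rewrite -/(sm v1) -/v0; lra.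
have vq j : v1 j * q j = v0 j * q j.
  have /eqP : `|1 - b j| * q j = 0.
    by apply: (psumr_eq0P _ bq) => // k _; rewrite mulr_ge0.
  rewrite mulf_eq0 normr_eq0 subr_eq0 => /orP[/eqP b1|/eqP->]; last by rewrite !mulr0.
  congr (_ * _); rewrite /v1 /smT.
  by rewrite -(softminE lam_gt0 p_ge0 p1 (esym b1)).
(* [v1] rather than [v0]: they agree where [q] is positive, so the row sums are the same, while
   [v1], a softmin, satisfies the column equations also where [q] vanishes. *)
exists (sm v0), v1; split=> [i|j]; last first.
  by rewrite -[RHS](gibbs_softmin (fun j i => c i j) lam_gt0 p_ge0 p1 (sm v0) j);
    apply: eq_bigr => i _; rewrite gibbsC.
rewrite -[RHS](gibbs_softmin c lam_gt0 q_ge0 q1 v0 i); apply: eq_bigr => j _.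
have /eqP := vq j; rewrite -subr_eq0 -mulrBl mulf_eq0 subr_eq0.
by case/orP => /eqP ev; rewrite /gibbs ev // !mulr0.
Qed.

End schrodinger_existence.

(** * Convergence rate of Sinkhorn's algorithm *)

Section sinkhorn_convergence.
Context (R : realType) (I J : finType).
Variables (lam : R) (c : I -> J -> R) (p : I -> R) (q : J -> R) (C : R).
Hypothesis lam_gt0 : 0 < lam.
Hypothesis p_ge0 : forall i, 0 <= p i.
Hypothesis q_ge0 : forall j, 0 <= q j.
Hypothesis p1 : \sum_i p i = 1.
Hypothesis q1 : \sum_j q j = 1.
Hypothesis C_gt0 : 0 < C.
Hypothesis c_osc : forall i i' j, c i j - c i' j <= C.
Variables (us : I -> R) (vs : J -> R).
Hypothesis us_vs : schrodinger lam c p q us vs.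
Variables (u : nat -> I -> R) (v : nat -> J -> R).
Hypothesis uE : forall k, u k.+1 = softmin lam c q (v k).
Hypothesis vE : forall k, v k.+1 = softmin lam (fun j i => c i j) p (u k.+1).

Let gap k := dual_value p q us vs - dual_value p q (u k) (v k).

Let colsk k j : \sum_i gibbs lam c (u k.+1) (v k.+1) i j * p i = 1.
Proof.
rewrite vE -[RHS](gibbs_softmin (fun j i => c i j) lam_gt0 p_ge0 p1 (u k.+1) j).
by apply: eq_bigr => i _; rewrite gibbsC.
Qed.

Let massk k : \sum_i (\sum_j gibbs lam c (u k.+1) (v k.+1) i j * q j) * p i = 1.
Proof.
under eq_bigr do rewrite mulr_suml; rewrite exchange_big /= -[RHS]q1.
apply: eq_bigr => j _; under eq_bigr do rewrite mulrAC.
by rewrite -mulr_suml colsk mul1r.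
Qed.

Let gap_ge0 k : 0 <= gap k.+1.
Proof.
rewrite subr_ge0; apply: (schrodinger_max lam_gt0 p_ge0 q_ge0 q1 us_vs).
by under eq_bigr do rewrite -mulr_suml; rewrite massk.
Qed.

Let N k := \sum_i `|1 - \sum_j gibbs lam c (u k) (v k) i j * q j| * p i.

(** Concavity bounds the gap by pairing the row defects with [us - u]. The defects have mean zero,
    so only the oscillation of [us - u] counts, and both potentials are softmins of oscillation at
    most [C]. *)
Let gap_le k : gap k.+1 <= 2 * C * N k.+1.
Proof.
have [i0 _] := prob_inhabited p1.
apply: (le_trans (dual_value_tangent lam_gt0 p_ge0 q_ge0 q1 _ (colsk k))).
  by rewrite (rows_mass p1 us_vs.1).
set a := fun i => \sum_j gibbs lam c (u k.+1) (v k.+1) i j * q j.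
have a1 : \sum_i (1 - a i) * p i = 0.
  by under eq_bigr do rewrite mulrBl mul1r; rewrite sumrB p1 massk subrr.
pose w i := us i - u k.+1 i.
rewrite (_ : \sum_i _ = \sum_i (w i - w i0) * (1 - a i) * p i); last first.
  transitivity (\sum_i w i * (1 - a i) * p i - w i0 * \sum_i (1 - a i) * p i).
    by rewrite a1 mulr0 subr0.
  by rewrite mulr_sumr -sumrB; apply: eq_bigr => i _; ring.
have usE i : us i = softmin lam c q vs i.
  by apply: softminE => //; exact: us_vs.1.
have w_osc i i' : w i - w i' <= 2 * C.
  rewrite /w !usE uE.
  have := softmin_le lam_gt0 q_ge0 q1 vs (c_osc i i').
  have := softmin_le lam_gt0 q_ge0 q1 (v k) (c_osc i' i).
  lra.
rewrite mulr_sumr; apply: ler_sum => i _; rewrite mulrA ler_wpM2r //.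
apply: le_trans (ler_norm _) _; rewrite normrM ler_wpM2r //.
by rewrite ler_norml w_osc andbT lerNl opprB w_osc.
Qed.

(** The bound is the gain of the [u] half-step; the [v] half-step adds a nonnegative gain. *)
Let gap_step k : lam / 4 * N k.+1 ^+ 2 <= gap k.+1 - gap k.+2.
Proof.
have h1 := half_step lam_gt0 p_ge0 q_ge0 p1 q1 (massk k).
rewrite -uE in h1.
have m2 : \sum_j (\sum_i gibbs lam (fun j i => c i j) (v k.+1) (u k.+2) j i * p i) * q j = 1.
  by rewrite uE; exact: softmin_cols_mass.
have h2 := half_step lam_gt0 q_ge0 p_ge0 q1 p1 m2.
rewrite [X in _ <= X - _]dual_valueC [X in _ <= _ - X]dual_valueC -vE in h2.
have h3 : 0 <= lam / 4 * (\sum_j `|1 - \sum_i gibbs lam (fun j i => c i j) (v k.+1) (u k.+2) j i * p i| * q j) ^+ 2.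
  by rewrite mulr_ge0 ?sqr_ge0 // divr_ge0 // ltW.
rewrite /gap; move: h1 h2 h3; rewrite -/(N k.+1); lra.
Qed.

Lemma sinkhorn_rate k : 0 <= dual_value p q us vs - dual_value p q (u k.+1) (v k.+1)
  <= 16 * C ^+ 2 / (lam * k.+1%:R).
Proof.
(* [16 C^2 = 4 (2 C)^2]: the gain [lam / 4 * N^2] is expressed through the gap by means of
   [gap <= 2 C N]. *)
rewrite gap_ge0 /= -/(gap k.+1); set ka := lam / (16 * C ^+ 2).
have ka0 : 0 < ka by rewrite divr_gt0 // mulr_gt0 // exprn_gt0.
have -> : 16 * C ^+ 2 / (lam * k.+1%:R) = (ka * k.+1%:R)^-1.
  by rewrite /ka; field; rewrite !gt_eqF.
have rec j : ka * gap j.+1 ^+ 2 <= gap j.+1 - gap j.+2.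
  apply: le_trans (gap_step j).
  have -> : lam / 4 * N j.+1 ^+ 2 = ka * (2 * C * N j.+1) ^+ 2.
    by rewrite /ka; field; rewrite gt_eqF.
  by rewrite ler_pM2l // ler_sqr ?nnegrE ?gap_le // (le_trans (gap_ge0 j)) ?gap_le.
suff : ka * k.+1%:R * gap k.+1 <= 1.
  by rewrite -[(_ * _)^-1]mulr1 ler_pdivlMl // mulr_gt0.
elim: k => [|k IH].
  have := rec 0; have := gap_ge0 1; have := gap_ge0 0; rewrite mulr1.
  set x := gap 1; set y := gap 2 => x0 y0 H.
  have [->|xn0] := eqVneq x 0; first by rewrite mulr0.
  have xpos : 0 < x by rewrite lt_neqAle eq_sym xn0.
  rewrite -(ler_pM2r xpos) mul1r (_ : ka * x * x = ka * x ^+ 2); [lra|ring].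
have := rec k; have := gap_ge0 k; have := gap_ge0 k.+1.
have -> : k.+2%:R = k.+1%:R + 1 :> R by rewrite natr1.
move: IH; set x := gap k.+1; set y := gap k.+2; set t := k.+1%:R : R => IH y0 x0 H.
have t0 : 0 < t by rewrite ltr0n.
have : ka * (t + 1) * y <= ka * (t + 1) * (x - ka * x ^+ 2).
  rewrite ler_pM2l; first lra.
  by rewrite mulr_gt0 // addr_gt0.
move/le_trans; apply.
have t1 : 1 <= t by rewrite ler1n.
have kx0 : 0 <= ka * x by rewrite mulr_ge0 // ltW.
have kx1 : ka * x <= 1.
  by apply: le_trans IH; rewrite -mulrA mulrCA ler_peMl.
(* With [z = ka * x], the identity is [(1 - t z) (1 - z) + z^2 = 1 - (t + 1) z (1 - z)], and the
   induction hypothesis says [t z <= 1]. *)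
have : 0 <= (1 - t * (ka * x)) * (1 - ka * x) + (ka * x) ^+ 2.
  by rewrite addr_ge0 ?sqr_ge0 // mulr_ge0 // subr_ge0 // mulrCA mulrA.
rewrite (_ : _ + _ = 1 - ka * (t + 1) * (x - ka * x ^+ 2)); last by ring.
by rewrite subr_ge0.
Qed.

End sinkhorn_convergence.

(** * Perturbation of the cost and of the marginals *)

Section perturbation.
Context (R : realType) (I J : finType).
Variables (lam : R) (p : I -> R) (q : J -> R).
Hypothesis lam_gt0 : 0 < lam.
Hypothesis p_ge0 : forall i, 0 <= p i.
Hypothesis q_ge0 : forall j, 0 <= q j.
Hypothesis p1 : \sum_i p i = 1.
Hypothesis q1 : \sum_j q j = 1.

(** Lowering [u'] by [eta] makes up for a cost [c] that may be smaller than [c'], so the shifted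
    pair still has mass at most 1 for [c]. *)
Lemma dual_value_cost (c c' : I -> J -> R) eta u v u' v' :
  (forall i j, c' i j - c i j <= eta) ->
  schrodinger lam c p q u v -> schrodinger lam c' p q u' v' ->
  dual_value p q u' v' - eta <= dual_value p q u v.
Proof.
move=> cc' uv uv'.
have -> : dual_value p q u' v' - eta = dual_value p q (fun i => u' i - eta) v'.
  rewrite /dual_value; under [X in _ = X + _]eq_bigr do rewrite mulrBl.
  by rewrite sumrB -mulr_sumr p1; ring.
apply: (schrodinger_max lam_gt0 p_ge0 q_ge0 q1 uv).
rewrite -[leRHS](rows_mass p1 uv'.1); apply: ler_sum => i _; apply: ler_sum => j _.
rewrite ler_wpM2r // ler_wpM2r // ler_expR ler_pM2r ?invr_gt0 //.
have := cc' i j; lra.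
Qed.

Lemma dual_value_cost_dist (c c' : I -> J -> R) eta u v u' v' :
  (forall i j, `|c i j - c' i j| <= eta) ->
  schrodinger lam c p q u v -> schrodinger lam c' p q u' v' ->
  `|dual_value p q u v - dual_value p q u' v'| <= eta.
Proof.
move=> cc' uv uv'.
have H1 : dual_value p q u' v' - eta <= dual_value p q u v.
  apply: dual_value_cost uv uv' => i j.
  by have := cc' i j; rewrite ler_norml => /andP[]; lra.
have H2 : dual_value p q u v - eta <= dual_value p q u' v'.
  apply: dual_value_cost uv' uv => i j.
  by have := cc' i j; rewrite ler_norml => /andP[]; lra.
by rewrite ler_norml; apply/andP; split; lra.
Qed.

(* The rows of the system for (p', q) sum to 1 at every index, so u', v' is
   admissible for (p, q) too. *)
Lemma dual_value_marginal (c : I -> J -> R) (p' : I -> R) u v u' v' :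
  schrodinger lam c p q u v -> schrodinger lam c p' q u' v' ->
  dual_value p' q u' v' - dual_value p q u v <= \sum_i u' i * (p' i - p i).
Proof.
move=> uv uv'.
have : dual_value p q u' v' <= dual_value p q u v.
  by apply: (schrodinger_max lam_gt0 p_ge0 q_ge0 q1 uv); rewrite (rows_mass p1 uv'.1).
rewrite /dual_value.
have -> : \sum_i u' i * (p' i - p i) = \sum_i u' i * p' i - \sum_i u' i * p i.
  by rewrite -sumrB; apply: eq_bigr => i _; rewrite mulrBr.
lra.
Qed.

End perturbation.

Section merging.
Context (R : realType) (I J A B : finType).
Variables (lam : R) (p : I -> R) (q : J -> R) (f : I -> A) (g : J -> B).
Variable c : A -> B -> R.
Let pA a := \sum_(i | f i == a) p i.
Let qB b := \sum_(j | g j == b) q j.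

Lemma sum_merge (K D : finType) (h : K -> D) (w : K -> R) (F : D -> R) :
  \sum_k F (h k) * w k = \sum_d F d * \sum_(k | h k == d) w k.
Proof.
rewrite (partition_big h xpredT) //=; apply: eq_bigr => d _.
by rewrite mulr_sumr; apply: eq_bigr => k /eqP ->.
Qed.

(** Points of a common cell have the same cost, so cell potentials pull back to points. This links
    the [n] sample points on which Sinkhorn's algorithm runs to their cell frequencies. *)
Lemma schrodinger_merge u v : schrodinger lam c pA qB u v ->
  schrodinger lam (fun i j => c (f i) (g j)) p q (u \o f) (v \o g).
Proof.
move=> [rows cols]; split=> [i|j].
  by rewrite -(rows (f i)) -(sum_merge g q (fun b => gibbs lam c u v (f i) b)).
by rewrite -(cols (g j)) -(sum_merge f p (fun a => gibbs lam c u v a (g j))).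
Qed.

Lemma dual_value_merge u v :
  dual_value p q (u \o f) (v \o g) = dual_value pA qB u v.
Proof. by rewrite /dual_value -!sum_merge. Qed.

End merging.

(** * Regularity of softmin potentials *)

Section taylor.
Context (R : realType).

Lemma antiderivative_poly (P : {poly R}) (s : nat) (t0 y0 : R) : (size P <= s)%N ->
  exists Q : {poly R}, [/\ (size Q <= s.+1)%N, Q^`() = P & Q.[t0] = y0].
Proof.
move=> sP; pose Q0 : {poly R} := \poly_(i < s.+1) (P`_i.-1 / i%:R * (i != 0)%:R).
have dQ0 : Q0^`() = P.
  apply/polyP => i; rewrite coef_deriv coef_poly ltnS /= mulr1.
  case: ltnP => [_|si]; last by rewrite mul0rn nth_default // (leq_trans sP).
  by rewrite -[LHS]mulr_natr divfK // pnatr_eq0.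
exists (Q0 + (y0 - Q0.[t0])%:P); split.
- rewrite (leq_trans (size_polyD _ _)) // geq_max size_poly /=.
  by rewrite (leq_trans (size_polyC_leq1 _)).
- by rewrite derivD derivC addr0.
- by rewrite hornerD hornerC addrCA subrr addr0.
Qed.

Lemma abs_le_of_derivative (g g' : R -> R) (M t0 : R) (s : nat) :
  (forall t : R, is_derive t 1 g (g' t)) -> g t0 = 0 -> 0 <= M ->
  (forall t, `|g' t| <= M * `|t - t0| ^+ s) ->
  forall t, `|g t| <= M * `|t - t0| ^+ s.+1.
Proof.
move=> dg g0 M0 g'M t.
have cg (a b : R) : {within `[a, b], continuous g}.
  apply: continuous_subspaceT => x.
  by apply: differentiable_continuous; apply/derivable1_diffP; case: (dg x).
have [->|ne] := eqVneq t t0.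
  by rewrite g0 normr0 mulr_ge0 // exprn_ge0.
have /orP[lt|gt] : (t < t0) || (t0 < t) by rewrite -neq_lt.
- have [x xt] := MVT lt (fun x _ => dg x) (cg t t0).
  rewrite g0 sub0r => e; rewrite -normrN e normrM exprSr mulrA [`|t - t0|]distrC.
  rewrite ler_wpM2r //.
  apply: le_trans (g'M x) _; rewrite ler_wpM2l // lerXn2r ?nnegrE //.
  move: xt; rewrite in_itv /= => /andP[x1 x2].
  by rewrite [leLHS]distrC (gtr0_norm (x := t0 - x)) ?(gtr0_norm (x := t0 - t)) ?subr_gt0 // lerD2l lerN2 ltW.
- have [x xt] := MVT gt (fun x _ => dg x) (cg t0 t).
  rewrite g0 subr0 => ->; rewrite normrM exprSr mulrA ler_wpM2r //.
  apply: le_trans (g'M x) _; rewrite ler_wpM2l // lerXn2r ?nnegrE //.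
  move: xt; rewrite in_itv /= => /andP[x1 x2].
  by rewrite (gtr0_norm (x := x - t0)) ?(gtr0_norm (x := t - t0)) ?subr_gt0 // lerD2r ltW.
Qed.

(** The polynomial is an antiderivative of the one for [f 1], adjusted at [t0], and the mean value
    theorem raises the order of the error by one. The successive derivatives are given as a
    sequence, with the relation between them as a hypothesis. *)
Lemma taylor_poly (s : nat) (f : nat -> R -> R) (M t0 : R) : 0 <= M ->
  (forall j (t : R), is_derive t 1 (f j) (f j.+1 t)) -> (forall t, `|f s t| <= M) ->
  exists2 P : {poly R}, (size P <= s)%N &
    forall t, `|f 0%N t - P.[t]| <= M * `|t - t0| ^+ s.
Proof.
move=> M0; elim: s f => [|s IH] f df fM.
  by exists 0 => [|t]; rewrite ?size_poly0 // horner0 subr0 mulr1.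
have [P sP HP] := IH (fun j => f j.+1) (fun j => df j.+1) fM.
have [Q [sQ dQ Q0]] := antiderivative_poly t0 (f 0%N t0) sP.
exists Q => // t.
apply: (abs_le_of_derivative (g := fun t => f 0%N t - Q.[t])
  (g' := fun t => f 1%N t - P.[t]) (t0 := t0)) => //; last by rewrite Q0 subrr.
by move=> x; rewrite -dQ; apply: is_deriveB.
Qed.

End taylor.

(* Derivatives of log-partition functions are universal polynomials in the
   moments of the tilted measure. *)
Inductive mexpr := Mom of nat | MAdd of mexpr & mexpr | MMul of mexpr & mexpr | MOpp of mexpr.

Fixpoint mderiv e := match e with
  | Mom k => MAdd (Mom k.+1) (MOpp (MMul (Mom k) (Mom 1)))
  | MAdd e1 e2 => MAdd (mderiv e1) (mderiv e2)
  | MMul e1 e2 => MAdd (MMul (mderiv e1) e2) (MMul e1 (mderiv e2))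
  | MOpp e1 => MOpp (mderiv e1)
  end.

(** Bounds the expression whenever all moments lie in [-1, 1]. Depending on the expression alone, it
    makes the derivative bounds independent of the weights. *)
Fixpoint mbound e : nat := match e with
  | Mom _ => 1
  | MAdd e1 e2 => mbound e1 + mbound e2
  | MMul e1 e2 => mbound e1 * mbound e2
  | MOpp e1 => mbound e1
  end.

Section log_partition.
Context (R : realType) (J : finType) (W zeta : J -> R).
Hypothesis W_ge0 : forall b, 0 <= W b.
Hypothesis W_gt0 : 0 < \sum_b W b.
Hypothesis zeta_le1 : forall b, `|zeta b| <= 1.

Fixpoint meval (m : nat -> R) e : R := match e with
  | Mom k => m k
  | MAdd e1 e2 => meval m e1 + meval m e2
  | MMul e1 e2 => meval m e1 * meval m e2
  | MOpp e1 => - meval m e1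
  end.

Lemma meval_le (m : nat -> R) e : (forall k, `|m k| <= 1) ->
  `|meval m e| <= (mbound e)%:R.
Proof.
move=> m1; elim: e => //= [e1 h1 e2 h2|e1 h1 e2 h2|e h].
- by rewrite natrD (le_trans (ler_normD _ _)) // lerD.
- by rewrite natrM normrM ler_pM.
- by rewrite normrN.
Qed.

Definition tilted (k : nat) (t : R) : R := \sum_b W b * zeta b ^+ k * expR (t * zeta b).
Definition moment k t : R := tilted k t / tilted 0 t.

Lemma tilted0_gt0 t : 0 < tilted 0 t.
Proof.
have [b Wb] : exists b, 0 < W b.
  apply: contrapT => /forallNP h; move: W_gt0; rewrite big1 ?ltxx // => b _.
  by apply/eqP; rewrite eq_le W_ge0 andbT leNgt; apply/negP/h.
rewrite /tilted (bigD1 b) //= ltr_wpDr ?mulr1 //; last first.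
  by rewrite mulr_gt0 // expR_gt0.
by apply: sumr_ge0 => i _; rewrite mulr1 mulr_ge0 // expR_ge0.
Qed.

Lemma moment_le1 k t : `|moment k t| <= 1.
Proof.
rewrite /moment normrM normfV (gtr0_norm (tilted0_gt0 t)).
rewrite ler_pdivrMr ?tilted0_gt0 // mul1r (le_trans (ler_norm_sum _ _ _)) //.
apply: ler_sum => b _; rewrite mulr1 !normrM (ger0_norm (W_ge0 b)).
rewrite (ger0_norm (expR_ge0 _)) -mulrA ler_wpM2l // ler_piMl ?expR_ge0 //.
by rewrite normrX exprn_ile1.
Qed.

Lemma is_derive_sumr (I : Type) (r : seq I) (f f' : I -> R -> R) (t : R) :
  (forall i, is_derive t 1 (f i) (f' i t)) ->
  is_derive t 1 (fun x => \sum_(i <- r) f i x) (\sum_(i <- r) f' i t).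
Proof.
move=> df; elim: r => [|i r IH].
  rewrite big_nil (_ : (fun x => _) = cst 0); last by apply/funext => x; rewrite big_nil.
  exact: is_derive_cst.
rewrite big_cons (_ : (fun x => _) = f i + (fun x => \sum_(i <- r) f i x)); last first.
  by apply/funext => x; rewrite big_cons.
exact: is_deriveD.
Qed.

Lemma is_derive_tilted k (t : R) : is_derive t 1 (tilted k) (tilted k.+1 t).
Proof.
apply: (@is_derive_sumr _ _ (fun b t => W b * zeta b ^+ k * expR (t * zeta b))
  (fun b t => W b * zeta b ^+ k.+1 * expR (t * zeta b))) => b.
have dz : is_derive t 1 (fun x : R => x * zeta b) (zeta b).
  by apply: is_derive_eq; rewrite scaler0 add0r /GRing.scale /= mulr1.
have de := @is_derive1_comp R expR (fun x => x * zeta b) t _ _ (is_derive_expR _) dz.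
rewrite (_ : (fun t0 => _) = (W b * zeta b ^+ k) *: (expR \o (fun x => x * zeta b))) //.
apply: is_derive_eq; rewrite /GRing.scale /= exprSr; ring.
Qed.

Lemma is_derive_moment k (t : R) :
  is_derive t 1 (moment k) (moment k.+1 t - moment k t * moment 1 t).
Proof.
have Z0 := tilted0_gt0 t.
have dV := is_deriveV (lt0r_neq0 Z0) (is_derive_tilted 0 t).
have dM := is_deriveM (is_derive_tilted k t) dV.
apply: (is_derive_eq (f := moment k)) dM _.
rewrite /moment /GRing.scale /=; field; exact: lt0r_neq0.
Qed.

Lemma is_derive_meval e (t : R) :
  is_derive t 1 (fun t => meval (moment^~ t) e) (meval (moment^~ t) (mderiv e)).
Proof.
elim: e => [k|e1 h1 e2 h2|e1 h1 e2 h2|e h] /=.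
- exact: is_derive_moment.
- exact: is_deriveD.
- have := is_deriveM h1 h2; rewrite /GRing.scale /= => h.
  apply: is_derive_eq h _; ring.
- exact: is_deriveN.
Qed.

Lemma log_partition_taylor (s : nat) (t0 : R) : (0 < s)%N ->
  exists2 P : {poly R}, (size P <= s)%N & forall t,
    `|ln (\sum_b W b * expR (t * zeta b)) - P.[t]| <=
    (mbound (iter s.-1 mderiv (Mom 1)))%:R * `|t - t0| ^+ s.
Proof.
move=> s0.
have ZE t : \sum_b W b * expR (t * zeta b) = tilted 0 t.
  by apply: eq_bigr => b _; rewrite mulr1.
pose f j t := if j is j'.+1 then meval (moment^~ t) (iter j' mderiv (Mom 1))
  else ln (tilted 0 t).
have df j (t : R) : is_derive t 1 (f j) (f j.+1 t).
  case: j => [|j] /=; last exact: is_derive_meval.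
  have dln := is_derive1_ln (tilted0_gt0 t).
  have := @is_derive1_comp R (@ln R) (tilted 0) t _ _ dln (is_derive_tilted 0 t).
  rewrite (_ : f 0%N = @ln R \o tilted 0) // => h.
  by apply: (is_derive_eq h); rewrite /moment mulrC.
have fs t : `|f s t| <= (mbound (iter s.-1 mderiv (Mom 1)))%:R.
  by case: s s0 => // s _ /=; apply: meval_le => k; exact: moment_le1.
have [P sP HP] := taylor_poly t0 (ler0n _ _) df fs.
by exists P => // t; rewrite ZE; exact: HP.
Qed.

End log_partition.

Section potential_lines.
Context (R : realType) (d : nat) (J : finType).
Implicit Type x : 'I_d -> R.

Definition update x (i : 'I_d) (t : R) : 'I_d -> R := fun k => if k == i then t else x k.

Definition half_sqdist x y : R := 2^-1 * \sum_i (x i - y i) ^+ 2.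

Definition potential lam (q : J -> R) (z : J -> 'I_d -> R) (v : J -> R) : ('I_d -> R) -> R :=
  softmin lam (fun x b => half_sqdist x (z b)) q v.

(** Degree below [s] accommodates the quadratic exactly from [s = 3] on; for [s = 1] and [s = 2] it
    is replaced by its value and its tangent at [t0]. *)
Lemma half_sqr_taylor (s : nat) (B t0 : R) : (0 < s)%N -> `|t0| <= B ->
  exists2 P : {poly R}, (size P <= s)%N & forall t, `|t| <= B ->
    `|t ^+ 2 / 2 - P.[t]| <= (B + 1) * `|t - t0| ^+ s.
Proof.
move=> s0 t0B; have B0 : 0 <= B by exact: le_trans t0B.
case: s s0 => [//|[|[|s]]] _.
- exists (t0 ^+ 2 / 2)%:P; first by rewrite size_polyC_leq1.
  move=> t tB; rewrite hornerC.
  rewrite (_ : _ - _ = (t + t0) / 2 * (t - t0)); last by field.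
  rewrite normrM ler_wpM2r // normrM (ger0_norm (x := 2^-1)) ?invr_ge0 //.
  have := ler_normD t t0; lra.
- exists (t0 *: 'X + (- (t0 ^+ 2 / 2))%:P).
    rewrite (leq_trans (size_polyD _ _)) // geq_max.
    rewrite (leq_trans (size_scale_leq _ _)) ?size_polyX //=.
    by rewrite (leq_trans (size_polyC_leq1 _)).
  move=> t tB; rewrite hornerD hornerZ hornerX hornerC.
  rewrite (_ : _ - _ = 2^-1 * (t - t0) ^+ 2); last by field.
  rewrite normrM normrX ler_wpM2r ?exprn_ge0 // ger0_norm ?invr_ge0 //; lra.
- exists (2^-1 *: 'X^2).
    by rewrite (leq_trans (size_scale_leq _ _)) // size_polyXn.
  move=> t tB; rewrite hornerZ hornerXn mulrC subrr normr0 mulr_ge0 ?exprn_ge0 //; lra.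
Qed.

(** The second term absorbs the quadratic part of the potential, which has no factor [lam^(1 - s)]:
    multiplying by [lamM^(s - 1)] makes up for it as [lam <= lamM]. *)
Definition line_const (s : nat) (L B lamM : R) : R :=
  (mbound (iter s.-1 mderiv (Mom 1)))%:R * L ^+ s + (B + 1) * lamM ^+ s.-1.

Variables (lam : R) (q : J -> R) (z : J -> 'I_d -> R) (v : J -> R) (L : R).
Hypothesis lam_gt0 : 0 < lam.
Hypothesis q_ge0 : forall b, 0 <= q b.
Hypothesis q1 : \sum_b q b = 1.
Hypothesis L_gt0 : 0 < L.
Hypothesis zL : forall b i, `|z b i| <= L.

(** On a coordinate line the squares factor out of the softmin, leaving [t^2 / 2 - lam * ln Z] with
    [Z] a partition function in the variable [t L / lam]. Rescaling costs [(L / lam)^s], and the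
    prefactor gives one power of [lam] back. *)
Lemma potential_line (s : nat) (B lamM t0 : R) x i : (0 < s)%N -> `|t0| <= B ->
  lam <= lamM ->
  exists2 P : {poly R}, (size P <= s)%N & forall t, `|t| <= B ->
    `|potential lam q z v (update x i t) - P.[t]| <=
      line_const s L B lamM * (lam ^+ s.-1)^-1 * `|t - t0| ^+ s.
Proof.
move=> s0 t0B lamlamM.
pose rest b := 2^-1 * \sum_(k | k != i) (x k - z b k) ^+ 2.
pose W b := expR ((v b - z b i ^+ 2 / 2 - rest b) / lam) * q b.
pose zeta b := z b i / L.
have W0 b : 0 <= W b by rewrite mulr_ge0 ?expR_ge0.
have WS : 0 < \sum_b W b by exact: weighted_expR_gt0.
have zeta1 b : `|zeta b| <= 1.
  by rewrite normrM normfV (gtr0_norm L_gt0) ler_pdivrMr // mul1r.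
have UE t : potential lam q z v (update x i t) =
    t ^+ 2 / 2 - lam * ln (\sum_b W b * expR (t * (L / lam) * zeta b)).
  have Z0 : 0 < \sum_b W b * expR (t * (L / lam) * zeta b).
    have := tilted0_gt0 zeta W0 WS (t * (L / lam)); rewrite /tilted.
    by under eq_bigr do rewrite mulr1.
  rewrite /potential /softmin.
  have -> : \sum_j expR ((v j - half_sqdist (update x i t) (z j)) / lam) * q j =
      expR (- (t ^+ 2 / 2 / lam)) * \sum_b W b * expR (t * (L / lam) * zeta b).
    rewrite mulr_sumr; apply: eq_bigr => b _.
    rewrite /W; set e1 := expR (- _); set e2 := expR ((v b - _ - _) / _).
    set e3 := expR (t * _ * _).
    rewrite (_ : e1 * _ = e1 * e2 * e3 * q b); last by ring.
    rewrite -!expRD; congr (expR _ * _).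
    rewrite /half_sqdist (bigD1 i) //= {1}/update eqxx.
    rewrite (eq_bigr (fun k => (x k - z b k) ^+ 2)); last first.
      by move=> k /negbTE ki; rewrite /update ki.
    rewrite /zeta /rest; field; by rewrite !gt_eqF.
  rewrite lnM ?posrE ?expR_gt0 // expRK; field; by rewrite gt_eqF.
have [P1 sP1 HP1] := half_sqr_taylor s0 t0B.
have [P2 sP2 HP2] := log_partition_taylor W0 WS zeta1 (t0 * (L / lam)) s0.
exists (P1 - lam *: (P2 \Po ((L / lam) *: 'X))).
  rewrite (leq_trans (size_polyD _ _)) // geq_max sP1 size_polyN.
  rewrite (leq_trans (size_scale_leq _ _)) // size_comp_poly2 //.
  by rewrite size_scale ?size_polyX // mulf_neq0 ?invr_eq0 ?gt_eqF.
move=> t tB; rewrite UE hornerD hornerN hornerZ horner_comp hornerZ hornerX.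
rewrite [L / lam * t]mulrC; set lnZ := ln _; set p2 := P2.[_].
rewrite (_ : _ - _ = (t ^+ 2 / 2 - P1.[t]) - lam * (lnZ - p2)); last by ring.
apply: le_trans (ler_normB _ _) _.
have H1 := HP1 t tB; have := HP2 (t * (L / lam)); rewrite -/lnZ -/p2.
rewrite -mulrBl normrM (gtr0_norm (divr_gt0 L_gt0 lam_gt0)) exprMn => H2.
rewrite normrM (gtr0_norm lam_gt0).
set e := `|t - t0| ^+ s in H1 H2 *.
have e0 : 0 <= e by rewrite exprn_ge0.
have lamE : lam ^+ s = lam * lam ^+ s.-1 by rewrite -exprS prednK.
have l0 : 0 < lam ^+ s.-1 by rewrite exprn_gt0.
have B0 : 0 <= B by exact: le_trans t0B.
rewrite /line_const !mulrDl addrC; apply: lerD.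
  apply: le_trans (ler_wpM2l (ltW lam_gt0) H2) _.
  rewrite expr_div_n lamE le_eqVlt; apply/orP; left; apply/eqP.
  by field; rewrite !gt_eqF.
apply: le_trans H1 _; rewrite -!mulrDl ler_wpM2r // -mulrA ler_peMr ?addr_ge0 //.
rewrite ler_pdivlMr // mul1r lerXn2r // nnegrE; first exact: ltW.
by rewrite (le_trans (ltW lam_gt0)).
Qed.

Lemma half_sqdist_ge0 x y : 0 <= half_sqdist x y.
Proof. by rewrite mulr_ge0 ?invr_ge0 // sumr_ge0 // => i _; exact: sqr_ge0. Qed.

Lemma half_sqdist_le x y (B : R) : (forall i, `|x i| <= B) -> (forall i, `|y i| <= B) ->
  half_sqdist x y <= d%:R * (2 * B ^+ 2).
Proof.
move=> xB yB; rewrite /half_sqdist.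
rewrite (_ : d%:R * _ = 2^-1 * \sum_(i < d) (4 * B ^+ 2)); last first.
  by rewrite sumr_const card_ord -mulr_natl; field.
rewrite ler_wpM2l ?invr_ge0 // ler_sum // => i _.
have := xB i; have := yB i; rewrite !ler_norml => /andP[y1 y2] /andP[x1 x2].
nra.
Qed.

Lemma potential_osc (B : R) x y : L <= B -> (forall i, `|x i| <= B) -> (forall i, `|y i| <= B) ->
  `|potential lam q z v x - potential lam q z v y| <= d%:R * (2 * B ^+ 2).
Proof.
move=> LB xB yB.
have zB b i : `|z b i| <= B by exact: le_trans LB.
have h x' y' : (forall i, `|x' i| <= B) ->
    potential lam q z v x' - potential lam q z v y' <= d%:R * (2 * B ^+ 2).
  move=> x'B; apply: softmin_le => // b.
  by rewrite (le_trans _ (half_sqdist_le x'B (zB b))) // lerBlDr lerDl half_sqdist_ge0.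
by rewrite ler_norml h // andbT lerNl opprB h.
Qed.

End potential_lines.

(** * Interpolation *)

Section lagrange.
Context (R : realType) (s : nat).
Hypothesis s_gt0 : (0 < s)%N.

Definition lagp (m : 'I_s) : {poly R} :=
  \prod_(k < s | k != m) ((m%:R - k%:R)^-1 *: ('X - k%:R%:P)).

Lemma lagp_node (m k : 'I_s) : (lagp m).[k%:R] = (k == m)%:R.
Proof.
rewrite /lagp horner_prod; have [->|km] := eqVneq k m.
  rewrite big1 // => i im; rewrite hornerZ hornerXsubC mulVf //.
  by rewrite subr_eq0 eqr_nat eq_sym.
by rewrite (bigD1 k) //= hornerZ hornerXsubC subrr mulr0 mul0r.
Qed.

Lemma size_lagp m : (size (lagp m) <= s)%N.
Proof.
rewrite /lagp; apply: (leq_trans (size_poly_prod_leq _ _)).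
rewrite (eq_bigr (fun=> 2%N)); last first.
  move=> k km; rewrite size_scale ?size_XsubC // invr_eq0 subr_eq0 eqr_nat.
  by rewrite eq_sym.
rewrite sum_nat_const.
set N := #|_|; have -> : N = s.-1 by rewrite /N (cardC1 m) card_ord.
by rewrite muln2 -addnn -addSn addnK prednK.
Qed.

Lemma lagrange_poly (P : {poly R}) : (size P <= s)%N ->
  P = \sum_(m < s) P.[m%:R] *: lagp m.
Proof.
move=> sP; apply/eqP; rewrite -subr_eq0; apply/eqP.
pose rs := [seq k%:R | k : 'I_s] : seq R.
apply: (@roots_geq_poly_eq0 _ _ rs).
- apply/allP => _ /mapP[k _ ->]; rewrite rootE hornerD hornerN horner_sum.
  rewrite (bigD1 k) //= hornerZ lagp_node eqxx mulr1 big1 ?addr0 ?subrr //.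
  by move=> m mk; rewrite hornerZ lagp_node eq_sym (negbTE mk) mulr0.
- rewrite map_inj_uniq ?enum_uniq // => i j /eqP; rewrite eqr_nat => /eqP.
  exact: val_inj.
- rewrite size_map -cardE card_ord (leq_trans (size_polyD _ _)) //.
  rewrite geq_max sP size_polyN (leq_trans (size_sum _ _ _)) //.
  apply/bigmax_leqP => m _; exact: leq_trans (size_scale_leq _ _) (size_lagp m).
Qed.

(** Lagrange weights on the unit interval for the nodes [m / s] with [m < s]; the right end point is
    not a node. *)
Definition lagw (tau : R) (m : 'I_s) : R := (lagp m).[s%:R * tau].

Lemma lagw_interp (P : {poly R}) (a h tau : R) : (size P <= s)%N -> h != 0 ->
  \sum_m lagw tau m * P.[a + h * (m%:R / s%:R)] = P.[a + h * tau].
Proof.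
move=> sP h0; have s0 : s%:R != 0 :> R by rewrite pnatr_eq0 -lt0n.
pose Q := P \Po ((h / s%:R) *: 'X + a%:P).
have sQ : (size Q <= s)%N.
  rewrite size_comp_poly2 // size_polyDl ?size_scale ?size_polyX //.
    by rewrite mulf_neq0 ?invr_eq0.
    by rewrite (leq_trans _ (ltnSn 1)) // ltnS size_polyC_leq1.
  by rewrite mulf_neq0 ?invr_eq0.
have QE t : Q.[t] = P.[a + h * (t / s%:R)].
  rewrite horner_comp hornerD hornerZ hornerX hornerC; congr (P.[_]).
  by rewrite addrC; congr (_ + _); field.
have -> : P.[a + h * tau] = Q.[s%:R * tau].
  by rewrite QE; congr (_.[_]); field.
rewrite [in RHS](lagrange_poly sQ) horner_sum; apply: eq_bigr => m _.
by rewrite hornerZ QE mulrC.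
Qed.

Lemma sum_lagw tau : \sum_m lagw tau m = 1.
Proof.
have := @lagw_interp 1 0 1 tau; rewrite size_poly1 => /(_ s_gt0 (oner_neq0 _)).
rewrite hornerC => <-; apply: eq_bigr => m _; by rewrite hornerC mulr1.
Qed.

Lemma lagw_le tau m : 0 <= tau <= 1 -> `|lagw tau m| <= s%:R ^+ s.
Proof.
move=> /andP[tau0 tau1]; rewrite /lagw /lagp horner_prod normr_prod.
have s1 : 1 <= s%:R :> R by rewrite ler1n.
apply: (@le_trans _ _ (\prod_(k < s | k != m) s%:R)).
  apply: ler_prod => k km; rewrite normr_ge0 /= hornerZ hornerXsubC normrM normfV.
  have dist1 : 1 <= `|m%:R - k%:R| :> R.
    rewrite ler_normr.
    have /orP[h|h] : (m < k)%N || (k < m)%N by rewrite -neq_ltn eq_sym.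
      have h' : m%:R + 1 <= k%:R :> R by rewrite natr1 ler_nat.
      by apply/orP; right; lra.
    have h' : k%:R + 1 <= m%:R :> R by rewrite natr1 ler_nat.
    by apply/orP; left; lra.
  rewrite mulrC ler_pdivrMr ?(lt_le_trans ltr01) //.
  apply: (@le_trans _ _ s%:R); last by rewrite ler_peMr ?(le_trans ler01).
  have kS : k%:R <= s%:R :> R by rewrite ler_nat ltnW.
  have k0 : 0 <= k%:R :> R by rewrite ler0n.
  rewrite ler_norml; apply/andP; split; nra.
rewrite prodr_const; apply: ler_weXn2l => //.
by rewrite (leq_trans (max_card _)) ?card_ord.
Qed.

Definition lag_const : R := s%:R * s%:R ^+ s.

Lemma sum_abs_lagw tau : 0 <= tau <= 1 -> \sum_m `|lagw tau m| <= lag_const.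
Proof.
move=> h; apply: (@le_trans _ _ (\sum_(m < s) s%:R ^+ s)).
  by apply: ler_sum => m _; exact: lagw_le.
by rewrite sumr_const card_ord -[leLHS]mulr_natl.
Qed.

Lemma lag_const_ge1 : 1 <= lag_const.
Proof. by rewrite /lag_const -natrX -natrM ler1n muln_gt0 expn_gt0 s_gt0. Qed.

End lagrange.

(** * Exponential moments of sums over an independent sample *)

Section product_weights.
Context (R : realType) (I A : finType) (w : I -> A -> R).
Implicit Type m : {ffun I -> A}.

(** Serves both for the law of an independent sample and for tensor products of Lagrange weights,
    which are signed. *)
Definition prod_weight m := \prod_i w i (m i).

Definition ffun_set m (i0 : I) (t : A) : {ffun I -> A} :=
  [ffun i => if i == i0 then t else m i].

Lemma sum_prod_weight : \sum_m prod_weight m = \prod_i \sum_t w i t.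
Proof. by rewrite bigA_distr_bigA. Qed.

(* Averaging over the coordinate i0: swapping (m i0, t) leaves the joint weight
   invariant. *)
Lemma prod_weight_average i0 (G : {ffun I -> A} -> R) : \sum_t w i0 t = 1 ->
  \sum_m prod_weight m * G m =
  \sum_m prod_weight m * \sum_t w i0 t * G (ffun_set m i0 t).
Proof.
move=> w1.
transitivity (\sum_(mt : {ffun I -> A} * A) prod_weight mt.1 * w i0 mt.2 * G mt.1).
  rewrite -(pair_bigA _ (fun m t => prod_weight m * w i0 t * G m)) /=.
  by apply: eq_bigr => m _; rewrite -mulr_suml -mulr_sumr w1 mulr1.
pose h (mt : {ffun I -> A} * A) := (ffun_set mt.1 i0 mt.2, mt.1 i0).
have hK : involutive h.
  move=> [m t]; rewrite /h /=; congr (_, _); last by rewrite ffunE eqxx.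
  by apply/ffunP => i; rewrite !ffunE; case: eqP => // ->.
rewrite (reindex_inj (inv_inj hK)) /=.
have -> : \sum_m prod_weight m * \sum_t w i0 t * G (ffun_set m i0 t) =
    \sum_m \sum_t prod_weight m * w i0 t * G (ffun_set m i0 t).
  by apply: eq_bigr => m _; rewrite mulr_sumr; apply: eq_bigr => t _; rewrite mulrA.
rewrite (pair_bigA _ (fun m t => prod_weight m * w i0 t * G (ffun_set m i0 t))) /=.
apply: eq_bigr => -[m t] _ /=; congr (_ * _).
rewrite /prod_weight (bigD1 i0) //= [in RHS](bigD1 i0) //= ffunE eqxx.
rewrite (eq_bigr (fun i => w i (m i))); first by ring.
by move=> i /negbTE ii0; rewrite ffunE ii0.
Qed.

End product_weights.

(** For a centred variable the linear term averages to 0, which leaves a subgaussian bound. *)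
Lemma expR_le_add_sqr (R : realType) (x : R) : expR x <= x + expR (2 * x ^+ 2).
Proof.
have sq : 1 + 2 * x ^+ 2 <= expR (2 * x ^+ 2) by exact: expR_ge1Dx.
have [x1|x1] := lerP 1 x.
  have : expR x <= expR (2 * x ^+ 2) by rewrite ler_expR; nra.
  lra.
have [x0|x0] := lerP x 0.
  suff : expR x <= 1 + x + 2 * x ^+ 2 by lra.
  rewrite -[x]opprK expRN; set y := - x.
  have y0 : 0 <= y by rewrite oppr_ge0.
  have e1 : 1 + y <= expR y by exact: expR_ge1Dx.
  have ey : 0 < expR y by exact: expR_gt0.
  rewrite -[(expR y)^-1]mul1r ler_pdivrMr //.
  have : (1 - y + 2 * (- y) ^+ 2) * (1 + y) <= (1 - y + 2 * (- y) ^+ 2) * expR y.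
    by rewrite ler_wpM2l //; nra.
  apply: le_trans; nra.
suff : expR x <= 1 + x + 2 * x ^+ 2 by lra.
(* The bound [exp z <= 1 / (1 - z)], taken at half of [x] and squared, stays below [1 + x + 2 x^2]
   up to [x = 1]; taken at [x] itself it would blow up there. *)
pose z := x / 2; have -> : x = z + z by rewrite /z; field.
have z0 : 0 < z by rewrite divr_gt0.
have z1 : z < 2^-1 by rewrite /z; lra.
have e1 : 1 - z <= expR (- z) by have := expR_ge1Dx (- z).
have pz : 0 < 1 - z by lra.
have e2 : expR z <= (1 - z)^-1.
  by rewrite -[z in leLHS]opprK expRN lef_pV2 // posrE expR_gt0.
rewrite expRD; apply: (@le_trans _ _ ((1 - z)^-1 * (1 - z)^-1)).
  by rewrite ler_pM ?expR_ge0.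
rewrite -invfM -[X in X <= _]mul1r ler_pdivrMr ?mulr_gt0 //.
have : 0 <= z ^+ 2 * ((1 - 2 * z) * (5 - 4 * z)).
  by rewrite mulr_ge0 ?sqr_ge0 // mulr_ge0; lra.
move=> F0; rewrite -subr_ge0.
rewrite (_ : _ - 1 = z ^+ 2 * ((1 - 2 * z) * (5 - 4 * z))) //; ring.
Qed.

Section concentration.
Context (R : realType) (A K : finType) (n : nat) (p : A -> R).
Variables (xi : A -> K -> R) (B2 : R).
Hypothesis p_ge0 : forall a, 0 <= p a.
Hypothesis p1 : \sum_a p a = 1.
Hypothesis xi_mean : forall k, \sum_a p a * xi a k = 0.
Hypothesis B2_gt0 : 0 < B2.
Hypothesis xi_norm : forall a, \sum_k xi a k ^+ 2 <= B2.

Definition sample_weight (m : {ffun 'I_n -> A}) : R := prod_weight (fun=> p) m.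

Lemma sample_weight_ge0 m : 0 <= sample_weight m.
Proof. exact: prodr_ge0. Qed.

Lemma sum_sample_weight : \sum_m sample_weight m = 1.
Proof. by rewrite sum_prod_weight big1. Qed.

Let S (j : nat) (m : {ffun 'I_n -> A}) k := \sum_(i < n | (i < j)%N) xi (m i) k.
Let Q j m := \sum_k S j m k ^+ 2.

(** The effect of one more observation: its own square costs at most [B2], and the cross term is
    centred, so by the subgaussian bound it only increases the coefficient [al] slightly. *)
Let expR_step (al : R) (s : K -> R) : 0 <= al ->
  \sum_a p a * expR (al * \sum_k (s k + xi a k) ^+ 2) <=
  expR (al * B2) * expR (al * (1 + 8 * al * B2) * \sum_k s k ^+ 2).
Proof.
move=> al0; set q := \sum_k s k ^+ 2.
pose x a := 2 * al * \sum_k s k * xi a k.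
have H a : expR (al * \sum_k (s k + xi a k) ^+ 2) <=
    expR (al * B2) * expR (al * q) * (x a + expR (8 * al ^+ 2 * B2 * q)).
  have -> : \sum_k (s k + xi a k) ^+ 2 =
      q + (\sum_k xi a k ^+ 2) + 2 * \sum_k s k * xi a k.
    rewrite /q mulr_sumr -!big_split; apply: eq_bigr => k _ /=; ring.
  rewrite (_ : al * _ = al * (\sum_k xi a k ^+ 2) + al * q + x a); last first.
    by rewrite /x; ring.
  rewrite !expRD -!mulrA ler_pM ?expR_ge0 ?mulr_ge0 ?expR_ge0 //.
    by rewrite ler_expR ler_wpM2l.
  rewrite ler_wpM2l ?expR_ge0 //.
  apply: le_trans (expR_le_add_sqr _) _; rewrite lerD2l ler_expR.
  have CS := sum_cauchy_schwarz (index_enum K) xpredT s (xi a).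
  have q0 : 0 <= q by apply: sumr_ge0 => k _; exact: sqr_ge0.
  have : (\sum_k s k * xi a k) ^+ 2 <= q * B2.
    by apply: le_trans CS _; rewrite ler_wpM2l.
  move=> h; rewrite /x exprMn exprMn.
  have := ler_wpM2l (sqr_ge0 al) h; lra.
apply: (@le_trans _ _ (\sum_a p a * (expR (al * B2) * expR (al * q) *
    (x a + expR (8 * al ^+ 2 * B2 * q))))).
  by apply: ler_sum => a _; rewrite ler_wpM2l.
rewrite le_eqVlt; apply/orP; left; apply/eqP.
under eq_bigr do rewrite mulrCA; rewrite -mulr_sumr.
under eq_bigr do rewrite mulrDr; rewrite big_split /= -mulr_suml p1 mul1r.
have -> : \sum_a p a * x a = 0.
  transitivity (\sum_k 2 * al * s k * \sum_a p a * xi a k).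
    under [RHS]eq_bigr do rewrite mulr_sumr; rewrite exchange_big /=.
    apply: eq_bigr => a _; rewrite /x !mulr_sumr; apply: eq_bigr => k _; ring.
  by apply: big1 => k _; rewrite xi_mean mulr0.
by rewrite add0r -mulrA -expRD; congr (_ * expR _); ring.
Qed.

(** Each observation turns [al] into [al * (1 + 8 * al * B2)]; the factor 16 in the smallness
    condition leaves room for this growth over [j] steps. *)
Let mgf_S j (al : R) : (j <= n)%N -> 0 <= al -> 16 * al * B2 * j%:R <= 1 ->
  \sum_m sample_weight m * expR (al * Q j m) <= expR (2 * al * B2 * j%:R).
Proof.
elim: j al => [|j IH] al jn al0 small.
  rewrite mulr0 expR0; under eq_bigr => m _.
    rewrite (_ : Q 0 m = 0); last first.
      by apply: big1 => k _; rewrite /S big_pred0 // expr0n.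
    rewrite mulr0 expR0 mulr1; over.
  by rewrite sum_sample_weight.
pose i0 := Ordinal jn.
rewrite /sample_weight (@prod_weight_average _ _ _ (fun=> p) i0) //.
have SE m t k : S j.+1 (ffun_set m i0 t) k = S j m k + xi t k.
  rewrite /S (bigD1 i0) //= ffunE eqxx addrC; congr (_ + _).
  apply: eq_big => i; first by rewrite -val_eqE /= ltnS ltn_neqAle andbC.
  by case/andP => _ /negbTE ii0; rewrite ffunE ii0.
have small' : 16 * al * B2 * j%:R <= 1.
  apply: le_trans small; rewrite ler_wpM2l ?ler_nat //.
  by rewrite !mulr_ge0 // ltW.
have B0 := ltW B2_gt0.
have al'0 : 0 <= al * (1 + 8 * al * B2) by rewrite mulr_ge0 // addr_ge0 // !mulr_ge0.
have al'small : 16 * (al * (1 + 8 * al * B2)) * B2 * j%:R <= 1.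
  have e1 : 16 * al * B2 <= (j.+1%:R)^-1.
    by rewrite -[_^-1]mul1r ler_pdivlMr ?ltr0n.
  set t := j%:R; have t0 : 0 <= t :> R by rewrite ler0n.
  have tE : j.+1%:R = t + 1 :> R by rewrite natr1.
  rewrite tE in e1 small; set y := 16 * al * B2 in e1 small *.
  have y0 : 0 <= y by rewrite !mulr_ge0.
  rewrite (_ : _ * t = y * t * (1 + y / 2)); last by rewrite /y; field.
  have yt : y * t <= 1 - y by lra.
  apply: (@le_trans _ _ ((1 - y) * (1 + y / 2))).
    by rewrite ler_wpM2r //; lra.
  nra.
apply: (@le_trans _ _ (\sum_m prod_weight (fun=> p) m * (expR (al * B2) *
    expR (al * (1 + 8 * al * B2) * Q j m)))).
  apply: ler_sum => m _; rewrite ler_wpM2l ?sample_weight_ge0 //.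
  have := expR_step (S j m) al0.
  by under eq_bigr => a _ do under eq_bigr => k _ do rewrite -SE.
under eq_bigr do rewrite mulrCA; rewrite -mulr_sumr.
apply: (@le_trans _ _ (expR (al * B2) * expR (2 * (al * (1 + 8 * al * B2)) * B2 * j%:R))).
  by rewrite ler_wpM2l ?expR_ge0 //; exact: IH (ltnW jn) _ _.
rewrite -expRD ler_expR -natr1; set t := j%:R : R in small' *.
have h : al * B2 * (16 * al * B2 * t) <= al * B2 * 1 by rewrite ler_wpM2l // mulr_ge0.
by rewrite -subr_ge0; move: h; rewrite -subr_ge0; congr (_ <= _); ring.
Qed.

(* The n = 0 case is harmless: the sum is then empty and 1 / 0 = 0. *)
Lemma mgf_sum_sqr :
  \sum_m sample_weight m * expR ((16 * B2 * n%:R)^-1 *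
     \sum_k (\sum_i xi (m i) k) ^+ 2) <= expR 1.
Proof.
have B0 := ltW B2_gt0.
have small : 16 * (16 * B2 * n%:R)^-1 * B2 * n%:R <= 1.
  have [->|n0] := eqVneq n 0; first by rewrite mulr0.
  rewrite le_eqVlt; apply/orP; left; apply/eqP; field.
  by rewrite pnatr_eq0 n0 gt_eqF.
have inv0 : 0 <= (16 * B2 * n%:R)^-1 by rewrite invr_ge0 !mulr_ge0.
have := mgf_S (leqnn n) inv0 small.
under eq_bigr => m _.
  rewrite (_ : Q n m = \sum_k (\sum_i xi (m i) k) ^+ 2); last first.
    apply: eq_bigr => k _; congr (_ ^+ 2); apply: eq_bigl => i.
    exact: ltn_ord.
  over.
move/le_trans; apply; rewrite ler_expR.
apply: le_trans small; rewrite -!mulrA ler_wpM2r //.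
  by rewrite !mulr_ge0 // invr_ge0 !mulr_ge0.
by rewrite ler_nat.
Qed.

End concentration.

(** * Multiscale expansion on dyadic cubes *)

Section tensor_interpolation.
Context (R : realType) (d s : nat).
Hypothesis s_gt0 : (0 < s)%N.
Implicit Types (a x tau : 'I_d -> R) (h : R) (m : {ffun 'I_d -> 'I_s}).
Local Notation Lam := (lag_const R s).

Definition affine a h tau : 'I_d -> R := fun i => a i + h * tau i.
Definition node a h m : 'I_d -> R := affine a h (fun i => (m i)%:R / s%:R).
Definition lagprod tau m : R := prod_weight (fun i => lagw (tau i)) m.
(** [tau] is a local coordinate: this is the value at [affine a h tau] of the tensor interpolant on
    the cube with corner [a] and side [h]. *)
Definition interp (f : ('I_d -> R) -> R) a h tau : R :=
  \sum_m lagprod tau m * f (node a h m).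

Lemma sum_lagprod tau : \sum_m lagprod tau m = 1.
Proof. by rewrite sum_prod_weight big1 // => i _; exact: sum_lagw. Qed.

Lemma sum_abs_lagprod tau : (forall i, 0 <= tau i <= 1) ->
  \sum_m `|lagprod tau m| <= Lam ^+ d.
Proof.
move=> tau01.
under eq_bigr do rewrite /lagprod /prod_weight normr_prod.
rewrite -(bigA_distr_bigA (fun i k => `|lagw (tau i) k|)) -[d in leRHS]card_ord -prodr_const.
by apply: ler_prod => i _; rewrite sumr_ge0 //= sum_abs_lagw.
Qed.

Lemma sum_sqr_lagprod tau : (forall i, 0 <= tau i <= 1) ->
  \sum_m lagprod tau m ^+ 2 <= (Lam ^+ d) ^+ 2.
Proof.
move=> tau01; have S := sum_abs_lagprod tau01.
have le1 m : `|lagprod tau m| <= Lam ^+ d.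
  by apply: le_trans S; rewrite (bigD1 m) //= lerDl sumr_ge0.
apply: (@le_trans _ _ (\sum_m Lam ^+ d * `|lagprod tau m|)).
  by apply: ler_sum => m _; rewrite -real_normK ?num_real // expr2 ler_wpM2r.
rewrite -mulr_sumr expr2 ler_wpM2l // exprn_ge0 //.
exact: le_trans ler01 (lag_const_ge1 _ s_gt0).
Qed.

Lemma interpB f g a h tau :
  interp (fun x => f x - g x) a h tau = interp f a h tau - interp g a h tau.
Proof. by rewrite -sumrB; apply: eq_bigr => m _; rewrite mulrBr. Qed.

Lemma interp_cst (c : R) a h tau : interp (fun=> c) a h tau = c.
Proof. by rewrite /interp -mulr_suml sum_lagprod mul1r. Qed.

(** Coordinates are moved to the nodes one at a time, and each of the [d] moves is a one-dimensional
    interpolation. [Lam ^+ d] bounds the absolute mass of the signed weights. *)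
Lemma interp_error (f : ('I_d -> R) -> R) a h tau (eps : R) : h != 0 ->
  (forall i, 0 <= tau i <= 1) ->
  (forall x i, exists2 P : {poly R}, (size P <= s)%N &
     forall t, 0 <= t <= 1 -> `|f (update x i (a i + h * t)) - P.[a i + h * t]| <= eps) ->
  `|f (affine a h tau) - interp f a h tau| <= d%:R * (Lam ^+ d * ((1 + Lam) * eps)).
Proof.
move=> h0 tau01 fP.
(* In hyb k m the first k coordinates are already at the nodes. *)
pose hyb (k : nat) m := affine a h (fun i : 'I_d => if (i < k)%N then (m i)%:R / s%:R else tau i).
pose H k := \sum_m lagprod tau m * f (hyb k m).
have node01 (k : 'I_s) : 0 <= (k%:R / s%:R : R) <= 1.
  rewrite divr_ge0 //= ler_pdivrMr ?ltr0n // mul1r ler_nat; exact: ltnW.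
have H0 : f (affine a h tau) = H 0.
  by rewrite -[LHS]mul1r -(sum_lagprod tau) mulr_suml.
have Hd : interp f a h tau = H d.
  by apply: eq_bigr => m _; congr (_ * f _); apply/funext => i; rewrite /hyb /affine ltn_ord.
have step (k : 'I_d) : `|H k - H k.+1| <= Lam ^+ d * ((1 + Lam) * eps).
  pose G m := f (hyb k m) - f (hyb k.+1 m).
  have -> : H k - H k.+1 = \sum_m lagprod tau m * G m.
    by rewrite -sumrB; apply: eq_bigr => m _; rewrite mulrBr.
  rewrite /lagprod (@prod_weight_average _ _ _ _ k) ?sum_lagw //.
  apply: (@le_trans _ _ (\sum_m `|lagprod tau m| * ((1 + Lam) * eps))).
    rewrite (le_trans (ler_norm_sum _ _ _)) //; apply: ler_sum => m _.
    rewrite normrM ler_wpM2l //.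
    have hk t : hyb k (ffun_set m k t) = hyb k m.
      apply/funext => i; rewrite /hyb /affine ffunE; case: ltnP => // ik.
      by case: eqP => // ei; rewrite ei ltnn in ik.
    have hk1 t : hyb k.+1 (ffun_set m k t) = update (hyb k m) k (a k + h * (t%:R / s%:R)).
      apply/funext => i; rewrite /hyb /affine /update ffunE.
      case: eqP => [->|ik]; first by rewrite ltnSn.
      by rewrite ltnS leq_eqVlt val_eqE (introF eqP ik).
    have hyk : hyb k m = update (hyb k m) k (a k + h * tau k).
      apply/funext => i; rewrite /update; case: eqP => // ->.
      by rewrite /hyb /affine ltnn.
    under eq_bigr do rewrite /G hk hk1 mulrBr.
    rewrite sumrB -mulr_suml sum_lagw // mul1r.
    have [P sP HP] := fP (hyb k m) k.
    have -> : f (hyb k m) - \sum_(t < s) lagw (tau k) t * f (update (hyb k m) k (a k + h * (t%:R / s%:R)))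
      = (f (update (hyb k m) k (a k + h * tau k)) - P.[a k + h * tau k]) -
        \sum_(t < s) lagw (tau k) t * (f (update (hyb k m) k (a k + h * (t%:R / s%:R)))
                                 - P.[a k + h * (t%:R / s%:R)]).
      rewrite -hyk; under [in RHS]eq_bigr do rewrite mulrBr.
      by rewrite sumrB lagw_interp //; ring.
    rewrite (le_trans (ler_normB _ _)) // mulrDl mul1r lerD // ?HP //.
    rewrite (le_trans (ler_norm_sum _ _ _)) //.
    apply: (@le_trans _ _ (\sum_t `|lagw (tau k) t| * eps)).
      by apply: ler_sum => t _; rewrite normrM ler_wpM2l // HP.
    rewrite -mulr_suml ler_wpM2r ?sum_abs_lagw //.
    by have := HP (tau k) (tau01 k); apply: le_trans.
  rewrite -mulr_suml ler_wpM2r ?sum_abs_lagprod //.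
  have L1 := lag_const_ge1 R s_gt0.
  have [P sP HP] := fP tau k.
  have e0 : 0 <= eps by apply: le_trans (HP (tau k) (tau01 k)).
  by rewrite mulr_ge0 // addr_ge0 // (le_trans ler01).
rewrite H0 Hd.
suff : forall n, (n <= d)%N -> `|H 0 - H n| <= n%:R * (Lam ^+ d * ((1 + Lam) * eps)).
  by apply.
elim=> [|n IH] nd; first by rewrite subrr normr0 mul0r.
rewrite -(subrKA (H n)) (le_trans (ler_normD _ _)) // -natr1 mulrDl mul1r.
by apply: lerD; [exact: IH (ltnW nd)|exact: (step (Ordinal nd))].
Qed.

(** The interpolant has degree below [s] in each variable, so interpolating it again on another cube
    changes nothing. The weights being products, this is checked coordinate by coordinate. *)
Lemma interp_reproduce (f : ('I_d -> R) -> R) a h a' h' tau : h != 0 -> h' != 0 ->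
  interp (fun x => interp f a h (fun i => (x i - a i) / h)) a' h' tau =
  interp f a h (fun i => (affine a' h' tau i - a i) / h).
Proof.
move=> h0 h'0; rewrite /interp.
under eq_bigr do rewrite mulr_sumr; rewrite exchange_big /=.
apply: eq_bigr => m _.
under eq_bigr do rewrite mulrA; rewrite -mulr_suml; congr (_ * _).
under eq_bigr do rewrite /lagprod /prod_weight -big_split /=.
rewrite -(bigA_distr_bigA (fun i k => lagw (tau i) k *
  lagw ((a' i + h' * (k%:R / s%:R) - a i) / h) (m i))).
apply: eq_bigr => i _.
pose P := lagp R (m i) \Po ((s%:R / h) *: 'X - (s%:R / h * a i)%:P).
have s0 : s%:R != 0 :> R by rewrite pnatr_eq0 -lt0n.
have sh : s%:R / h != 0 by rewrite mulf_neq0 ?invr_eq0.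
have sP : (size P <= s)%N.
  rewrite size_comp_poly2 ?size_lagp // -polyCN size_polyDl ?size_scale ?size_polyX //.
  by rewrite (leq_trans _ (ltnSn 1)) // ltnS size_polyC_leq1.
have PE (t : R) : P.[t] = lagw ((t - a i) / h) (m i).
  rewrite horner_comp hornerD hornerN hornerZ hornerX hornerC /lagw; congr (_.[_]).
  by field.
by rewrite -PE -(lagw_interp s_gt0 _ _ sP h'0); apply: eq_bigr => k _; rewrite PE.
Qed.

End tensor_interpolation.

Section dyadic_cubes.
Context (R : realType) (d s : nat) (L : R) (J : nat).
Hypothesis s_gt0 : (0 < s)%N.
Hypothesis L_gt0 : 0 < L.

(** There are [2 ^ j + 1] indices per direction: the last one receives the points of the face at
    [L]. Its cube sticks out of the box, whence the radius [3 * L] below. *)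
Definition cubes (j : nat) := {ffun 'I_d -> 'I_(2 ^ j).+1}.

Definition side (j : nat) : R := 2 * L / 2 ^+ j.
Definition corner j (Q : cubes j) : 'I_d -> R := fun i => - L + side j * (Q i)%:R.

(* The fine grid cells are the cubes of level J; a cell stands for its corner. *)
Definition ancestor j (a : cubes J) : cubes j := [ffun i => inord (a i %/ 2 ^ (J - j))].
Definition parent j (Q : cubes j.+1) : cubes j := [ffun i => inord (Q i %/ 2)].
Definition local j (a : cubes J) : 'I_d -> R :=
  fun i => (a i %% 2 ^ (J - j))%:R / 2 ^+ (J - j).

Lemma side_gt0 j : 0 < side j.
Proof. by rewrite divr_gt0 ?exprn_gt0 // mulr_gt0. Qed.

Lemma side_half j : side j = 2 * side j.+1.
Proof. by rewrite /side exprS; field; rewrite expf_neq0. Qed.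

Lemma ancestor_val j (a : cubes J) i : (j <= J)%N ->
  ancestor j a i = (a i %/ 2 ^ (J - j))%N :> nat.
Proof.
move=> jJ; rewrite ffunE inordK // ltnS -(leq_pmul2r (m := 2 ^ (J - j))) ?expn_gt0 //.
by rewrite -expnD subnKC // (leq_trans (leq_trunc_div _ _)) // -ltnS.
Qed.

Lemma parent_val j (Q : cubes j.+1) i : parent Q i = (Q i %/ 2)%N :> nat.
Proof.
rewrite ffunE inordK // ltnS -(leq_pmul2r (m := 2)) //.
by rewrite -expnSr (leq_trans (leq_trunc_div _ _)) // -ltnS.
Qed.

Lemma parent_ancestor j (a : cubes J) : (j < J)%N -> parent (ancestor j.+1 a) = ancestor j a.
Proof.
move=> jJ; apply/ffunP => i; apply/val_inj; rewrite /= parent_val !ancestor_val ?(ltnW jJ) //.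
by rewrite -divnMA -expnSr subnSK.
Qed.

Lemma corner_local j (a : cubes J) : (j <= J)%N ->
  affine (corner (ancestor j a)) (side j) (local j a) = corner a.
Proof.
move=> jJ; apply/funext => i; rewrite /affine /corner /local ancestor_val //.
set D := (2 ^ (J - j))%N.
have DE : D%:R = 2 ^+ (J - j) :> R by rewrite natrX.
have D0 : D%:R != 0 :> R by rewrite pnatr_eq0 -lt0n expn_gt0.
rewrite -DE -addrA -mulrDr; congr (_ + _).
rewrite {3}(divn_eq (a i) D) natrD natrM.
have -> : side J = side j / D%:R.
  by rewrite /side DE -{1}(subnKC jJ) exprD; field; rewrite !expf_neq0.
by field.
Qed.

Lemma local01 j a i : 0 <= local j a i <= 1.
Proof.
rewrite /local divr_ge0 ?exprn_ge0 //= ler_pdivrMr ?exprn_gt0 // mul1r.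
by rewrite -natrX ler_nat ltnW // ltn_mod expn_gt0.
Qed.

Lemma corner_bound j (Q : cubes j) i t : 0 <= t <= 1 -> `|corner Q i + side j * t| <= 3 * L.
Proof.
move=> /andP[t0 t1]; rewrite /corner.
have sQ0 : 0 <= side j * (Q i)%:R by rewrite mulr_ge0 // ltW // side_gt0.
have sQ1 : side j * (Q i)%:R <= 2 * L.
  rewrite /side -mulrA ler_piMr //; first by rewrite mulr_ge0 // ltW.
  by rewrite mulrC ler_pdivrMr ?exprn_gt0 // mul1r -natrX ler_nat -ltnS.
have s2 : side j <= 2 * L.
  rewrite /side ler_piMr //; first by rewrite mulr_ge0 // ltW.
  by rewrite invf_le1 ?exprn_gt0 // exprn_ege1 // ler1n.
have st0 : 0 <= side j * t by rewrite mulr_ge0 // ltW // side_gt0.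
have st1 : side j * t <= 2 * L.
  by apply: le_trans s2; rewrite ler_piMr // ltW // side_gt0.
have L0 := L_gt0.
rewrite ler_norml; apply/andP; split; lra.
Qed.

Section detail.
Variables (f : ('I_d -> R) -> R) (f0 Cosc M : R).
Hypothesis M_ge0 : 0 <= M.
Hypothesis f_osc : forall x, (forall i, `|x i| <= 3 * L) -> `|f x - f0| <= Cosc.
Hypothesis f_line : forall x i t0, `|t0| <= 3 * L ->
  exists2 P : {poly R}, (size P <= s)%N & forall t, `|t| <= 3 * L ->
    `|f (update x i t) - P.[t]| <= M * `|t - t0| ^+ s.

Definition cube_interp j (Q : cubes j) : ('I_d -> R) -> R :=
  fun x => interp s f (corner Q) (side j) (fun i => (x i - corner Q i) / side j).

(** What is left of [f] on a cube after subtracting the interpolant of the parent cube, or the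
    constant [f0] at the top. Interpolating it on the cube gives the increment between two
    successive levels. *)
Definition detail j : cubes j -> ('I_d -> R) -> R :=
  if j is j'.+1 then fun Q x => f x - cube_interp (parent Q) x
  else fun _ x => f x - f0.

Definition detail_coef j (Q : cubes j) (m : {ffun 'I_d -> 'I_s}) : R :=
  detail Q (node (corner Q) (side j) m).

Definition err_const : R :=
  d%:R * (lag_const R s ^+ d * ((1 + lag_const R s) * M)).

Lemma err_const_ge0 : 0 <= err_const.
Proof.
have := ltW (lt_le_trans ltr01 (lag_const_ge1 R s_gt0)) => L0.
by rewrite !mulr_ge0 ?exprn_ge0 ?addr_ge0.
Qed.

Lemma cube_interp_error j (Q : cubes j) tau : (forall i, 0 <= tau i <= 1) ->
  `|f (affine (corner Q) (side j) tau) - interp s f (corner Q) (side j) tau|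
  <= err_const * side j ^+ s.
Proof.
move=> tau01; have sj := side_gt0 j.
rewrite (_ : err_const * _ = d%:R * (lag_const R s ^+ d * ((1 + lag_const R s) * (M * side j ^+ s)))); last first.
  by rewrite /err_const; ring.
apply: interp_error; rewrite ?gt_eqF // => x i.
have c0 : `|corner Q i| <= 3 * L.
  by have := @corner_bound j Q i 0; rewrite mulr0 addr0; apply; rewrite lexx ler01.
have [P sP HP] := f_line x i c0; exists P => // t t01.
apply: le_trans (HP _ (corner_bound Q i t01)) _.
rewrite ler_wpM2l // addrC addKr lerXn2r ?nnegrE ?(ltW sj) //.
case/andP: t01 => t0 t1; rewrite normrM (gtr0_norm sj) (ger0_norm t0).
by rewrite ler_piMr // ltW.
Qed.

Lemma detail_interp j (a : cubes J) : (j < J)%N ->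
  interp s (detail (ancestor j.+1 a)) (corner (ancestor j.+1 a)) (side j.+1) (local j.+1 a) =
  interp s f (corner (ancestor j.+1 a)) (side j.+1) (local j.+1 a) -
  interp s f (corner (ancestor j a)) (side j) (local j a).
Proof.
move=> jJ; rewrite /detail interpB; congr (_ - _).
rewrite interp_reproduce ?gt_eqF ?side_gt0 // parent_ancestor //.
congr (interp _ _ _ _ _); apply/funext => i.
rewrite (corner_local a jJ) -(corner_local a (ltnW jJ)) /affine.
by rewrite addrC addKr mulrC mulKf // gt_eqF // side_gt0.
Qed.

Lemma detail_coef0 (Q : cubes 0) m : `|detail_coef Q m| <= Cosc.
Proof.
apply: f_osc => i; apply: corner_bound.
by rewrite divr_ge0 //= ler_pdivrMr ?ltr0n // mul1r ler_nat ltnW.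
Qed.

Lemma detail_coefS j (Q : cubes j.+1) m :
  `|detail_coef Q m| <= err_const * side j ^+ s.
Proof.
rewrite /detail_coef /detail /cube_interp.
(* Local coordinates in the parent cube of a node of the child [Q]; the parity of [Q i] tells which
   half of the parent it lies in. *)
pose tau i : R := ((Q i %% 2)%:R + (m i)%:R / s%:R) / 2.
have tau01 i : 0 <= tau i <= 1.
  have m01 : 0 <= ((m i)%:R / s%:R : R) <= 1.
    by rewrite divr_ge0 //= ler_pdivrMr ?ltr0n // mul1r ler_nat ltnW.
  have Q1 : (Q i %% 2)%:R <= 1 :> R by rewrite (_ : 1 = 1%:R) // ler_nat -ltnS ltn_mod.
  have Q0 : 0 <= (Q i %% 2)%:R :> R by rewrite ler0n.
  case/andP: m01 => m0 m1; rewrite /tau; apply/andP; split; lra.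
have nodeE : node (corner Q) (side j.+1) m = affine (corner (parent Q)) (side j) tau.
  apply/funext => i; rewrite /node /affine /corner parent_val (side_half j) /tau.
  rewrite {1}(divn_eq (Q i) 2) natrD natrM; field.
  by rewrite pnatr_eq0 -lt0n.
rewrite nodeE (_ : (fun i => _) = tau); last first.
  apply/funext => i; rewrite /affine addrC addKr mulrC mulKf // gt_eqF //.
  exact: side_gt0.
exact: cube_interp_error.
Qed.

Lemma detail_telescope (a : cubes J) (n : nat) : (n <= J)%N ->
  interp s f (corner (ancestor n a)) (side n) (local n a) - f0 =
  \sum_(j < n.+1) \sum_m lagprod (local j a) m * detail_coef (ancestor j a) m.
Proof.
elim: n => [|n IH] nJ.
  by rewrite big_ord1 /= -[in LHS](interp_cst s_gt0 f0 (corner (ancestor 0 a)) (side 0) (local 0 a)) -interpB.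
rewrite big_ord_recr /= -IH ?(ltnW nJ) //.
rewrite -[X in _ = _ + X]/(interp s (detail (ancestor n.+1 a)) _ _ _) detail_interp //.
ring.
Qed.

Definition multiscale_index := {j : 'I_J.+1 & (cubes j * {ffun 'I_d -> 'I_s})%type}.

(* The weights (3/4)^j are square-summable over the levels, while the 2^(dj)
   squared coefficients of order 4^(-js) at level j stay summable after division
   by (9/16)^j because 2s > d. *)
Definition feature (a : cubes J) (k : multiscale_index) : R :=
  (3 / 4) ^+ tag k * ((ancestor (tag k) a == (tagged k).1)%:R * lagprod (local (tag k) a) (tagged k).2).

Definition weighted_coef (k : multiscale_index) : R :=
  detail_coef (tagged k).1 (tagged k).2 / (3 / 4) ^+ tag k.

Lemma sum_multiscale (F : forall j : 'I_J.+1, cubes j -> {ffun 'I_d -> 'I_s} -> R) :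
  \sum_(k : multiscale_index) F (tag k) (tagged k).1 (tagged k).2 =
  \sum_(j < J.+1) \sum_Q \sum_m F j Q m.
Proof.
rewrite (eq_bigr (fun j : 'I_J.+1 => \sum_(Qm : cubes j * {ffun 'I_d -> 'I_s}) F j Qm.1 Qm.2)).
  by rewrite sig_big_dep.
by move=> j _; rewrite pair_bigA.
Qed.

Lemma multiscale_expansion (a : cubes J) :
  f (corner a) - f0 = \sum_k weighted_coef k * feature a k +
   (f (corner a) - interp s f (corner (ancestor J a)) (side J) (local J a)).
Proof.
rewrite (_ : \sum_k _ = interp s f (corner (ancestor J a)) (side J) (local J a) - f0).
  by ring.
rewrite detail_telescope //.
rewrite (sum_multiscale (fun j Q m => detail_coef Q m / (3 / 4) ^+ j *
  ((3 / 4) ^+ j * ((ancestor j a == Q)%:R * lagprod (local j a) m)))).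
apply: eq_bigr => j _; rewrite (bigD1 (ancestor j a)) //= [X in _ + X]big1 ?addr0; last first.
  by move=> Q /negbTE Qa; apply: big1 => m _; rewrite [ancestor j a == Q]eq_sym Qa mul0r !mulr0.
have g0 : (3 / 4) ^+ j != 0 :> R by rewrite expf_neq0 // mulf_neq0 ?invr_eq0.
by apply: eq_bigr => m _; rewrite eqxx mul1r mulrA divfK // mulrC.
Qed.

(** At each level a single cube contains [a], so the sum is geometric with ratio 9/16 and stays
    below 3, whatever the number of levels. *)
Lemma feature_norm (a : cubes J) :
  \sum_k feature a k ^+ 2 <= 3 * (lag_const R s ^+ d) ^+ 2.
Proof.
rewrite (sum_multiscale (fun j Q m =>
  ((3 / 4) ^+ j * ((ancestor j a == Q)%:R * lagprod (local j a) m)) ^+ 2)).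
apply: (@le_trans _ _ (\sum_(j < J.+1) (9 / 16) ^+ j * (lag_const R s ^+ d) ^+ 2)).
  apply: ler_sum => j _; rewrite (bigD1 (ancestor j a)) //= [X in _ + X]big1 ?addr0; last first.
    by move=> Q /negbTE Qa; apply: big1 => m _; rewrite [ancestor j a == Q]eq_sym Qa mul0r mulr0 expr0n.
  rewrite (_ : \sum_m _ = (9 / 16) ^+ j * \sum_(m : {ffun 'I_d -> 'I_s}) lagprod (local j a) m ^+ 2); last first.
    rewrite mulr_sumr; apply: eq_bigr => m _; rewrite eqxx mul1r exprMn -exprM mulnC exprM.
    by congr (_ ^+ _ * _); field.
  rewrite ler_wpM2l ?exprn_ge0 ?divr_ge0 //.
  by apply: sum_sqr_lagprod => // i; exact: local01.
rewrite -mulr_suml ler_wpM2r ?sqr_ge0 //.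
suff H n : \sum_(j < n) (9 / 16) ^+ j <= 3 - 16 / 7 * (9 / 16) ^+ n :> R.
  by apply: le_trans (H _) _; rewrite gerBl mulr_ge0 ?exprn_ge0 // divr_ge0.
elim: n => [|n IH]; first by rewrite big_ord0 expr0; lra.
rewrite big_ord_recr /= exprS.
have : 0 <= (9 / 16) ^+ n :> R by rewrite exprn_ge0 // divr_ge0.
lra.
Qed.

(** Since [2 s >= d + 1], the decay of the squared coefficients beats the number of cubes by a
    factor [2^-j]. Against the weights [(16/9)^j] there remains the ratio 8/9, whose series is 9;
    [2 ^+ d] comes from [2^j + 1 <= 2^(j+1)]. *)
Lemma weighted_coef_norm (X : R) : (d < 2 * s)%N -> 0 <= X ->
  (forall j (Q : cubes j) m, `|detail_coef Q m| <= X * (2 ^+ (j * s))^-1) ->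
  \sum_k weighted_coef k ^+ 2 <= 9 * (2 ^+ d * s%:R ^+ d * X ^+ 2).
Proof.
move=> ds X0 HX.
rewrite (sum_multiscale (fun j Q m => (detail_coef Q m / (3 / 4) ^+ j) ^+ 2)).
apply: (@le_trans _ _ (\sum_(j < J.+1) (8 / 9) ^+ j * (2 ^+ d * s%:R ^+ d * X ^+ 2))).
  apply: ler_sum => j _.
  set Y := X ^+ 2 * (2 ^+ (j * s * 2))^-1 * (16 / 9) ^+ j.
  apply: (@le_trans _ _ (\sum_(Q : cubes j) \sum_(m : {ffun 'I_d -> 'I_s}) Y)).
    apply: ler_sum => Q _; apply: ler_sum => m _.
    rewrite expr_div_n -exprM [(j * 2)%N]mulnC exprM.
    rewrite (_ : (3 / 4) ^+ 2 = (16 / 9)^-1 :> R); last by field.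
    rewrite exprVn invrK /Y ler_wpM2r ?exprn_ge0 ?divr_ge0 //.
    rewrite exprM -exprVn -exprMn -real_normK ?num_real //.
    rewrite ler_sqr ?nnegrE //.
    by rewrite divr_ge0 // exprn_ge0.
  rewrite !sumr_const !card_ffun !card_ord -mulrnA -[leLHS]mulr_natl natrM !natrX.
  rewrite /Y [leLHS](_ : _ = ((2 ^ j).+1%:R ^+ d * (2 ^+ (j * s * 2))^-1 * (16 / 9) ^+ j) * (s%:R ^+ d * X ^+ 2)); last by ring.
  rewrite [leRHS](_ : _ = (2 ^+ d * (8 / 9) ^+ j) * (s%:R ^+ d * X ^+ 2)); last by ring.
  rewrite ler_wpM2r ?mulr_ge0 ?exprn_ge0 //.
  have -> : (8 / 9) ^+ j = (2 ^+ j)^-1 * (16 / 9) ^+ j :> R.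
    by rewrite -exprVn -exprMn; congr (_ ^+ _); field.
  rewrite mulrA ler_wpM2r ?exprn_ge0 ?divr_ge0 //.
  apply: (@le_trans _ _ ((2 ^+ j.+1) ^+ d * (2 ^+ (j * s * 2))^-1)).
    rewrite ler_wpM2r ?invr_ge0 ?exprn_ge0 // lerXn2r ?nnegrE ?exprn_ge0 //.
    rewrite -natrX ler_nat expnS mul2n -addnn -addn1 leq_add2l expn_gt0 //.
  rewrite exprS exprMn -mulrA ler_wpM2l ?exprn_ge0 // -exprM.
  rewrite ler_pdivrMr ?exprn_gt0 // ler_pdivlMl ?exprn_gt0 // -exprD.
  rewrite ler_weXn2l ?ler1n // -mulnA -mulnS leq_mul2l mulnC; apply/orP; right.
  by rewrite -mulnC mulnC.
rewrite -mulr_suml ler_wpM2r ?mulr_ge0 ?sqr_ge0 ?exprn_ge0 //.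
suff H n : \sum_(j < n) (8 / 9) ^+ j <= 9 - 9 * (8 / 9) ^+ n :> R.
  by apply: le_trans (H _) _; rewrite gerBl mulr_ge0 // exprn_ge0 // divr_ge0.
elim: n => [|n IH]; first by rewrite big_ord0 expr0; lra.
rewrite big_ord_recr /= exprS; lra.
Qed.

(** Cauchy-Schwarz separates [f], seen through its coefficients, from [r], seen through feature
    averages in which [f] does not occur; this makes the bound uniform over [f]. The zero total of
    [r] removes [f0]. *)
Lemma multiscale_bound (r : cubes J -> R) (X : R) : (d < 2 * s)%N -> 0 <= X ->
  (forall j (Q : cubes j) m, `|detail_coef Q m| <= X * (2 ^+ (j * s))^-1) ->
  \sum_a r a = 0 -> \sum_a `|r a| <= 2 ->
  `|\sum_a f (corner a) * r a| <=
   Num.sqrt (9 * (2 ^+ d * s%:R ^+ d * X ^+ 2) * \sum_k (\sum_a feature a k * r a) ^+ 2)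
   + 2 * (err_const * side J ^+ s).
Proof.
move=> ds X0 HX r0 r2.
have -> : \sum_a f (corner a) * r a =
   \sum_k weighted_coef k * (\sum_a feature a k * r a) +
   \sum_a (f (corner a) - interp s f (corner (ancestor J a)) (side J) (local J a)) * r a.
  transitivity (\sum_a (f (corner a) - f0) * r a).
    by under [RHS]eq_bigr do rewrite mulrBl; rewrite sumrB -mulr_sumr r0 mulr0 subr0.
  under eq_bigr do rewrite multiscale_expansion mulrDl; rewrite big_split /=; congr (_ + _).
  under [RHS]eq_bigr do rewrite mulr_sumr; rewrite [RHS]exchange_big /=.
  apply: eq_bigr => a _; rewrite mulr_suml; apply: eq_bigr => k _; ring.
apply: le_trans (ler_normD _ _) _; apply: lerD.
  rewrite -sqrtr_sqr ler_wsqrtr // (le_trans (sum_cauchy_schwarz _ _ _ _)) //.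
  rewrite ler_wpM2r ?weighted_coef_norm // sumr_ge0 // => k _; exact: sqr_ge0.
apply: le_trans (ler_norm_sum _ _ _) _.
apply: (@le_trans _ _ (\sum_a err_const * side J ^+ s * `|r a|)).
  apply: ler_sum => a _; rewrite normrM ler_wpM2r //.
  rewrite -{1}(corner_local a (leqnn J)); apply: cube_interp_error => i; exact: local01.
rewrite -mulr_sumr mulrC ler_wpM2r // mulr_ge0 ?err_const_ge0 // exprn_ge0 //.
by rewrite ltW // side_gt0.
Qed.

End detail.

End dyadic_cubes.

(** * Stability of the dual value in the marginals *)

Section dual_deviation.
Context (R : realType) (d : nat) (L lamM : R).
Hypothesis L_gt0 : 0 < L.
Hypothesis lamM_gt0 : 0 < lamM.

(** The least [s] with [d < 2 * s]; a larger one would worsen the power [lam^(1 - s)]. *)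
Definition smoothness : nat := (d %/ 2).+1.
Local Notation s := smoothness.

Lemma smoothness_gt : (d < 2 * s)%N.
Proof. by rewrite mulnS mulnC {1}(divn_eq d 2) addnC ltn_add2r ltn_mod. Qed.

Section fixed_grid.
Variable J : nat.
Local Notation A := (cubes d J).
Implicit Types (p q r : A -> R) (lam : R).

Definition cell_point (a : A) : 'I_d -> R := corner L a.
Definition cell_cost (a b : A) : R := half_sqdist (cell_point a) (cell_point b).

Lemma cell_point_le a i : `|cell_point a i| <= L.
Proof.
rewrite /cell_point /corner /side.
have J0 : 0 < 2 ^+ J :> R by rewrite exprn_gt0.
have aJ : (a i)%:R <= 2 ^+ J :> R by rewrite -natrX ler_nat -ltnS.
have a0 : 0 <= (a i)%:R :> R by rewrite ler0n.
have h0 : 0 <= 2 * L / 2 ^+ J * (a i)%:R by rewrite mulr_ge0 // divr_ge0 // ?mulr_ge0 // ltW.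
have h1 : 2 * L / 2 ^+ J * (a i)%:R <= 2 * L.
  by rewrite mulrAC ler_pdivrMr // ler_pM2l // mulr_gt0.
rewrite ler_norml; apply/andP; split; lra.
Qed.

Lemma half_sqdistC (x y : 'I_d -> R) : half_sqdist x y = half_sqdist y x.
Proof. by congr (_ * _); apply: eq_bigr => i _; rewrite -sqrrN opprB. Qed.

Lemma cell_costC a b : cell_cost a b = cell_cost b a.
Proof. exact: half_sqdistC. Qed.

Lemma cell_cost_ge0 a b : 0 <= cell_cost a b.
Proof. exact: half_sqdist_ge0. Qed.

Lemma cell_cost_le a b : cell_cost a b <= d%:R * (2 * L ^+ 2).
Proof. by apply: half_sqdist_le => i; exact: cell_point_le. Qed.

Definition osc_const : R := d%:R * (2 * (3 * L) ^+ 2).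
Definition line_constL : R := line_const s L (3 * L) lamM.
(** The first term serves level 0, the second one all others; [4 * L] appears because
    [side j = 4 L / 2^(j+1)]. *)
Definition coef_const : R :=
  osc_const * lamM ^+ s.-1 + err_const d s line_constL * (4 * L) ^+ s.

(* Bounds \sum_a U a * r a for all softmin potentials U at once. *)
Definition deviation lam r : R :=
  (lam ^+ s.-1)^-1 *
  (Num.sqrt (9 * (2 ^+ d * s%:R ^+ d * coef_const ^+ 2) *
     \sum_(k : multiscale_index d s J) (\sum_a feature R a k * r a) ^+ 2)
   + 2 * (err_const d s line_constL * side L J ^+ s)).

Lemma line_constL_ge0 : 0 <= line_constL.
Proof.
have h := ltW L_gt0; have h' := ltW lamM_gt0.
rewrite /line_constL /line_const addr_ge0 //.
  by rewrite mulr_ge0 ?exprn_ge0.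
by rewrite mulr_ge0 ?exprn_ge0 // addr_ge0 // mulr_ge0.
Qed.

Lemma err_constL_ge0 : 0 <= err_const d s line_constL.
Proof. by apply: err_const_ge0 => //; exact: line_constL_ge0. Qed.

Lemma coef_const_ge0 : 0 <= coef_const.
Proof.
have h := ltW L_gt0; have h' := ltW lamM_gt0.
have e0 := err_constL_ge0.
by apply: addr_ge0; apply: mulr_ge0 => //; rewrite ?exprn_ge0 ?mulr_ge0 ?sqr_ge0.
Qed.

Lemma potential_deviation lam q v r : 0 < lam <= lamM ->
  (forall b, 0 <= q b) -> \sum_b q b = 1 -> \sum_a r a = 0 -> \sum_a `|r a| <= 2 ->
  `|\sum_a potential lam q cell_point v (cell_point a) * r a| <= deviation lam r.
Proof.
move=> /andP[lam0 lamle] q0 q1 r0 r2.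
set U := potential lam q cell_point v.
have l0 : 0 < lam ^+ s.-1 by rewrite exprn_gt0.
pose M := line_constL / lam ^+ s.-1.
have M0 : 0 <= M by rewrite divr_ge0 ?line_constL_ge0 // ltW.
have L3 : 0 <= 3 * L by rewrite mulr_ge0 // ltW.
have U_osc x : (forall i, `|x i| <= 3 * L) -> `|U x - U (fun=> 0)| <= osc_const.
  move=> xL; apply: (@potential_osc _ _ _ _ _ _ _ L) => //.
  - exact: cell_point_le.
  - have := L_gt0; lra.
  - by move=> i; rewrite normr0.
have U_line x i t0 : `|t0| <= 3 * L ->
    exists2 P : {poly R}, (size P <= s)%N & forall t, `|t| <= 3 * L ->
    `|U (update x i t) - P.[t]| <= M * `|t - t0| ^+ s.
  by move=> t0L; apply: potential_line => //; exact: cell_point_le.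
pose X := coef_const / lam ^+ s.-1.
have X0 : 0 <= X by rewrite divr_ge0 ?coef_const_ge0 // ltW.
have errM : err_const d s M = err_const d s line_constL / lam ^+ s.-1.
  by rewrite /err_const /M !mulrA.
have err0 := err_constL_ge0.
have osc0 : 0 <= osc_const by do 2 (apply: mulr_ge0 => //); exact: sqr_ge0.
have HX j (Q : cubes d j) (m : {ffun 'I_d -> 'I_s}) :
    `|detail_coef L U (U (fun=> 0)) Q m| <= X * (2 ^+ (j * s))^-1.
  case: j Q => [|j] Q.
    rewrite mul0n expr0 invr1 mulr1.
    apply: (le_trans (detail_coef0 _ L_gt0 U_osc Q m)) => //.
    rewrite /X ler_pdivlMr // /coef_const ler_wpDr //.
      by rewrite mulr_ge0 // exprn_ge0 // mulr_ge0 // ltW.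
    by rewrite ler_wpM2l // lerXn2r // nnegrE ltW.
  apply: (le_trans (detail_coefS _ L_gt0 (U (fun=> 0)) M0 U_line Q m)) => //.
  rewrite errM (_ : side L j ^+ s = (4 * L) ^+ s / 2 ^+ (j.+1 * s)); last first.
    rewrite exprM -expr_div_n; congr (_ ^+ _); rewrite /side exprS.
    by field; rewrite expf_neq0.
  rewrite /X mulrA ler_wpM2r ?invr_ge0 ?exprn_ge0 //.
  rewrite mulrAC ler_wpM2r ?invr_ge0 ?(ltW l0) //.
  by rewrite /coef_const lerDr mulr_ge0 // exprn_ge0 // ltW.
apply: (le_trans (multiscale_bound (ltn0Sn _) L_gt0 M0 U_line smoothness_gt X0 HX r0 r2)).
rewrite /deviation errM mulrDr lerD //.
  set S := \sum_k _; rewrite (_ : _ * S = ((lam ^+ s.-1)^-1) ^+ 2 *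
    (9 * (2 ^+ d * s%:R ^+ d * coef_const ^+ 2) * S)); last first.
    by rewrite /X exprMn; ring.
  by rewrite sqrtrM ?sqr_ge0 // sqrtr_sqr ger0_norm // invr_ge0 ltW.
rewrite le_eqVlt; apply/orP; left; apply/eqP; ring.
Qed.

Definition prob_vec (I : finType) (p : I -> R) := (forall a, 0 <= p a) /\ \sum_a p a = 1.

Lemma prob_vec_diff p q : prob_vec p -> prob_vec q ->
  \sum_a (p a - q a) = 0 /\ \sum_a `|p a - q a| <= 2.
Proof.
move=> [p0 p1] [q0 q1]; split; first by rewrite sumrB p1 q1 subrr.
apply: (@le_trans _ _ (\sum_a (p a + q a))).
  by apply: ler_sum => a _; rewrite (le_trans (ler_normB _ _)) // !ger0_norm.
by rewrite big_split /= p1 q1.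
Qed.

Definition grid_potentials lam p q u v := schrodinger lam cell_cost p q u v.

Lemma grid_potentials_exist lam p q : 0 < lam -> prob_vec p -> prob_vec q ->
  exists u v, grid_potentials lam p q u v.
Proof.
move=> lam0 [p0 p1] [q0 q1].
apply: (schrodinger_exists (C := d%:R * (2 * L ^+ 2))) => // a b b'.
by rewrite lerBlDr (le_trans (cell_cost_le _ _)) // lerDl cell_cost_ge0.
Qed.

Lemma grid_potentialsC lam p q u v :
  grid_potentials lam p q u v -> grid_potentials lam q p v u.
Proof.
move=> [rows cols]; split=> a; [rewrite -(cols a)|rewrite -(rows a)];
by apply: eq_bigr => b _; rewrite /gibbs [_ + u _]addrC cell_costC.
Qed.

(** Optimality brackets the difference between the values of the linear form [p' - p] at the two
    first potentials. Both are softmins for the same [q], so [deviation] covers them however they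
    depend on [p] and [p']. *)
Lemma dual_value_marginal_dev lam p p' q u v u' v' : 0 < lam <= lamM ->
  prob_vec p -> prob_vec p' -> prob_vec q ->
  grid_potentials lam p q u v -> grid_potentials lam p' q u' v' ->
  `|dual_value p' q u' v' - dual_value p q u v| <= deviation lam (fun a => p' a - p a).
Proof.
move=> lamle pp pp' [q0 q1] uv uv'; have /andP[lam0 _] := lamle.
have [d0 d2] := prob_vec_diff pp' pp; have [[p0 p1] [p'0 p'1]] := (pp, pp').
have pot u1 v1 p2 : grid_potentials lam p2 q u1 v1 ->
    `|\sum_a u1 a * (p' a - p a)| <= deviation lam (fun a => p' a - p a).
  move=> [rows _].
  have := potential_deviation v1 lamle q0 q1 d0 d2.
  congr (`|_| <= _); apply: eq_bigr => a _; congr (_ * _).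
  by rewrite (softminE lam0 q0 q1 (rows a)).
have h1 := dual_value_marginal lam0 p0 q0 p1 q1 uv uv'.
have h2 := dual_value_marginal lam0 p'0 q0 p'1 q1 uv' uv.
have := pot _ _ _ uv; have := pot _ _ _ uv'; rewrite !ler_norml.
rewrite (_ : \sum_i u i * (p i - p' i) = - \sum_i u i * (p' i - p i)) in h2; last first.
  by rewrite -sumrN; apply: eq_bigr => a _; rewrite -mulrN opprB.
by move=> /andP[_ h3] /andP[h4 _]; apply/andP; split; lra.
Qed.

Lemma dual_value_dev lam p p' q q' u v u' v' : 0 < lam <= lamM ->
  prob_vec p -> prob_vec p' -> prob_vec q -> prob_vec q' ->
  grid_potentials lam p q u v -> grid_potentials lam p' q' u' v' ->
  `|dual_value p' q' u' v' - dual_value p q u v| <=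
  deviation lam (fun a => p' a - p a) + deviation lam (fun a => q' a - q a).
Proof.
move=> lamle pp pp' pq pq' uv uv'; have /andP[lam0 _] := lamle.
have [u1 [v1 uv1]] := grid_potentials_exist lam0 pp' pq.
have h1 := dual_value_marginal_dev lamle pp pp' pq uv uv1.
have h2 := dual_value_marginal_dev lamle pq pq' pp' (grid_potentialsC uv1) (grid_potentialsC uv').
rewrite [X in `|X - _|]dual_valueC [X in `|_ - X|]dual_valueC in h2.
rewrite -(subrKA (dual_value p' q u1 v1)) (le_trans (ler_normD _ _)) // addrC.
by apply: lerD.
Qed.

Lemma deviation_le lam lam' r : 0 < lam -> lam <= lam' -> deviation lam' r <= deviation lam r.
Proof.
move=> lam0 le; rewrite /deviation ler_wpM2r //.
  rewrite addr_ge0 ?sqrtr_ge0 // mulr_ge0 // mulr_ge0 ?err_constL_ge0 //.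
  by rewrite exprn_ge0 // ltW // side_gt0.
rewrite lef_pV2 ?posrE ?exprn_gt0 ?(lt_le_trans lam0) //.
by rewrite lerXn2r // nnegrE ltW // (lt_le_trans lam0).
Qed.

Section samples.
Variables (n : nat) (p : A -> R).
Hypothesis n_gt0 : (0 < n)%N.
Hypothesis pp : prob_vec p.

(** Written as a sum of uniform weights over a fibre, the form produced by [schrodinger_merge]. *)
Definition frequency (m : 'I_n -> A) (a : A) : R :=
  \sum_(i < n | m i == a) n%:R^-1.

Lemma sum_frequency m (F : A -> R) :
  \sum_a F a * frequency m a = n%:R^-1 * \sum_i F (m i).
Proof.
rewrite /frequency -(sum_merge m (fun=> n%:R^-1) F) mulr_sumr.
by apply: eq_bigr => i _; rewrite mulrC.
Qed.

Lemma frequency_prob m : prob_vec (frequency m).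
Proof.
have n0 : n%:R != 0 :> R by rewrite pnatr_eq0 -lt0n.
split=> [a|]; first by apply: sumr_ge0 => i _; rewrite invr_ge0.
have := sum_frequency m (fun=> 1); under eq_bigr do rewrite mul1r.
by move=> ->; rewrite sumr_const card_ord mulVf.
Qed.

Local Notation idx := (multiscale_index d s J).
Definition centered_feature (a : A) (k : idx) : R :=
  feature R a k - \sum_b p b * feature R b k.
Definition feature_var : R := 12 * (lag_const R s ^+ d) ^+ 2.
(** Normalised so that [mgf_sum_sqr] bounds its exponential moment by [expR 1]. It is the only
    random quantity, for each sample, in the final bounds. *)
Definition fluctuation (m : 'I_n -> A) : R :=
  (16 * feature_var * n%:R)^-1 * \sum_k (\sum_i centered_feature (m i) k) ^+ 2.

Lemma feature_var_gt0 : 0 < feature_var.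
Proof.
by rewrite mulr_gt0 // exprn_gt0 // exprn_gt0 // (lt_le_trans ltr01) // lag_const_ge1.
Qed.

Lemma centered_feature_mean k : \sum_a p a * centered_feature a k = 0.
Proof.
under eq_bigr do rewrite mulrBr; rewrite sumrB -mulr_suml pp.2 mul1r subrr //.
Qed.

(** [(x - y)^2 <= 2 x^2 + 2 y^2] and Jensen's inequality for the mean give [2 * 3 + 2 * 3], the 12
    of [feature_var]. *)
Lemma centered_feature_norm a : \sum_k centered_feature a k ^+ 2 <= feature_var.
Proof.
have [p0 p1] := pp.
pose mean (k : idx) := \sum_b p b * feature R b k.
have jensen k : mean k ^+ 2 <= \sum_b p b * feature R b k ^+ 2.
  rewrite -subr_ge0; have : 0 <= \sum_b p b * (feature R b k - mean k) ^+ 2.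
    by apply: sumr_ge0 => b _; rewrite mulr_ge0 ?sqr_ge0.
  congr (0 <= _).
  transitivity (\sum_b (p b * feature R b k ^+ 2 - 2 * mean k * (p b * feature R b k)
     + mean k ^+ 2 * p b)).
    by apply: eq_bigr => b _; ring.
  by rewrite big_split /= sumrB -!mulr_sumr p1 -/(mean k); ring.
apply: (@le_trans _ _ (\sum_k (2 * feature R a k ^+ 2 + 2 * mean k ^+ 2))).
  apply: ler_sum => k _; rewrite /centered_feature -/(mean k).
  by have := sqr_ge0 (feature R a k + mean k); nra.
rewrite big_split /= -!mulr_sumr.
have F1 : \sum_(k : idx) feature R a k ^+ 2 <= 3 * (lag_const R s ^+ d) ^+ 2.
  exact: (feature_norm _ (ltn0Sn _)).
have F2 : \sum_k mean k ^+ 2 <= 3 * (lag_const R s ^+ d) ^+ 2.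
  apply: (@le_trans _ _ (\sum_b p b * \sum_(k : idx) feature R b k ^+ 2)).
    under [leRHS]eq_bigr do rewrite mulr_sumr; rewrite exchange_big /=.
    by apply: ler_sum => k _; exact: jensen.
  apply: (@le_trans _ _ (\sum_b p b * (3 * (lag_const R s ^+ d) ^+ 2))).
    by apply: ler_sum => b _; rewrite ler_wpM2l //; exact: (feature_norm _ (ltn0Sn _)).
  by rewrite -mulr_suml p1 mul1r.
rewrite /feature_var; lra.
Qed.

Lemma fluctuation_mgf :
  \sum_(m : {ffun 'I_n -> A}) sample_weight p m * expR (fluctuation m) <= expR 1.
Proof.
apply: mgf_sum_sqr; [exact: pp.1|exact: pp.2|exact: centered_feature_mean|
  exact: feature_var_gt0|exact: centered_feature_norm].
Qed.

Lemma fluctuation_ge0 m : 0 <= fluctuation m.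
Proof.
rewrite mulr_ge0 ?sumr_ge0 // => [|k _]; last exact: sqr_ge0.
have f0 := ltW feature_var_gt0; rewrite invr_ge0; apply: mulr_ge0 => //.
exact: mulr_ge0.
Qed.

Definition dev_const : R :=
  Num.sqrt (9 * (2 ^+ d * s%:R ^+ d * coef_const ^+ 2) * (16 * feature_var))
  + 2 * err_const d s line_constL.

(** The square root of the fluctuation is bounded by [1 + fluctuation], which is linear and so can
    be integrated directly. *)
Lemma deviation_frequency lam m : 0 < lam ->
  deviation lam (fun a => frequency m a - p a) <=
  dev_const * (lam ^+ s.-1)^-1 * ((1 + fluctuation m) / Num.sqrt n%:R + side L J ^+ s).
Proof.
move=> lam0; rewrite /deviation [X in _ <= X * _]mulrC -[leRHS]mulrA ler_wpM2l //.
  by rewrite invr_ge0 exprn_ge0 // ltW.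
have nR : 0 < n%:R :> R by rewrite ltr0n.
have sn : 0 < Num.sqrt n%:R :> R by rewrite sqrtr_gt0.
have W0 := fluctuation_ge0 m; have fv := feature_var_gt0.
have sd : 0 <= side L J ^+ s by rewrite exprn_ge0 // ltW // side_gt0.
have SE : \sum_(k : idx) (\sum_a feature R a k * (frequency m a - p a)) ^+ 2 =
    16 * feature_var * fluctuation m / n%:R.
  rewrite /fluctuation.
  transitivity (\sum_(k : idx) (n%:R^-1 * \sum_i centered_feature (m i) k) ^+ 2).
    apply: eq_bigr => k _; congr (_ ^+ 2).
    under eq_bigr do rewrite mulrBr; rewrite sumrB sum_frequency.
    rewrite /centered_feature sumrB sumr_const card_ord -[X in _ = _ * (_ - X)]mulr_natl mulrBr.
    rewrite mulKf ?gt_eqF //; congr (_ - _); apply: eq_bigr => b _; exact: mulrC.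
  under eq_bigr do rewrite exprMn; rewrite -mulr_sumr; field.
  by rewrite !gt_eqF.
rewrite SE.
set c1 := 9 * _; have c10 : 0 <= c1.
  by apply: mulr_ge0 => //; apply: mulr_ge0; rewrite ?sqr_ge0 // mulr_ge0 ?exprn_ge0.
have q0 : 0 <= c1 * (16 * feature_var) by rewrite mulr_ge0 // mulr_ge0 // ltW.
have -> : c1 * (16 * feature_var * fluctuation m / n%:R) =
  (c1 * (16 * feature_var)) * (fluctuation m / n%:R) by ring.
rewrite (sqrtrM _ q0) /dev_const -/c1 [leRHS]mulrDl; apply: lerD; last first.
  have e0 := err_constL_ge0; have e2 := mulr_ge0 (ler0n R 2) e0.
  rewrite mulrA; apply: ler_wpM2l => //; rewrite lerDr.
  by rewrite divr_ge0 ?sqrtr_ge0 // addr_ge0.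
rewrite ler_wpM2l ?sqrtr_ge0 // (@le_trans _ _ ((1 + fluctuation m) / Num.sqrt n%:R)) //; last first.
  by rewrite lerDl.
rewrite sqrtrM // sqrtrV ?ler0n // ler_wpM2r ?invr_ge0 ?sqrtr_ge0 //.
rewrite -[leRHS]ger0_norm ?addr_ge0 // -sqrtr_sqr ler_wsqrtr //.
have := sqr_ge0 (fluctuation m); nra.
Qed.

End samples.

End fixed_grid.
End dual_deviation.

(** * Comparison of measures and of Sinkhorn estimates on the grid *)

Lemma measurable_nat_preimage d0 (T : measurableType d0) (B : Type) (g : T -> nat)
    (h : nat -> B) (b : B) : (forall n, measurable [set x | (n < g x)%N]) ->
  measurable [set x | h (g x) = b].
Proof.
move=> mg.
have meq n : measurable [set x | g x = n].
  rewrite (_ : [set x | g x = n] = ~` [set x | (n < g x)%N] `&`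
      (if n is n'.+1 then [set x | (n' < g x)%N] else setT)).
    apply: measurableI; first exact: measurableC.
    by case: n => [|n]; [exact: measurableT|exact: mg].
  apply/seteqP; split => x /=.
    move=> gn; split; first by rewrite gn ltnn.
    by case: n gn => [|n] //= ->.
  move=> [/negP]; rewrite -leqNgt; case: n => [|n] gn.
    by move=> _; apply/eqP; rewrite -leqn0.
  by move=> ng; apply/eqP; rewrite eqn_leq gn.
rewrite (_ : [set x | h (g x) = b] =
  \bigcup_n ([set x | g x = n] `&` (if pselect (h n = b) then setT else set0))).
  apply: bigcupT_measurable => n; apply: measurableI => //.
  by case: pselect => ?; [exact: measurableT|exact: measurable0].
apply/seteqP; split => x /=.
  by move=> hx; exists (g x) => //; split => //=; case: pselect.
by move=> [n _ [/= ->]]; case: pselect.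
Qed.

Section cells.
Context (R : realType) (d : nat) (L : R) (J : nat).
Hypothesis L_gt0 : 0 < L.
Local Notation E := (euclid R d).

Definition coord (x : E) (i : 'I_d) : R := (x : 'rV[R]_d) 0 i.
Definition box : set E := [set x | forall i, `|coord x i| <= L].
Definition cell_index (i : 'I_d) (x : E) : nat := Num.truncn ((coord x i + L) / side L J).
(** Outside the box the index may be out of range, and [inord] then returns 0; only points of the
    box matter. *)
Definition cell (x : E) : cubes d J := [ffun i => inord (cell_index i x)].
Definition grid_error : R := d%:R * (4 * L * side L J).

Lemma grid_error_ge0 : 0 <= grid_error.
Proof.
by rewrite mulr_ge0 // !mulr_ge0 // ltW // side_gt0.
Qed.

Lemma measurable_box : measurable box.
Proof.
rewrite (_ : box = \bigcap_i [set x | `|coord x i| <= L]).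
  apply: fin_bigcap_measurable => [|i _]; first exact: finite_finset.
  rewrite -[X in measurable X]setTI.
  apply: measurable_fun_le => //.
  by apply: measurableT_comp => //; exact: measurable_coord.
by apply/seteqP; split => [x h i _|x h i]; [exact: h|exact: (h i)].
Qed.

Lemma measurable_cell a : measurable (cell @^-1` [set a]).
Proof.
rewrite (_ : _ @^-1` _ = \bigcap_i [set x | (inord (cell_index i x) : 'I_(2 ^ J).+1) = a i]).
  apply: fin_bigcap_measurable => [|i _]; first exact: finite_finset.
  apply: (measurable_nat_preimage (fun n => inord n : 'I_(2 ^ J).+1)) => n.
  rewrite (_ : [set x | (n < cell_index i x)%N] =
    [set x | n.+1%:R <= (coord x i + L) / side L J]).
    rewrite -[X in measurable X]setTI.
    apply: measurable_fun_le => //.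
    apply: measurable_funM => //; apply: measurable_funD => //.
    exact: measurable_coord.
  by apply/seteqP; split => x /=; rewrite /cell_index truncn_gt_nat.
apply/seteqP; split => [x /= h i _|x h /=].
  by rewrite /= -h ffunE.
by apply/ffunP => i; rewrite ffunE; exact: (h i).
Qed.

Lemma cell_near x i : box x -> `|coord x i - cell_point L (cell x) i| <= side L J.
Proof.
move=> /(_ i) xL; have s0 := @side_gt0 _ _ L_gt0 J.
move: xL; rewrite ler_norml => /andP[x1 x2].
pose y := (coord x i + L) / side L J.
have y0 : 0 <= y by rewrite divr_ge0 ?(ltW s0) //; lra.
have yJ : y <= (2 ^ J)%:R.
  rewrite ler_pdivrMr // natrX /side mulrC divfK ?expf_neq0 //; lra.
have /andP[t1 t2] := truncn_itv y0.
(* The extra index of [cubes] is used here: a coordinate equal to [L] has index [2 ^ J]. *)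
have tJ : (Num.truncn y < (2 ^ J).+1)%N.
  by rewrite ltnS -(ler_nat R) (le_trans t1).
have xE : coord x i = - L + side L J * y.
  by rewrite /y mulrC divfK ?gt_eqF //; ring.
rewrite /cell_point /corner ffunE inordK // -/y -/(Num.truncn y).
rewrite /cell_index -/y [X in X - _]xE.
rewrite (_ : _ - _ = side L J * (y - (Num.truncn y)%:R)); last by ring.
rewrite normrM (gtr0_norm s0) ger0_norm ?subr_ge0 // ler_piMr ?(ltW s0) //.
by rewrite lerBlDr addrC natr1 ltW.
Qed.

Lemma cell_cost_near x y : box x -> box y ->
  `|sqdist (x : 'rV[R]_d) y - 2 * cell_cost L (cell x) (cell y)| <= 2 * grid_error.
Proof.
move=> bx By; rewrite /cell_cost /half_sqdist mulVKf // /sqdist -sumrB.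
apply: le_trans (ler_norm_sum _ _ _) _.
rewrite (_ : 2 * grid_error = \sum_(i < d) 8 * L * side L J); last first.
  by rewrite sumr_const card_ord -[RHS]mulr_natl /grid_error; ring.
apply: ler_sum => i _; have s0 := @side_gt0 _ _ L_gt0 J.
have := cell_near i bx; have := cell_near i By.
have := cell_point_le L_gt0 (cell x) i; have := cell_point_le L_gt0 (cell y) i.
have := bx i; have := By i; rewrite -/(coord x i) -/(coord y i).
set a := coord x i; set b := coord y i.
set a' := cell_point L (cell x) i; set b' := cell_point L (cell y) i.
move=> hb ha hb' ha' nb na.
have -> : (a - b) ^+ 2 - (a' - b') ^+ 2 = ((a - a') - (b - b')) * ((a - b) + (a' - b')) by ring.
rewrite normrM (_ : 8 * L * side L J = 2 * side L J * (4 * L)); last by ring.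
apply: ler_pM => //.
  by apply: le_trans (ler_normB _ _) _; lra.
apply: le_trans (ler_normD _ _) _.
have := ler_normB a b; have := ler_normB a' b'; lra.
Qed.

Definition mass (mu : probability E R) (a : cubes d J) : R := fine (mu (cell @^-1` [set a])).

Lemma mass_prob mu : prob_vec (mass mu).
Proof.
split=> [a|]; first by rewrite /mass fine_ge0.
have := @probability_setT _ _ _ mu.
rewrite (measure_finite_valued measurable_cell mu measurableT) => -[] <-.
by apply: eq_bigr => a _; rewrite setTI.
Qed.

Lemma ot_cost_grid (lam : R) (mu nu : probability E R) u v : 0 < lam -> mu box = 1%E -> nu box = 1%E ->
  grid_potentials L lam (mass mu) (mass nu) u v ->
  `|ot_cost lam mu nu - 2 * dual_value (mass mu) (mass nu) u v| <= 2 * grid_error.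
Proof.
move=> lam0 muB nuB [rows cols].
apply: (ot_cost_finite lam0 measurable_cell measurable_box muB nuB _ grid_error_ge0 _ rows cols).
  by move=> a b; exact: cell_cost_ge0.
exact: cell_cost_near.
Qed.

(** Zero potentials are admissible because the cost is nonnegative. The upper bound is Jensen's
    inequality in each row, in the form [1 + x <= exp x]. *)
Lemma dual_value_bounds (lam : R) (p q u v : cubes d J -> R) : 0 < lam -> prob_vec p -> prob_vec q ->
  grid_potentials (J := J) L lam p q u v ->
  0 <= dual_value p q u v <= d%:R * (2 * L ^+ 2).
Proof.
move=> lam0 [p0 p1] [q0 q1] uv; apply/andP; split.
  rewrite (_ : 0 = dual_value p q (fun=> 0) (fun=> 0)); last first.
    by rewrite /dual_value !big1 ?addr0 // => a _; rewrite mul0r.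
  apply: (schrodinger_max lam0 p0 q0 q1 uv).
  rewrite -p1; apply: ler_sum => a _; rewrite -[leRHS]mul1r -mulr_suml ler_wpM2r //.
  rewrite -q1; apply: ler_sum => b _; rewrite -[leRHS]mul1r ler_wpM2r //.
  rewrite -expR0 ler_expR !add0r mulNr oppr_le0 divr_ge0 ?(ltW lam0) //.
  exact: cell_cost_ge0.
have row a : u a + \sum_b v b * q b <= d%:R * (2 * L ^+ 2).
  have : \sum_b (1 + (u a + v b - cell_cost L a b) / lam) * q b <= 1.
    rewrite -[leRHS](uv.1 a); apply: ler_sum => b _; rewrite ler_wpM2r //.
    exact: expR_ge1Dx.
  have -> : \sum_b (1 + (u a + v b - cell_cost L a b) / lam) * q b =
     1 + (u a + \sum_b v b * q b - \sum_b cell_cost L a b * q b) / lam.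
    transitivity (\sum_b (q b + ((u a / lam) * q b + lam^-1 * (v b * q b) -
       lam^-1 * (cell_cost L a b * q b)))).
      by apply: eq_bigr => b _; ring.
    by rewrite big_split sumrB big_split /= -!mulr_sumr q1; ring.
  rewrite gerDl pmulr_lle0 ?invr_gt0 // subr_le0 => /le_trans; apply.
  apply: (@le_trans _ _ (\sum_b d%:R * (2 * L ^+ 2) * q b)).
    by apply: ler_sum => b _; rewrite ler_wpM2r // cell_cost_le.
  by rewrite -mulr_sumr q1 mulr1.
rewrite /dual_value; set V := \sum_j v j * q j.
rewrite (_ : _ + V = \sum_a (u a + V) * p a); last first.
  by under [RHS]eq_bigr do rewrite mulrDl; rewrite big_split /= -mulr_sumr p1 mulr1.
apply: (@le_trans _ _ (\sum_a d%:R * (2 * L ^+ 2) * p a)).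
  by apply: ler_sum => a _; rewrite ler_wpM2r // row.
by rewrite -mulr_sumr p1 mulr1.
Qed.

End cells.
(** Stated for all large [L], so that one box can serve both measures. *)
Lemma compact_in_box (R : realType) (d : nat) (mu : probability (euclid R d) R) :
  compactly_supported mu -> exists2 L0, 0 < L0 & forall L, L0 <= L -> mu (box (d := d) L) = 1%E.
Proof.
move=> [K cK muK].
have mK : measurable (K : set (euclid R d)).
  have : closed K by apply: compact_closed => //; exact: norm_hausdorff.
  rewrite -openC => oK; rewrite -[K]setCK; apply: measurableC.
  exact: sub_sigma_algebra.
have coord_bound (i : 'I_d) : exists M : R, forall x, K x -> `|x 0 i| <= M.
  have : compact ((fun x : 'rV[R]_d => x 0 i) @` K).
    apply: continuous_compact => //; apply: continuous_subspaceT.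
    exact: coord_continuous.
  move=> /compact_bounded [M [_ HM]]; exists (M + 1) => x Kx.
  by apply: (HM (M + 1)); [rewrite ltrDl|exists x].
have [M HM] := choice coord_bound.
exists (1 + \sum_i `|M i|).
  by rewrite ltr_pwDl // sumr_ge0.
move=> L ML; apply/eqP; rewrite eq_le probability_le1 ?andTb; last exact: measurable_box.
rewrite -[leLHS]muK; apply: le_measure; rewrite ?inE //; first exact: measurable_box.
move=> x Kx i; apply: le_trans (HM i x Kx) _; apply: le_trans ML.
by rewrite (bigD1 i) //= (le_trans (ler_norm _)) // addrCA lerDl addr_ge0 // sumr_ge0.
Qed.

Lemma ler_dist_halves (R : realFieldType) (a b x y e g g' : R) :
  `|a - 2 * x| <= g -> `|b - 2 * y| <= g' -> `|x - y| <= e -> `|a - b| <= 2 * e + (g + g').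
Proof.
rewrite !ler_norml => /andP[? ?] /andP[? ?] /andP[? ?]; apply/andP; split; lra.
Qed.

(** Each self-term moves one measure twice, so the errors of the two self-terms add up to twice that
    of the cross term: this is [e1 + e2 <= 2 * e]. *)
Lemma ler_dist_div (R : realFieldType) (a b c a' b' c' e e1 e2 : R) :
  `|a' - a| <= e -> `|b' - b| <= e1 -> `|c' - c| <= e2 -> e1 + e2 <= 2 * e ->
  `|(a' - 1 / 2 * (b' + c')) - (a - 1 / 2 * (b + c))| <= 2 * e.
Proof.
rewrite !ler_norml => /andP[? ?] /andP[? ?] /andP[? ?] ?; apply/andP; split; lra.
Qed.

Lemma ler_dist_richardson (R : realFieldType) (a b a' b' e e' : R) :
  `|a' - a| <= 2 * e -> `|b' - b| <= 2 * e' -> e' <= e ->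
  `|(2 * a' - b') - (2 * a - b)| <= 6 * e.
Proof.
rewrite !ler_norml => /andP[? ?] /andP[? ?] ?; apply/andP; split; lra.
Qed.

Lemma csinkhorn_divE (R : realType) (n d k : nat) (lam : R) (x y : 'I_n -> 'rV[R]_d) :
  (csinkhorn_div lam k x y).1 = (cot_cost lam k x y).1
    - 1 / 2 * ((cot_cost lam k x x).1 + (cot_cost lam k y y).1).
Proof. by rewrite div1r mulrC. Qed.

Section grid_comparison.
Context (R : realType) (d : nat) (L lamM : R) (J : nat).
Hypothesis L_gt0 : 0 < L.
Hypothesis lamM_gt0 : 0 < lamM.
Local Notation E := (euclid R d).
Local Notation box := (box (d := d) L).
Local Notation mass := (@mass R d L J).
Local Notation dev lam p p' := (deviation L lamM lam (fun a : cubes d J => p' a - p a)).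
Local Notation grid_error := (grid_error d L J).

Lemma ot_cost_dev (lam : R) (mu nu mu' nu' : probability E R) : 0 < lam <= lamM ->
  mu box = 1%E -> nu box = 1%E -> mu' box = 1%E -> nu' box = 1%E ->
  `|ot_cost lam mu' nu' - ot_cost lam mu nu| <=
  2 * (dev lam (mass mu) (mass mu') + dev lam (mass nu) (mass nu')) + 4 * grid_error.
Proof.
move=> lamle bmu bnu bmu' bnu'; have /andP[lam0 _] := lamle.
have pr := @mass_prob R d L J.
have [u [v uv]] := grid_potentials_exist L_gt0 lam0 (pr mu) (pr nu).
have [u' [v' uv']] := grid_potentials_exist L_gt0 lam0 (pr mu') (pr nu').
rewrite (_ : 4 * grid_error = 2 * grid_error + 2 * grid_error); last by ring.
apply: (ler_dist_halves (ot_cost_grid L_gt0 lam0 bmu' bnu' uv') (ot_cost_grid L_gt0 lam0 bmu bnu uv)).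
exact: (dual_value_dev L_gt0 lamM_gt0 lamle (pr mu) (pr mu') (pr nu) (pr nu')).
Qed.

Lemma ot_cost_bounds (lam : R) (mu nu : probability E R) : 0 < lam ->
  mu box = 1%E -> nu box = 1%E ->
  `|ot_cost lam mu nu| <= 2 * (d%:R * (2 * L ^+ 2)) + 2 * grid_error.
Proof.
move=> lam0 bmu bnu; have pr := @mass_prob R d L J.
have [u [v uv]] := grid_potentials_exist L_gt0 lam0 (pr mu) (pr nu).
have /andP[V0 V1] := dual_value_bounds L_gt0 lam0 (pr mu) (pr nu) uv.
have := ot_cost_grid L_gt0 lam0 bmu bnu uv.
move: V0 V1; move: (dual_value _ _ _ _) (ot_cost _ _ _) => V T V0 V1.
rewrite !ler_norml => /andP[? ?]; apply/andP; split; lra.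
Qed.

Lemma richardson_div_dev (lam : R) (mu nu mu' nu' : probability E R) :
  0 < lam -> Num.sqrt 2 * lam <= lamM ->
  mu box = 1%E -> nu box = 1%E -> mu' box = 1%E -> nu' box = 1%E ->
  `|richardson_div lam mu' nu' - richardson_div lam mu nu| <=
  12 * (dev lam (mass mu) (mass mu') + dev lam (mass nu) (mass nu')) + 24 * grid_error.
Proof.
move=> lam0 lamle b1 b2 b3 b4.
have sq1 : 1 <= Num.sqrt 2 :> R by rewrite -{1}sqrtr1 ler_wsqrtr // ler1n.
have lam2 : lam <= Num.sqrt 2 * lam by rewrite ler_peMl // ltW.
have l1 : 0 < lam <= lamM by rewrite lam0 (le_trans lam2).
have l2 : 0 < Num.sqrt 2 * lam <= lamM by rewrite lamle (lt_le_trans lam0).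
have dle (r : cubes d J -> R) := deviation_le L_gt0 lamM_gt0 r lam0 lam2.
rewrite (_ : 12 * _ + _ = 6 * (2 * (dev lam (mass mu) (mass mu') + dev lam (mass nu) (mass nu')) + 4 * grid_error)); last by ring.
apply: ler_dist_richardson.
- apply: ler_dist_div; [exact: (ot_cost_dev l1 b1 b2 b3 b4)|exact: (ot_cost_dev l1 b1 b1 b3 b3)|
    exact: (ot_cost_dev l1 b2 b2 b4 b4)|].
  by rewrite le_eqVlt; apply/orP; left; apply/eqP; ring.
- apply: ler_dist_div; [exact: (ot_cost_dev l2 b1 b2 b3 b4)|exact: (ot_cost_dev l2 b1 b1 b3 b3)|
    exact: (ot_cost_dev l2 b2 b2 b4 b4)|].
  by rewrite le_eqVlt; apply/orP; left; apply/eqP; ring.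
- by rewrite lerD2r ler_pM2l // lerD.
Qed.

Section empirical.
Variables (n : nat) (x : 'I_n.+1 -> E).
Hypothesis x_box : forall i, box (x i).

Lemma empiricalE (S : set E) :
  empirical x S = ((\sum_(i < n.+1) (\1_S (x i) : R)) / n.+1%:R)%:E.
Proof.
rewrite /empirical /mscale /= /msum /= mulrC EFinM -sumEFin; congr (_ * _)%E.
by apply: eq_bigr => i _; rewrite inord_val diracE indicE.
Qed.

Lemma empirical_box : empirical x box = 1%E :> \bar R.
Proof.
rewrite empiricalE; under eq_bigr do rewrite indicE mem_set //=.
by rewrite sumr_const card_ord divff // pnatr_eq0.
Qed.

Lemma mass_empirical :
  mass (empirical x : probability E R) = frequency R (fun i => cell L J (x i)).
Proof.
apply/funext => a.
transitivity (fine (empirical x (cell L J @^-1` [set a]) : \bar R)); first by [].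
rewrite empiricalE /= mulr_suml /frequency [RHS]big_mkcond /=.
apply: eq_bigr => i _; rewrite indicE.
have [e|e] := eqVneq (cell L J (x i)) a; first by rewrite mem_set // mul1r.
by rewrite memNset ?mul0r //= => /eqP; rewrite (negbTE e).
Qed.

End empirical.

(** The [+ 1] keeps the bound positive when [d = 0]. *)
Definition cost_bound : R := d%:R * (2 * L ^+ 2) + 1.

(** The algorithm is compared with optimal potentials for the exact costs between sample points, and
    these, by perturbation of the cost, with the grid potentials pulled back to the points. *)
Lemma cot_cost_grid (n k : nat) (lam : R) (x y : 'I_n.+1 -> E) u v : 0 < lam ->
  (forall i, box (x i)) -> (forall i, box (y i)) ->
  grid_potentials L lam (frequency R (fun i => cell L J (x i)))
    (frequency R (fun i => cell L J (y i))) u v ->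
  `|(cot_cost lam k.+1 (x : 'I_n.+1 -> 'rV[R]_d) y).1 - 2 * dual_value
    (frequency R (fun i => cell L J (x i))) (frequency R (fun i => cell L J (y i))) u v|
  <= 2 * grid_error + 32 * cost_bound ^+ 2 / (lam * k.+1%:R).
Proof.
move=> lam0 bx By uv; rewrite cot_costE.
pose w : 'I_n.+1 -> R := fun=> n.+1%:R^-1.
pose c i j := 1 / 2 * sqdist (x i : 'rV[R]_d) (y j).
have w0 i : 0 <= w i by rewrite invr_ge0.
have w1 : \sum_i w i = 1.
  by rewrite sumr_const card_ord -[LHS]mulr_natl divff // pnatr_eq0.
have cb : 0 < cost_bound by rewrite ltr_wpDl // mulr_ge0 // mulr_ge0 // sqr_ge0.
have c0 i j : 0 <= c i j by rewrite mulr_ge0 // sqdist_ge0.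
have cC i j : c i j <= cost_bound.
  apply: (@le_trans _ _ (d%:R * (2 * L ^+ 2))); last by rewrite lerDl.
  by rewrite /c div1r; apply: (half_sqdist_le (bx i) (By j)).
have [us [vs usvs]] : exists us vs, schrodinger lam c w w us vs.
  apply: (schrodinger_exists (C := cost_bound)) => // i j j'.
  by rewrite lerBlDr (le_trans (cC _ _)) // lerDl.
have osc i i' j : c i j - c i' j <= cost_bound.
  by rewrite lerBlDr (le_trans (cC _ _)) // lerDl.
pose it := sinkhorn_iter lam c w w.
have rate := @sinkhorn_rate _ _ _ lam c w w cost_bound lam0 w0 w0 w1 w1 cb osc us vs usvs
  (fun k => (it k).1) (fun k => (it k).2) (fun=> erefl) (fun=> erefl) k.
have cc i j : `|c i j - cell_cost L (cell L J (x i)) (cell L J (y j))| <= grid_error.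
  have := cell_cost_near J L_gt0 (bx i) (By j).
  rewrite (_ : sqdist _ _ - _ = 2 * (c i j - cell_cost L (cell L J (x i)) (cell L J (y j)))).
    by rewrite normrM ger0_norm // ler_pM2l.
  by rewrite /c; field.
have := dual_value_cost_dist lam0 w0 w0 w1 w1 cc usvs (schrodinger_merge uv).
rewrite dual_value_merge.
have -> : (fun=> 1 / n.+1%:R) = w by apply/funext => i; rewrite mul1r.
have -> : sinkhorn_value lam c w w k.+1 = 2 * dual_value w w (it k.+1).1 (it k.+1).2.
  by rewrite /sinkhorn_value /dual_value /it; case: sinkhorn_iter => ? ? /=; rewrite big_split.
rewrite -/(frequency R (fun i => cell L J (x i))) -/(frequency R (fun j => cell L J (y j))).
move: rate; rewrite (_ : 32 * _ / _ = 2 * (16 * cost_bound ^+ 2 / (lam * k.+1%:R))); last by ring.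
move: (16 * _ / _) (dual_value w w us vs) (dual_value w w _ _) (dual_value _ _ u v) => e D D' D2.
move=> /andP[? ?]; rewrite !ler_norml => /andP[? ?]; apply/andP; split; lra.
Qed.

Local Notation freq x := (frequency R (fun i => cell L J (x i))).

Definition sinkhorn_error (lam : R) (k : nat) : R := 32 * cost_bound ^+ 2 / (lam * k.+1%:R).

Lemma cot_cost_dev (n k : nat) (lam : R) (mu nu : probability E R) (x y : 'I_n.+1 -> E) :
  0 < lam <= lamM -> mu box = 1%E -> nu box = 1%E ->
  (forall i, box (x i)) -> (forall i, box (y i)) ->
  `|(cot_cost lam k.+1 (x : 'I_n.+1 -> 'rV[R]_d) y).1 - ot_cost lam mu nu| <=
  2 * (dev lam (mass mu) (freq x) + dev lam (mass nu) (freq y)) +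
  (4 * grid_error + sinkhorn_error lam k).
Proof.
move=> lamle bmu bnu bx By; have /andP[lam0 _] := lamle.
have pr := @mass_prob R d L J.
have fr (z : 'I_n.+1 -> E) : prob_vec (freq z) by exact: frequency_prob.
have [u [v uv]] := grid_potentials_exist L_gt0 lam0 (pr mu) (pr nu).
have [u' [v' uv']] := grid_potentials_exist L_gt0 lam0 (fr x) (fr y).
rewrite (_ : 4 * grid_error + _ = (2 * grid_error + sinkhorn_error lam k) + 2 * grid_error); last by ring.
apply: (ler_dist_halves (cot_cost_grid k lam0 bx By uv') (ot_cost_grid L_gt0 lam0 bmu bnu uv)).
exact: (dual_value_dev L_gt0 lamM_gt0 lamle (pr mu) (fr x) (pr nu) (fr y)).
Qed.

Lemma crichardson_div_dev (n k : nat) (lam : R) (mu nu : probability E R) (x y : 'I_n.+1 -> E) :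
  0 < lam -> Num.sqrt 2 * lam <= lamM -> mu box = 1%E -> nu box = 1%E ->
  (forall i, box (x i)) -> (forall i, box (y i)) ->
  `|(crichardson_div lam k.+1 (x : 'I_n.+1 -> 'rV[R]_d) y).1 - richardson_div lam mu nu| <=
  12 * (dev lam (mass mu) (freq x) + dev lam (mass nu) (freq y)) +
  6 * (4 * grid_error + sinkhorn_error lam k).
Proof.
move=> lam0 lamle b1 b2 b3 b4.
have sq1 : 1 <= Num.sqrt 2 :> R by rewrite -{1}sqrtr1 ler_wsqrtr // ler1n.
have lam2 : lam <= Num.sqrt 2 * lam by rewrite ler_peMl // ltW.
have l1 : 0 < lam <= lamM by rewrite lam0 (le_trans lam2).
have l2 : 0 < Num.sqrt 2 * lam <= lamM by rewrite lamle (lt_le_trans lam0).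
have dle (r : cubes d J -> R) := deviation_le L_gt0 lamM_gt0 r lam0 lam2.
rewrite (_ : 12 * _ + _ = 6 * (2 * (dev lam (mass mu) (freq x) + dev lam (mass nu) (freq y)) +
  (4 * grid_error + sinkhorn_error lam k))); last by ring.
apply: ler_dist_richardson.
- rewrite !csinkhorn_divE.
  apply: ler_dist_div; [exact: (cot_cost_dev k l1 b1 b2 b3 b4)|exact: (cot_cost_dev k l1 b1 b1 b3 b3)|
    exact: (cot_cost_dev k l1 b2 b2 b4 b4)|].
  by rewrite le_eqVlt; apply/orP; left; apply/eqP; ring.
- rewrite !csinkhorn_divE.
  apply: ler_dist_div; [exact: (cot_cost_dev k l2 b1 b2 b3 b4)|exact: (cot_cost_dev k l2 b1 b1 b3 b3)|
    exact: (cot_cost_dev k l2 b2 b2 b4 b4)|].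
  by rewrite le_eqVlt; apply/orP; left; apply/eqP; ring.
- rewrite lerD //; first by rewrite ler_pM2l // lerD.
  rewrite lerD2l /sinkhorn_error; apply: ler_wpM2l; first by rewrite mulr_ge0 // sqr_ge0.
  have /andP[l20 _] := l2; rewrite lef_pV2 ?posrE ?mulr_gt0 ?ltr0n //.
  by rewrite ler_pM2r // ltr0n.
Qed.

End grid_comparison.

(** * Operation count *)

Section operation_count.
Context (R : realType) (n d : nat).
Implicit Types (lam : R) (x y : 'I_n -> 'rV[R]_d).

Lemma csinkhorn_iter_count lam c p q k :
  (@csinkhorn_iter R n lam c p q k).2 = (k * (2 * (n * (5 * n + 3))))%N.
Proof.
elim: k => [//|k IH] /=; rewrite IH !sum_nat_const !card_ord; ring.
Qed.

Lemma cot_cost_count lam k x y :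
  (cot_cost lam k x y).2 =
  (1 + n * (n * (3 * d + 1)) + k * (2 * (n * (5 * n + 3))) + (4 * n + 1))%N.
Proof.
rewrite /cot_cost /csinkhorn_value /= csinkhorn_iter_count !sum_nat_const !card_ord.
ring.
Qed.

(* Rewriting with the counts themselves would make unification unfold the
   iterations, hence these statements about plain numbers. *)
Let count3 (a b c m : nat) : a = m -> b = m -> c = m -> (a + (b + (c + 3)) = 3 * m + 3)%N.
Proof. by move=> -> -> ->; ring. Qed.

Lemma csinkhorn_div_count lam k x y :
  (csinkhorn_div lam k x y).2 =
  (3 * (1 + n * (n * (3 * d + 1)) + k * (2 * (n * (5 * n + 3))) + (4 * n + 1)) + 3)%N.
Proof. exact: (count3 (cot_cost_count _ _ _ _) (cot_cost_count _ _ _ _) (cot_cost_count _ _ _ _)). Qed.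

Let count2 (a b m : nat) : a = m -> b = m -> (a + (1 + (b + 2)) = 2 * m + 3)%N.
Proof. by move=> -> ->; ring. Qed.

(** The count is [21 + (18 d + 6) n^2 + 24 n + k (60 n^2 + 36 n)], and
    [21 + 6 + 24 + 60 + 36 = 147]. *)
Lemma crichardson_div_count lam k x y : (0 < n)%N ->
  ((crichardson_div lam k x y).2 <= (18 * d + 147) * (n * n) * k.+1)%N.
Proof.
move=> n0; rewrite [leqLHS](count2 (csinkhorn_div_count _ _ _ _) (csinkhorn_div_count _ _ _ _)).
have nn : (n <= n * n)%N by rewrite leq_pmulr.
have nn1 : (1 <= n * n)%N by rewrite muln_gt0 n0.
have kn : (k * n <= k * (n * n))%N by rewrite leq_mul2l nn orbT.
nia.
Qed.

End operation_count.

(** * Independent samples *)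

(* f is not assumed measurable, unlike in ge0_le_integral. *)
Lemma ge0_le_integral_nonmeasurable d0 (T : measurableType d0) (R : realType)
    (m : measure T R) (f g : T -> \bar R) : (forall x, (0 <= f x)%E) ->
  (forall x, (f x <= g x)%E) -> (\int[m]_x f x <= \int[m]_x g x)%E.
Proof.
move=> f0 fg; have g0 x : (0 <= g x)%E by exact: le_trans (f0 x) (fg x).
rewrite !ge0_integralTE //; apply: le_ereal_sup => _ [h hf <-]; exists h => //.
by move=> x; exact: le_trans (hf x) (fg x).
Qed.

(** In the application [f] contains an infimum over couplings and is not assumed measurable. It is
    dominated everywhere by [h], equal to [+oo] off [G], and only [h] and [g] are then compared
    almost everywhere. *)
Lemma ge0_le_integral_ae d0 (T : measurableType d0) (R : realType)
    (P : probability T R) (f g : T -> \bar R) (G : set T) : measurable G -> P G = 1%E ->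
  measurable_fun setT g -> (forall x, (0 <= f x)%E) -> (forall x, (0 <= g x)%E) ->
  (forall x, G x -> (f x <= g x)%E) -> (\int[P]_x f x <= \int[P]_x g x)%E.
Proof.
move=> mG PG mg f0 g0 fg.
have PC : P (~` G) = 0%E by rewrite probability_setC // PG subee.
pose h x : \bar R := if x \in G then g x else +oo%E.
have mh : measurable_fun setT h.
  apply: measurable_fun_ifT => //.
  apply: (@measurable_fun_bool _ _ _ _ true).
  rewrite setTI (_ : _ @^-1` _ = G) //; apply/seteqP.
  by split => x /=; [move/set_mem|move/mem_set].
apply: (@le_trans _ _ (\int[P]_x h x)%E).
  apply: ge0_le_integral_nonmeasurable => // x; rewrite /h.
  by case: ifPn; rewrite ?leey // inE => /fg.
rewrite le_eqVlt; apply/orP; left; apply/eqP.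
apply: ge0_ae_eq_integral => //.
- by move=> x _; rewrite /h; case: ifP => // _; rewrite le0y.
- exists (~` G); split; [exact: measurableC|exact: PC|].
  by move=> x /=; apply: contra_not => Gx _; rewrite /h mem_set.
Qed.

Lemma fine_prod (R : realType) (I : finType) (f : I -> \bar R) :
  (forall i, f i \is a fin_num) -> fine (\prod_i f i)%E = \prod_i fine (f i).
Proof.
move=> ff; transitivity (fine (\prod_i fine (f i))%:E) => //; congr fine.
by rewrite -prodEFin; apply: eq_bigr => i _; rewrite fineK.
Qed.

Section sample_law.
Context (R : realType) dO (Omega : measurableType dO) (P : probability Omega R).
Context dT (T : measurableType dT) (mu : probability T R) (n : nat).
Variable X : 'I_n -> {RV P >-> T}.
Hypothesis X_law : forall B : 'I_n -> set T, (forall i, measurable (B i)) ->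
  P [set w | forall i, B i (X i w)] = (\prod_i mu (B i))%E.

Lemma measurable_samples (B : 'I_n -> set T) : (forall i, measurable (B i)) ->
  measurable [set w | forall i, B i (X i w)].
Proof.
move=> mB; rewrite (_ : [set w | _] = \bigcap_i (X i @^-1` B i)).
  apply: fin_bigcap_measurable => [|i _]; first exact: finite_finset.
  by rewrite -[X in measurable X]setTI; apply: measurable_funP.
by apply/seteqP; split => [w h i _|w h i]; [exact: h|exact: (h i)].
Qed.

Lemma samples_in (K : set T) : measurable K -> mu K = 1%E ->
  P [set w | forall i, K (X i w)] = 1%E.
Proof. by move=> mK muK; rewrite (X_law (fun=> mK)) big1. Qed.

Variables (A : finType) (psi : T -> A).
Hypothesis mpsi : forall a, measurable (psi @^-1` [set a]).
Let p a := fine (mu (psi @^-1` [set a])).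

Definition sample_map (w : Omega) : {ffun 'I_n -> A} := [ffun i => psi (X i w)].

Let sample_mapE m : sample_map @^-1` [set m] = [set w | forall i, (psi @^-1` [set m i]) (X i w)].
Proof.
apply/seteqP; split => w /=; first by move=> <- i; rewrite ffunE.
by move=> h; apply/ffunP => i; rewrite ffunE.
Qed.

Lemma measurable_sample_map m : measurable (sample_map @^-1` [set m]).
Proof. by rewrite sample_mapE; apply: (measurable_samples (fun i => mpsi (m i))). Qed.

Lemma sample_map_law m : fine (P (sample_map @^-1` [set m])) = sample_weight p m.
Proof.
rewrite sample_mapE (X_law (fun i => mpsi (m i))) fine_prod // => i; exact: fin_num_measure.
Qed.

Lemma sample_map_integral (F : {ffun 'I_n -> A} -> R) :
  (\int[P]_w (F (sample_map w))%:E = (\sum_m sample_weight p m * F m)%:E)%E.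
Proof.
rewrite (integral_finite_valued measurable_sample_map P F measurableT).
by congr EFin; apply: eq_bigr => m _; rewrite setTI sample_map_law mulrC.
Qed.

Lemma measurable_sample_fun (F : {ffun 'I_n -> A} -> R) :
  measurable_fun setT (fun w => F (sample_map w)).
Proof. exact: (measurable_finite_valued measurable_sample_map). Qed.

Lemma measurable_sample_gt (F : {ffun 'I_n -> A} -> R) (a : R) :
  measurable [set w | a < F (sample_map w)].
Proof.
have := measurable_sample_fun F measurableT (measurable_itv `]a, +oo[).
rewrite setTI; congr measurable.
by apply/seteqP; split => w /=; rewrite in_itv /= andbT.
Qed.

Lemma sample_map_markov (F : {ffun 'I_n -> A} -> R) (a : R) :
  (P [set w | (a < F (sample_map w))%R] <=
   (\sum_m sample_weight p m * expR (F m - a))%:E)%E.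
Proof.
have mS := measurable_sample_gt F a.
rewrite (measure_finite_valued measurable_sample_map P mS) lee_fin.
apply: ler_sum => m _; have w0 : 0 <= sample_weight p m.
  by apply: sample_weight_ge0 => b; rewrite /p fine_ge0.
have [Fa|Fa] := ltP a (F m); last first.
  rewrite (_ : _ `&` _ = set0); first by rewrite measure0 /= mulr_ge0 ?expR_ge0.
  by apply/seteqP; split => w //= -[+ e]; rewrite e ltNge Fa.
rewrite (@le_trans _ _ (sample_weight p m)) //; last first.
  by rewrite ler_peMr // -expR0 ler_expR subr_ge0 ltW.
have mM := measurable_sample_map m; have mI := measurableI _ _ mS mM.
rewrite -sample_map_law fine_le ?fin_num_measure //.
by apply: le_measure; rewrite ?inE // => w [].
Qed.

End sample_law.

Section two_samples_law.
Context (R : realType) dO (Omega : measurableType dO) (P : probability Omega R).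
Context dT (T : measurableType dT) (mu nu : probability T R) (n : nat).
Variables X Y : 'I_n -> {RV P >-> T}.

(** Each law follows from joint independence by taking the whole space as the event of every
    variable of the other sample. *)
Lemma two_samples_law : two_samples X Y mu nu ->
  (forall B : 'I_n -> set T, (forall i, measurable (B i)) ->
    P [set w | forall i, B i (X i w)] = (\prod_i mu (B i))%E) /\
  (forall B : 'I_n -> set T, (forall i, measurable (B i)) ->
    P [set w | forall i, B i (Y i w)] = (\prod_i nu (B i))%E).
Proof.
move=> [muX nuY indep]; split=> B mB.
- have := indep [set: 'I_n + 'I_n]%SET (fun s => if s is inl i then B i else setT).
  move=> /(_ _); rewrite big_sumType /= [X in (_ * X)%E]big1 ?mule1; last first.
    by move=> i _; rewrite preimage_setT probability_setT.
  rewrite (_ : [set w | _] = [set w | forall i, B i (X i w)]).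
    move=> ->; last by case.
    by apply: eq_big => [i|i _]; [rewrite inE|exact: muX].
  apply/seteqP; split => w /= h; first by move=> i; exact: (h (inl i) (finset.in_setT _)).
  by case.
- have := indep [set: 'I_n + 'I_n]%SET (fun s => if s is inr i then B i else setT).
  move=> /(_ _); rewrite big_sumType /= [X in (X * _)%E]big1 ?mul1e; last first.
    by move=> i _; rewrite preimage_setT probability_setT.
  rewrite (_ : [set w | _] = [set w | forall i, B i (Y i w)]).
    move=> ->; last by case.
    by apply: eq_big => [i|i _]; [rewrite inE|exact: nuY].
  apply/seteqP; split => w /= h; first by move=> i; exact: (h (inr i) (finset.in_setT _)).
  by case.
Qed.

End two_samples_law.

Section measurable_sinkhorn.
Context (R : realType) dO (Omega : measurableType dO) (n : nat) (lam : R).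
Local Notation mfun f := (measurable_fun [set: Omega] f).

Lemma measurable_sinkhorn_u (c : Omega -> 'I_n -> 'I_n -> R) (q : 'I_n -> R)
    (v : Omega -> 'I_n -> R) i : (forall i j, mfun (fun w => c w i j)) ->
  (forall j, mfun (fun w => v w j)) -> mfun (fun w => sinkhorn_u lam (c w) q (v w) i).
Proof.
move=> mc mv; apply: measurableT_comp => //; apply: measurable_funM => //.
apply: measurableT_comp => //; apply: measurable_sum => j.
apply: measurable_funM => //; apply: measurableT_comp => //.
by apply: measurable_funM => //; apply: measurable_funB.
Qed.

Lemma measurable_sinkhorn_value (c : Omega -> 'I_n -> 'I_n -> R) p q k :
  (forall i j, mfun (fun w => c w i j)) -> mfun (fun w => sinkhorn_value lam (c w) p q k).
Proof.
move=> mc.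
have [m1 m2] : (forall i, mfun (fun w => (sinkhorn_iter lam (c w) p q k).1 i)) /\
               (forall i, mfun (fun w => (sinkhorn_iter lam (c w) p q k).2 i)).
  elim: k => [|k [_ IH]]; first by split.
  have mu i : mfun (fun w => (sinkhorn_iter lam (c w) p q k.+1).1 i).
    exact: measurable_sinkhorn_u.
  split=> // i.
  by apply: (@measurable_sinkhorn_u (fun w j i => c w i j) p (fun w => (sinkhorn_iter lam (c w) p q k.+1).1)).
rewrite (_ : (fun w => _) = fun w => 2 * \sum_(i < n) ((sinkhorn_iter lam (c w) p q k).1 i * p i
   + (sinkhorn_iter lam (c w) p q k).2 i * q i)); last first.
  by apply/funext => w; rewrite /sinkhorn_value; case: sinkhorn_iter.
apply: measurable_funM => //; apply: measurable_sum => i.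
by apply: measurable_funD; exact: measurable_funM.
Qed.

End measurable_sinkhorn.

Section measurable_estimator.
Context (R : realType) (d : nat) dO (Omega : measurableType dO) (P : probability Omega R).
Context (n k : nat) (lam : R).
Implicit Types X Y : 'I_n -> {RV P >-> euclid R d}.

Lemma measurable_cot_cost l X Y : measurable_fun [set: Omega]
  (fun w => (cot_cost l k (fun i => X i w : 'rV[R]_d) (fun i => Y i w)).1).
Proof.
rewrite (_ : (fun w => _) = fun w => sinkhorn_value l (fun i j => 1 / 2 *
  sqdist (X i w : 'rV[R]_d) (Y j w)) (fun=> 1 / n%:R) (fun=> 1 / n%:R) k); last first.
  by apply/funext => w; rewrite cot_costE.
apply: measurable_sinkhorn_value => i j.
apply: measurable_funM => //; apply: measurable_sum => a.
apply: measurable_funX; apply: measurable_funB.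
  by apply: (measurableT_comp (measurable_coord a)); exact: measurable_funP.
by apply: (measurableT_comp (measurable_coord a)); exact: measurable_funP.
Qed.

(** Monotonicity of the probability applies to measurable sets, so the confidence event must be one
    before a smaller event can bound its probability from below. *)
Lemma measurable_crichardson_div X Y : measurable_fun [set: Omega]
  (fun w => (crichardson_div lam k (fun i => X i w : 'rV[R]_d) (fun i => Y i w)).1).
Proof.
have mdiv l : measurable_fun [set: Omega]
    (fun w => (csinkhorn_div l k (fun i => X i w : 'rV[R]_d) (fun i => Y i w)).1).
  under eq_fun do rewrite csinkhorn_divE.
  apply: measurable_funB; first exact: measurable_cot_cost.
  apply: measurable_funM => //; apply: measurable_funD; exact: measurable_cot_cost.
apply: measurable_funB; last exact: mdiv.
by apply: measurable_funM => //; exact: mdiv.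
Qed.

End measurable_estimator.

(** * Rates *)

(** Richardson's cancellation: at [sqrt 2 * lambda] the quadratic term doubles and the remainder
    bound quadruples, so [2 a - b] loses the former and keeps an error [2 e + 4 e]. *)
Lemma ler_dist_extrapolate (R : realFieldType) (a b w x e : R) :
  `|a - w - x| <= e -> `|b - w - 2 * x| <= 4 * e -> `|2 * a - b - w| <= 6 * e.
Proof.
rewrite !ler_norml => /andP[? ?] /andP[? ?]; apply/andP; split; lra.
Qed.

Lemma ler_norm_div (R : realFieldType) (a b c e : R) :
  `|a| <= e -> `|b| <= e -> `|c| <= e -> `|a - 1 / 2 * (b + c)| <= 2 * e.
Proof.
rewrite !ler_norml => /andP[? ?] /andP[? ?] /andP[? ?]; apply/andP; split; lra.
Qed.

Lemma ler_norm_richardson (R : realFieldType) (a b e : R) :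
  `|a| <= e -> `|b| <= e -> `|2 * a - b| <= 3 * e.
Proof. by rewrite !ler_norml => /andP[? ?] /andP[? ?]; apply/andP; split; lra. Qed.

Section bias.
Context (R : realType) (d : nat) (L : R) (mu nu : probability (euclid R d) R) (I : R).
Hypothesis L_gt0 : 0 < L.
Hypothesis mu_box : mu (box (d := d) L) = 1%E.
Hypothesis nu_box : nu (box (d := d) L) = 1%E.
Hypothesis hI : (fun l : R => sinkhorn_div l mu nu - W2sq mu nu) =
          (fun l : R => l ^+ 2 * I) +O_ (0^'+) (fun l : R => l ^+ 4).

Lemma sinkhorn_expansion : exists K delta : R, [/\ 0 <= K, 0 < delta &
  forall l, 0 < l < delta ->
    `|sinkhorn_div l mu nu - W2sq mu nu - l ^+ 2 * I| <= K * l ^+ 4].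
Proof.
have /eqaddOP/pinfty_ex_gt0 [K K0 /nbhs_ballP [delta /= delta0 H]] := hI.
exists K, delta; split=> //; first exact: ltW.
move=> l /andP[l0 ld]; have := H l; rewrite /ball /= sub0r normrN gtr0_norm //.
by move=> /(_ ld l0); rewrite [X in _ * X]ger0_norm // exprn_ge0 // ltW.
Qed.

(** The expansion holds only near 0, while a bound for every [l] is wanted. Once [sqrt 2 * l]
    reaches [delta], both quantities are bounded by compactness of the supports and
    [l^4 >= delta^4 / 4]. *)
Lemma richardson_bias : exists2 K, 0 <= K & forall l, 0 < l ->
  `|richardson_div l mu nu - W2sq mu nu| <= K * l ^+ 4.
Proof.
have [K [delta [K0 delta0 HK]]] := sinkhorn_expansion.
pose B0 := 2 * (d%:R * (2 * L ^+ 2)) + 2 * grid_error d L 0.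
pose B := 6 * B0 + `|W2sq mu nu|.
have g0 := grid_error_ge0 d 0 L_gt0.
have B00 : 0 <= B0.
  apply: addr_ge0; last exact: mulr_ge0.
  by do 3 (apply: mulr_ge0 => //); exact: sqr_ge0.
have Bge0 : 0 <= B by rewrite addr_ge0 // mulr_ge0.
have d40 : 0 < delta ^+ 4 by rewrite exprn_gt0.
have s20 : 0 < Num.sqrt 2 :> R by rewrite sqrtr_gt0.
have sq2 (l : R) : (Num.sqrt 2 * l) ^+ 2 = 2 * l ^+ 2 by rewrite exprMn sqr_sqrtr.
have sq4 (l : R) : (Num.sqrt 2 * l) ^+ 4 = 4 * l ^+ 4.
  by rewrite (exprM _ 2 2) sq2 exprMn -exprM expr2 -natrM.
exists (6 * K + 4 * B / delta ^+ 4).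
  by apply: addr_ge0; [rewrite mulr_ge0|rewrite divr_ge0 ?mulr_ge0 // ltW].
move=> l l0; have l40 : 0 <= l ^+ 4 by rewrite exprn_ge0 // ltW.
have sl0 : 0 < Num.sqrt 2 * l by rewrite mulr_gt0.
have [ls|ls] := ltP (Num.sqrt 2 * l) delta.
  have sq1 : 1 <= Num.sqrt 2 :> R by rewrite -{1}sqrtr1 ler_wsqrtr // ler1n.
  have ll : l <= Num.sqrt 2 * l by rewrite ler_peMl // ltW.
  have h1 := HK l; have h2 := HK (Num.sqrt 2 * l).
  move: h1 h2; rewrite l0 sl0 ls (le_lt_trans ll ls) sq2 sq4 => /(_ isT) h1 /(_ isT) h2.
  rewrite mulrDl (@le_trans _ _ (6 * K * l ^+ 4)) //; last first.
    by rewrite lerDl mulr_ge0 // divr_ge0 ?mulr_ge0 // ltW.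
  rewrite -mulrA; apply: (@ler_dist_extrapolate _ _ _ _ (l ^+ 2 * I)) => //.
  by rewrite !mulrA [4 * K]mulrC -!mulrA in h2 *.
have Bl : B <= 4 * B / delta ^+ 4 * l ^+ 4.
  rewrite mulrAC ler_pdivlMr // [4 * B]mulrC -mulrA ler_wpM2l // -sq4.
  by rewrite lerXn2r // nnegrE ltW.
rewrite mulrDl; apply: (@le_trans _ _ B); last first.
  by rewrite (le_trans Bl) // lerDr; apply: mulr_ge0 => //; exact: mulr_ge0.
have cb l' (mu' nu' : probability (euclid R d) R) : 0 < l' ->
  mu' (box (d := d) L) = 1%E -> nu' (box (d := d) L) = 1%E -> `|ot_cost l' mu' nu'| <= B0.
  by move=> *; exact: ot_cost_bounds.
rewrite (le_trans (ler_normB _ _)) // lerD2r (_ : 6 * B0 = 3 * (2 * B0)); last by ring.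
have div l' : 0 < l' -> `|sinkhorn_div l' mu nu| <= 2 * B0.
  by move=> l'0; apply: ler_norm_div; exact: cb.
by apply: ler_norm_richardson; exact: div.
Qed.
End bias.

Lemma grid_small (R : realType) (d : nat) (L tau : R) : 0 < L -> 0 < tau ->
  exists J, side L J ^+ smoothness d <= tau /\ grid_error d L J <= tau.
Proof.
move=> L0 tau0; pose a := Num.min 1 (tau / (1 + d%:R * (4 * L))).
have b0 : 0 <= d%:R * (4 * L) by rewrite !mulr_ge0 // ltW.
have b1 : 0 < 1 + d%:R * (4 * L) by rewrite ltr_pwDl.
have a0 : 0 < a by rewrite lt_min ltr01 divr_gt0.
have a1 : a <= 1 by rewrite ge_min lexx.
have at_ : a * (1 + d%:R * (4 * L)) <= tau by rewrite -ler_pdivlMr // ge_min lexx orbT.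
pose J := Num.bound (2 * L / a).
have sa : side L J <= a.
  have := @upper_nthrootP _ (2 * L / a) J (leqnn _).
  by rewrite ltr_pdivrMr // => h; rewrite /side ler_pdivrMr ?exprn_gt0 // ltW // [a * _]mulrC.
have s0 := side_gt0 L0 J; exists J; split.
  rewrite (@le_trans _ _ (side L J)) //.
    by rewrite exprS ler_piMr ?exprn_ile1 ?(ltW s0) // (le_trans sa).
  by rewrite (le_trans sa) // (le_trans _ at_) // ler_peMr ?(ltW a0) // lerDl.
rewrite (le_trans _ at_) // /grid_error mulrA [leLHS]mulrC; apply: ler_pM => //; first exact: ltW.
by rewrite lerDr.
Qed.

Section rates.
Context (R : realType) (d n : nat).
Local Notation m := (d %/ 2)%N.
Local Notation N := (n.+1%:R : R).
Local Notation q := ((2 * m + 8)%N%:R : R).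

Definition rate : R := N `^ (- (4 / q)).

Let N0 : 0 < N. Proof. by []. Qed.
Let q0 : 0 < q. Proof. by rewrite ltr0n addnS. Qed.
Let qE : q = 2 * m%:R + 8. Proof. by rewrite natrD natrM. Qed.

Lemma rate_gt0 : 0 < rate. Proof. exact: powR_gt0. Qed.

Lemma lambda_power_le (lam C : R) : 0 < C -> 0 < lam -> lam <= C * N `^ (- (1 / q)) ->
  lam ^+ 4 <= C ^+ 4 * rate.
Proof.
move=> C0 l0 lC; rewrite (le_trans (_ : _ <= (C * N `^ (- (1 / q))) ^+ 4)) //.
  by rewrite lerXn2r // nnegrE ?ltW // (lt_le_trans l0).
rewrite exprMn -[X in _ * X <= _]powR_mulrn ?powR_ge0 // -powRrM.
by rewrite /rate mulNr div1r [_^-1 * _]mulrC.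
Qed.

Lemma lambda_inv_power_le (lam c : R) : 0 < c -> c * N `^ (- (1 / q)) <= lam ->
  (lam ^+ m)^-1 / Num.sqrt N <= (c ^+ m)^-1 * rate.
Proof.
move=> c0 cl; set b := N `^ _ in cl; have b0 : 0 < b by exact: powR_gt0.
have cb0 : 0 < c * b by rewrite mulr_gt0.
have l0 := lt_le_trans cb0 cl.
have h : (lam ^+ m)^-1 <= (c ^+ m)^-1 * (b ^+ m)^-1.
  rewrite -invfM -exprMn lef_pV2 ?posrE ?exprn_gt0 //.
  by rewrite lerXn2r // nnegrE ltW.
rewrite (le_trans (ler_wpM2r _ h)) ?invr_ge0 ?sqrtr_ge0 // -mulrA.
rewrite ler_wpM2l ?invr_ge0 ?exprn_ge0 ?(ltW c0) // le_eqVlt; apply/orP; left; apply/eqP.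
rewrite -powR12_sqrt ?(ltW N0) // -powRN -powR_mulrn ?(ltW b0) // -powRN -powRrM -powRD; last first.
  by rewrite (gt_eqF N0) implybT.
congr (_ `^ _); rewrite qE; field.
by rewrite -qE gt_eqF.
Qed.

End rates.

Lemma dev_const_ge0 (R : realType) (d : nat) (L lamM : R) : 0 < L -> 0 < lamM ->
  0 <= dev_const d L lamM.
Proof.
move=> L0 l0; have h := err_constL_ge0 d L0 l0.
by apply: addr_ge0; [exact: sqrtr_ge0|exact: mulr_ge0].
Qed.

(** * Combined error bound: fluctuations, mesh and bias *)

Section estimation_error.
Context (R : realType) (d : nat) (L c C K : R) (mu nu : probability (euclid R d) R).
Hypothesis L_gt0 : 0 < L.
Hypothesis c_gt0 : 0 < c.
Hypothesis C_gt0 : 0 < C.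
Hypothesis mu_box : mu (box (d := d) L) = 1%E.
Hypothesis nu_box : nu (box (d := d) L) = 1%E.
Hypothesis bias : forall l, 0 < l ->
  `|richardson_div l mu nu - W2sq mu nu| <= K * l ^+ 4.
Hypothesis K_ge0 : 0 <= K.
Local Notation E := (euclid R d).
Local Notation lamM := (Num.sqrt 2 * C).
Local Notation m := (d %/ 2)%N.

Definition stat_const : R := 12 * dev_const d L lamM * (c ^+ m)^-1.
(** The deterministic part: [2 * stat_const] for each sample, 1 for the mesh, [K * C ^+ 4] for the
    bias. *)
Definition error_const : R := 4 * stat_const + 1 + K * C ^+ 4.

Let lamM_gt0 : 0 < lamM. Proof. by rewrite mulr_gt0 // sqrtr_gt0. Qed.

Lemma stat_const_ge0 : 0 <= stat_const.
Proof.
have h := dev_const_ge0 d L_gt0 lamM_gt0.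
rewrite /stat_const; apply: mulr_ge0; first exact: mulr_ge0.
by rewrite invr_ge0 exprn_ge0 // ltW.
Qed.

Lemma error_const_ge0 : 0 <= error_const.
Proof.
have h := stat_const_ge0; have C0 := ltW C_gt0; rewrite /error_const.
by apply: addr_ge0; [apply: addr_ge0 => //; exact: mulr_ge0|apply: mulr_ge0 => //; exact: exprn_ge0].
Qed.

Section fixed_size.
Variables (n J : nat) (lam : R).
Local Notation N := (n.+1%:R : R).
Local Notation e := (1 / (2 * m + 8)%N%:R).
Local Notation r := (rate R d n).
Hypothesis lam_ge : c * N `^ (- e) <= lam.
Hypothesis lam_le : lam <= C * N `^ (- e).
Hypothesis side_small : side L J ^+ smoothness d <= (Num.sqrt N)^-1.
Hypothesis grid_error_small : 24 * grid_error d L J <= r.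
Local Notation mass := (@mass R d L J).
Local Notation freq x := (frequency R (fun i => cell L J (x i))).
Local Notation dev p p' := (deviation L lamM lam (fun a : cubes d J => p' a - p a)).

Definition fluct (p : probability E R) (x : {ffun 'I_n.+1 -> cubes d J}) : R :=
  fluctuation (mass p) x.
Definition cells_of (x : 'I_n.+1 -> E) : {ffun 'I_n.+1 -> cubes d J} :=
  [ffun i => cell L J (x i)].

Lemma lam_gt0 : 0 < lam.
Proof. by rewrite (lt_le_trans _ lam_ge) // mulr_gt0 // powR_gt0. Qed.

Lemma lam_le_max : Num.sqrt 2 * lam <= lamM.
Proof.
rewrite ler_pM2l ?sqrtr_gt0 // (le_trans lam_le) // ler_piMr ?(ltW C_gt0) //.
by rewrite powRN invf_le1 ?powR_gt0 // -[leLHS](powRr0 N) ler_powR // ler1n.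
Qed.

(** In [2 + fluct], one unit comes from bounding the square root of the fluctuation and the other
    from the interpolation error at the finest level. *)
Lemma dev_le p x : 12 * dev (mass p) (freq x) <= r * (stat_const * (2 + fluct p (cells_of x))).
Proof.
have := deviation_frequency L_gt0 lamM_gt0 (mass p) (ltn0Sn n) (fun i => cell L J (x i)) lam_gt0.
have -> : fluctuation (mass p) (fun i => cell L J (x i)) = fluct p (cells_of x).
  by congr fluctuation; apply/funext => i; rewrite ffunE.
set f := fluct _ _; have f0 : 0 <= f by apply: fluctuation_ge0.
move=> h; rewrite -ler_pdivlMl // (le_trans h) //.
have dc := dev_const_ge0 d L_gt0 lamM_gt0.
have lm : 0 <= (lam ^+ m)^-1 by rewrite invr_ge0 exprn_ge0 // ltW // lam_gt0.
rewrite (@le_trans _ _ (dev_const d L lamM * (lam ^+ m)^-1 * ((2 + f) / Num.sqrt N))) //.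
  apply: ler_wpM2l; first exact: mulr_ge0.
  have -> : (2 + f) / Num.sqrt N = (1 + f) / Num.sqrt N + (Num.sqrt N)^-1 by ring.
  exact: lerD.
rewrite (_ : 12^-1 * _ = dev_const d L lamM * ((c ^+ m)^-1 * r) * (2 + f)); last first.
  by rewrite /stat_const; field; rewrite expf_neq0 // gt_eqF.
rewrite (_ : _ * ((2 + f) / _) = dev_const d L lamM * ((lam ^+ m)^-1 / Num.sqrt N) * (2 + f)); last by ring.
apply: ler_wpM2r; first exact: addr_ge0.
by apply: ler_wpM2l => //; exact: lambda_inv_power_le.
Qed.

Local Notation bound x y :=
  (r * (error_const + stat_const * (fluct mu (cells_of x) + fluct nu (cells_of y)))).

(** Shared by the exact estimator, with [s = 0], and by the computed one, where [s] is the
    optimisation error. *)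
Lemma error_sum (a b s z : R) (x y : 'I_n.+1 -> E) :
  `|z - richardson_div lam mu nu| <=
    12 * (dev (mass mu) (freq x) + dev (mass nu) (freq y)) + (24 * grid_error d L J + s) ->
  `|z - W2sq mu nu| <= bound x y + s.
Proof.
move=> h; rewrite -(subrKA (richardson_div lam mu nu)) (le_trans (ler_normD _ _)) //.
have hb := bias lam_gt0; have hC := lambda_power_le C_gt0 lam_gt0 lam_le.
have hx := dev_le mu x; have hy := dev_le nu y.
have hKC := ler_wpM2l K_ge0 hC.
have gs := grid_error_small.
apply: le_trans (lerD h hb) _; rewrite mulrDr.
apply: (@le_trans _ _ (r * (stat_const * (2 + fluct mu (cells_of x))) +
  r * (stat_const * (2 + fluct nu (cells_of y))) + (r + s) + K * (C ^+ 4 * r))).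
  by apply: lerD => //; apply: lerD; [exact: lerD|rewrite lerD2r].
by rewrite /error_const le_eqVlt; apply/orP; left; apply/eqP; ring.
Qed.

Lemma empirical_error x y :
  (forall i, box L (x i)) -> (forall i, box L (y i)) ->
  `|richardson_div lam (empirical x) (empirical y) - W2sq mu nu| <= bound x y.
Proof.
move=> bx By; rewrite -[leRHS]addr0; apply: error_sum => //; rewrite addr0.
rewrite -!mass_empirical.
apply: richardson_div_dev => //; [exact: lam_gt0|exact: lam_le_max| |];
exact: empirical_box.
Qed.

Lemma sinkhorn_estimate_error k x y :
  (forall i, box L (x i)) -> (forall i, box L (y i)) ->
  `|(crichardson_div lam k.+1 (x : 'I_n.+1 -> 'rV[R]_d) y).1 - W2sq mu nu|
  <= bound x y + 6 * sinkhorn_error d L lam k.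
Proof.
move=> bx By; apply: error_sum => //.
rewrite (_ : 24 * _ + _ = 6 * (4 * grid_error d L J + sinkhorn_error d L lam k)); last by ring.
apply: crichardson_div_dev => //; [exact: lam_gt0|exact: lam_le_max].
Qed.

End fixed_size.
End estimation_error.

Lemma probability_setI_ge d0 (T : measurableType d0) (R : realType) (P : probability T R)
    (A B : set T) (a b : R) : measurable A -> measurable B ->
  ((1 - a)%:E <= P A)%E -> ((1 - b)%:E <= P B)%E -> ((1 - (a + b))%:E <= P (A `&` B))%E.
Proof.
move=> mA mB; have mI := measurableI _ _ mA mB.
have : (P A + P B <= 1 + P (A `&` B))%E.
  have mU := measurableU _ _ mA mB.
  have := probability_le1 P mU; rewrite measureUfinr //; last first.
    by rewrite (le_lt_trans (probability_le1 P mB)) // ltry.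
  by rewrite leeBlDr // fin_num_measure.
rewrite -[P A]fineK ?fin_num_measure // -[P B]fineK ?fin_num_measure //.
rewrite -[P (_ `&` _)]fineK ?fin_num_measure // -!EFinD !lee_fin.
move: (fine _) (fine _) (fine _) => x y z; lra.
Qed.

Section two_sample_bounds.
Context (R : realType) (d : nat) (L c C K : R) (mu nu : probability (euclid R d) R).
Hypothesis L_gt0 : 0 < L.
Hypothesis c_gt0 : 0 < c.
Hypothesis C_gt0 : 0 < C.
Hypothesis mu_box : mu (box (d := d) L) = 1%E.
Hypothesis nu_box : nu (box (d := d) L) = 1%E.
Hypothesis bias : forall l, 0 < l ->
  `|richardson_div l mu nu - W2sq mu nu| <= K * l ^+ 4.
Hypothesis K_ge0 : 0 <= K.
Local Notation E := (euclid R d).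
Local Notation m := (d %/ 2)%N.
Local Notation stat_const := (stat_const d L c C).
Local Notation error_const := (error_const d L c C K).

Lemma rate_grid n : exists J, side L J ^+ smoothness d <= (Num.sqrt n.+1%:R)^-1 /\
  24 * grid_error d L J <= rate R d n.
Proof.
have s0 : 0 < (Num.sqrt n.+1%:R)^-1 :> R by rewrite invr_gt0 sqrtr_gt0.
have r0 : 0 < rate R d n / 24 by rewrite divr_gt0 // rate_gt0.
have [J [h1 h2]] := @grid_small R d L (Num.min (Num.sqrt n.+1%:R)^-1 (rate R d n / 24)) L_gt0
  ltac:(by rewrite lt_min s0 r0).
exists J; split; first by rewrite (le_trans h1) // ge_min lexx.
by rewrite mulrC -ler_pdivlMr // (le_trans h2) // ge_min lexx orbT.
Qed.

Lemma fluct_mgf n J (p : probability E R) :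
  \sum_m sample_weight (mass L (J := J) p) m * expR (fluct L p (m : {ffun 'I_n.+1 -> _})) <= expR 1.
Proof. exact: (fluctuation_mgf n.+1 (mass_prob L J p)). Qed.

Lemma fluct_mean n J (p : probability E R) :
  \sum_m sample_weight (mass L (J := J) p) m * fluct L p (m : {ffun 'I_n.+1 -> _}) <= expR 1.
Proof.
apply: le_trans (fluct_mgf n J p); apply: ler_sum => x _; rewrite ler_wpM2l //.
  by apply: sample_weight_ge0 => a; case: (mass_prob L J p).
by have := expR_ge1Dx (fluct L p x); lra.
Qed.

Section one_sample.
Context dO (Omega : measurableType dO) (P : probability Omega R) (n : nat) (lam : R).
Variables X Y : 'I_n.+1 -> {RV P >-> E}.
Hypothesis XY : two_samples X Y mu nu.
Local Notation N := (n.+1%:R : R).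
Local Notation e := (1 / (2 * m + 8)%N%:R).
Hypothesis lam_ge : c * N `^ (- e) <= lam.
Hypothesis lam_le : lam <= C * N `^ (- e).
Local Notation r := (rate R d n).
Local Notation in_box Z := [set w | forall i, box L (Z i w)].

Let lawX := (two_samples_law XY).1.
Let lawY := (two_samples_law XY).2.

Lemma measurable_in_box (Z : 'I_n.+1 -> {RV P >-> E}) : measurable (in_box Z).
Proof. exact: (measurable_samples Z (fun=> measurable_box (d := d) L)). Qed.

Lemma expectation_bound :
  ('E_P[fun w => `|richardson_div lam (empirical (fun i => X i w)) (empirical (fun i => Y i w))
     - W2sq mu nu|%R] <= ((error_const + 2 * stat_const * expR 1) * r)%:E)%E.
Proof.
have [J [h1 h2]] := rate_grid n.
have s0 := stat_const_ge0 d L_gt0 c_gt0 C_gt0.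
have e0 := error_const_ge0 d L_gt0 c_gt0 C_gt0 K_ge0.
have r0 := ltW (rate_gt0 R d n).
pose mX := sample_map X (cell L J); pose mY := sample_map Y (cell L J).
(* The bound is split into a function of each sample, because the laws are available sample by
   sample; [f1] also takes the deterministic part. *)
pose f1 x : R := r * error_const + r * stat_const * fluct (n := n) L (J := J) mu x.
pose f2 x : R := r * stat_const * fluct (n := n) L (J := J) nu x.
have fl0 (p : probability E R) (x : {ffun 'I_n.+1 -> cubes d J}) : 0 <= fluct L p x.
  exact: fluctuation_ge0.
have f10 x : 0 <= f1 x by apply: addr_ge0; apply: mulr_ge0 => //; exact: mulr_ge0.
have f20 x : 0 <= f2 x by apply: mulr_ge0 => //; exact: mulr_ge0.
have mf1 : measurable_fun setT (fun w => (f1 (mX w))%:E).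
  by apply/measurable_EFinP; apply: (measurable_sample_fun X (@measurable_cell R d L J)).
have mf2 : measurable_fun setT (fun w => (f2 (mY w))%:E).
  by apply/measurable_EFinP; apply: (measurable_sample_fun Y (@measurable_cell R d L J)).
rewrite unlock.
apply: (@le_trans _ _ (\int[P]_w ((f1 (mX w))%:E + (f2 (mY w))%:E))%E).
  apply: (@ge0_le_integral_ae _ _ _ _ _ _ (in_box X `&` in_box Y)).
  - by apply: measurableI; exact: measurable_in_box.
  - have mb := measurable_box (d := d) L.
    have mI : measurable (in_box X `&` in_box Y) by apply: measurableI; exact: measurable_in_box.
    apply/eqP; rewrite eq_le probability_le1 //=.
    have := @probability_setI_ge _ _ _ P _ _ 0 0 (measurable_in_box X) (measurable_in_box Y).
    by rewrite (samples_in lawX mb mu_box) (samples_in lawY mb nu_box) addr0 subr0; apply.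
  - exact: emeasurable_funD.
  - by move=> w; rewrite lee_fin.
  - by move=> w; rewrite adde_ge0 // lee_fin.
  - move=> w [/= bX bY]; rewrite -EFinD lee_fin.
    apply: (le_trans (empirical_error L_gt0 c_gt0 C_gt0 mu_box nu_box bias K_ge0 lam_ge lam_le h1 h2 bX bY)).
    by rewrite /f1 /f2 le_eqVlt; apply/orP; left; apply/eqP; rewrite /mX /mY /sample_map /cells_of; ring.
rewrite ge0_integralD //; last 2 first.
  by move=> w _; rewrite lee_fin.
  by move=> w _; rewrite lee_fin.
rewrite (sample_map_integral lawX (@measurable_cell R d L J)) (sample_map_integral lawY (@measurable_cell R d L J)).
rewrite -EFinD lee_fin.
rewrite (@le_trans _ _ (r * error_const + r * stat_const * expR 1 + r * stat_const * expR 1)) //; last first.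
  by rewrite le_eqVlt; apply/orP; left; apply/eqP; ring.
have rs0 : 0 <= r * stat_const by exact: mulr_ge0.
have mean (p : probability E R) : \sum_x sample_weight (mass L (J := J) p) x * (r * stat_const * fluct L p (x : {ffun 'I_n.+1 -> _}))
    <= r * stat_const * expR 1.
  under eq_bigr do rewrite mulrCA; rewrite -mulr_sumr; apply: ler_wpM2l => //; exact: fluct_mean.
apply: lerD; last exact: mean.
rewrite /f1; under eq_bigr do rewrite mulrDr; rewrite big_split /= -mulr_suml.
rewrite sum_sample_weight ?mul1r; last by case: (mass_prob L J mu).
by rewrite lerD2l; exact: mean.
Qed.

(** The good event asks that both samples lie in the box and both fluctuations be at most [a]; each
    fluctuation exceeds [a] with probability at most [exp (1 - a)] by Markov's inequality. *)
Lemma confidence_bound k (a b : R) :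
  r * (error_const + stat_const * (2 * a)) + 6 * sinkhorn_error d L lam k <= b ->
  ((1 - 2 * expR (1 - a))%:E <=
   P [set w | `|(crichardson_div lam k.+1 (fun i => X i w : 'rV[R]_d) (fun i => Y i w)).1
      - W2sq mu nu| <= b]%R)%E.
Proof.
have [J [h1 h2]] := rate_grid n.
have s0 := stat_const_ge0 d L_gt0 c_gt0 C_gt0.
have r0 := ltW (rate_gt0 R d n).
move=> b_ge; set S := [set w | _].
have mS : measurable S.
  have mf : measurable_fun setT (fun w =>
      `|(crichardson_div lam k.+1 (fun i => X i w : 'rV[R]_d) (fun i => Y i w)).1 - W2sq mu nu|).
    apply: measurableT_comp => //; apply: measurable_funB => //.
    exact: measurable_crichardson_div.
  by rewrite -[S]setTI; apply: measurable_fun_le.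
have tail (p : probability E R) (Z : 'I_n.+1 -> {RV P >-> E}) :
   (forall B : 'I_n.+1 -> set E, (forall i, measurable (B i)) ->
    P [set w | forall i, B i (Z i w)] = (\prod_i p (B i))%E) ->
   measurable [set w | fluct L p (sample_map Z (cell L J) w) <= a] /\
   ((1 - expR (1 - a))%:E <= P [set w | fluct L p (sample_map Z (cell L J) w) <= a]%R)%E.
  move=> lawZ; set F := [set w | _].
  have mG := measurable_sample_gt Z (@measurable_cell R d L J) (fluct L p) a.
  have FE : F = ~` [set w | a < fluct L p (sample_map Z (cell L J) w)].
    by apply/seteqP; split => w; rewrite /F /= leNgt => /negP.
  split; first by rewrite FE; exact: measurableC.
  rewrite FE probability_setC // EFinB; apply: leeB => //.
  apply: (le_trans (sample_map_markov lawZ (@measurable_cell R d L J) (fluct L p) a)).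
  rewrite lee_fin expRD; under eq_bigr do rewrite expRD mulrA.
  by rewrite -mulr_suml ler_wpM2r ?expR_ge0 //; exact: fluct_mgf.
have [mF1 F1] := tail _ _ lawX; have [mF2 F2] := tail _ _ lawY.
have mb := measurable_box (d := d) L.
have mbX := measurable_in_box X; have mbY := measurable_in_box Y.
have b1 : ((1 - 0)%:E <= P (in_box X))%E by rewrite subr0 (samples_in lawX mb mu_box).
have b2 : ((1 - 0)%:E <= P (in_box Y))%E by rewrite subr0 (samples_in lawY mb nu_box).
have := probability_setI_ge (measurableI _ _ mbX mbY) (measurableI _ _ mF1 mF2)
  (probability_setI_ge mbX mbY b1 b2) (probability_setI_ge mF1 mF2 F1 F2).
rewrite !add0r -mulr2n -[_ *+ 2]mulr_natl => /le_trans; apply.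
apply: le_measure; rewrite ?inE //.
  by apply: measurableI; exact: measurableI.
move=> w [[/= bX bY] [/= fX fY]]; rewrite /S /mkset.
apply: (le_trans (sinkhorn_estimate_error L_gt0 c_gt0 C_gt0 mu_box nu_box bias K_ge0 lam_ge lam_le h1 h2 k bX bY)).
apply: le_trans b_ge; rewrite lerD2r; apply: ler_wpM2l => //; rewrite lerD2l; apply: ler_wpM2l => //.
by rewrite mulr_natl mulr2n; exact: lerD.
Qed.

End one_sample.
End two_sample_bounds.

(** * Choice of the sample size and of the number of iterations *)

Section parameter_choice.
Context (R : realType) (d : nat) (Y : R).
Hypothesis Y_ge1 : 1 <= Y.
Local Notation m := (d %/ 2)%N.
Local Notation q := ((2 * m + 8)%N%:R : R).
Local Notation n := (Num.truncn (Y `^ (q / 4))).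
Local Notation k := (Num.truncn (Y `^ (5 / 4))).

Let Y0 : 0 < Y. Proof. exact: lt_le_trans Y_ge1. Qed.
Let q0 : 0 < q. Proof. by rewrite ltr0n addnS. Qed.
Let qE : q = 2 * m%:R + 8. Proof. by rewrite natrD natrM. Qed.

Let powR_ge1 (x : R) : 0 <= x -> 1 <= Y `^ x.
Proof. by move=> x0; rewrite -[leLHS](powRr0 Y) ler_powR. Qed.

Let N_gt : Y `^ (q / 4) < n.+1%:R.
Proof. exact: truncnS_gt. Qed.

Lemma sample_size_le : n.+1%:R <= 2 * Y `^ (q / 4).
Proof.
have h := powR_ge1 (divr_ge0 (ltW q0) (ler0n R 4)).
have /andP[+ _] := truncn_itv (powR_ge0 Y (q / 4)).
rewrite -[X in _ -> X <= _]natr1; lra.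
Qed.

Lemma rate_le : rate R d n <= Y^-1.
Proof.
rewrite /rate powRN lef_pV2 ?posrE ?powR_gt0 //.
rewrite [leLHS](_ : Y = (Y `^ (q / 4)) `^ (4 / q)).
  by apply: ge0_ler_powR; rewrite ?nnegrE ?powR_ge0 // ?divr_ge0 ?ltW.
by rewrite -powRrM (_ : q / 4 * (4 / q) = 1) ?powRr1 ?ltW // qE; field.
Qed.

Lemma lambda_ge : Y `^ (- 4^-1) / 2 <= n.+1%:R `^ (- (1 / q)).
Proof.
rewrite (@le_trans _ _ ((2 * Y `^ (q / 4)) `^ (- (1 / q)))) //.
  rewrite powRM ?powR_ge0 // -powRrM [leRHS]mulrC.
  rewrite (_ : q / 4 * _ = - 4^-1); last by rewrite qE; field.
  rewrite ler_wpM2l ?powR_ge0 // powRN lef_pV2 ?posrE ?powR_gt0 //.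
  rewrite -[leRHS]powRr1 // ler_powR ?ler1n // div1r invf_le1 // ler1n addnS //.
rewrite !powRN lef_pV2 ?posrE ?powR_gt0 ?mulr_gt0 //; last exact: powR_gt0.
apply: ge0_ler_powR; rewrite ?nnegrE ?mulr_ge0 ?powR_ge0 ?divr_ge0 ?(ltW q0) //.
exact: sample_size_le.
Qed.

Lemma iterations_bounds : Y `^ (5 / 4) <= k.+1%:R /\ k.+2%:R <= 3 * Y `^ (5 / 4).
Proof.
have h : 1 <= Y `^ (5 / 4) by exact: powR_ge1.
have /andP[h1 h2] := truncn_itv (powR_ge0 Y (5 / 4)).
split; first exact: ltW.
by move: h1; rewrite -[X in _ -> X <= _]natr1 -[X in _ -> X + _ <= _]natr1; lra.
Qed.

(** The exponents add up to [2 (q / 4) + 5 / 4 = m + 21 / 4], which is below [m + 11 / 2]. *)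
Lemma operations_le : n.+1%:R * n.+1%:R * k.+2%:R <= 12 * Y `^ ((2 * m + 11)%N%:R / 2).
Proof.
have [_ hk] := iterations_bounds; have hn := sample_size_le.
apply: (@le_trans _ _ ((2 * Y `^ (q / 4)) * (2 * Y `^ (q / 4)) * (3 * Y `^ (5 / 4)))).
  by apply: ler_pM => //; exact: ler_pM.
rewrite (_ : _ * _ = 12 * (Y `^ (q / 4) * Y `^ (q / 4) * Y `^ (5 / 4))); last by ring.
rewrite -!powRD ?(gt_eqF Y0) ?implybT // ler_wpM2l // ler_powR //.
rewrite qE natrD natrM; have := ler0n R m; lra.
Qed.

Lemma sinkhorn_error_le L c lam : 0 < c -> c * n.+1%:R `^ (- (1 / q)) <= lam ->
  sinkhorn_error d L lam k <= 64 * cost_bound d L ^+ 2 / c * Y^-1.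
Proof.
move=> c0 lam_ge; rewrite /sinkhorn_error.
have lk : c / 2 * Y <= lam * k.+1%:R.
  rewrite [X in _ * X <= _](_ : Y = Y `^ (- 4^-1) * Y `^ (5 / 4)).
    have c20 : 0 <= c / 2 by rewrite divr_ge0 // ltW.
    rewrite mulrA; apply: ler_pM; rewrite ?powR_ge0 ?(mulr_ge0 c20) ?powR_ge0 //.
      rewrite (le_trans _ lam_ge) // -mulrA [_^-1 * _]mulrC ler_wpM2l ?(ltW c0) //.
      exact: lambda_ge.
    exact: iterations_bounds.1.
  rewrite -powRD ?(gt_eqF Y0) ?implybT // (_ : - 4^-1 + 5 / 4 = 1) ?powRr1 ?ltW //.
  by field.
have cY : 0 < c / 2 * Y by rewrite mulr_gt0 // divr_gt0.
rewrite (_ : 64 * _ / c * _ = 32 * cost_bound d L ^+ 2 / (c / 2 * Y)); last first.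
  by field; rewrite !gt_eqF.
apply: ler_wpM2l; first by rewrite mulr_ge0 // sqr_ge0.
by rewrite lef_pV2 ?posrE // (lt_le_trans cY).
Qed.

End parameter_choice.

(** The left side equals [2 delta^2 / e]; doubling the logarithm in the threshold supplies the
    square. *)
Lemma tail_le (R : realType) (delta : R) : 0 < delta < 1 ->
  2 * expR (1 - 2 * (1 + ln (1 / delta))) <= delta.
Proof.
move=> /andP[d0 d1].
rewrite div1r lnV ?posrE // (_ : 1 - _ = (ln delta + ln delta) - 1); last by ring.
rewrite expRB expRD lnK ?posrE // mulrA ler_pdivrMr ?expR_gt0 //.
have := expR_ge1Dx (1 : R); nra.
Qed.

Theorem proposition8 (R : realType) (d d' : nat) (hd' : d' = (2 * (d %/ 2))%N)
    (mu nu : probability (euclid R d) R)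
    (hmu : compactly_supported mu) (hnu : compactly_supported nu)
    (I : R)
    (hI : (fun l : R => sinkhorn_div l mu nu - W2sq mu nu) =
          (fun l : R => l ^+ 2 * I) +O_ (0^'+) (fun l : R => l ^+ 4))
    (lambda : nat -> R)
    (hlambda : same_order lambda (fun n => n%:R `^ (- (1 / (d' + 8)%N%:R)))) :
  (exists C : R, forall (n : nat) (dO : measure_display)
      (Omega : measurableType dO) (P : probability Omega R)
      (X Y : 'I_n.+1 -> {RV P >-> euclid R d}),
    two_samples X Y mu nu ->
    ('E_P[fun w => `|richardson_div (lambda n.+1)
                       (empirical (fun i => X i w)) (empirical (fun i => Y i w))
                     - W2sq mu nu|%R]
     <= (C * n.+1%:R `^ (- (4 / (d' + 8)%N%:R)))%:E)%E)
  /\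
  (exists (A C : R) (p : nat), forall eps delta : R,
    0 < eps <= 1 -> 0 < delta < 1 ->
    exists n k : nat,
      (forall x y : 'I_n.+1 -> 'rV[R]_d,
        (crichardson_div (lambda n.+1) k x y).2%:R
        <= C * (1 + ln (1 / delta)) ^+ p * eps `^ (- ((d' + 11)%N%:R / 2))) /\
      (forall (dO : measure_display) (Omega : measurableType dO)
          (P : probability Omega R) (X Y : 'I_n.+1 -> {RV P >-> euclid R d}),
        two_samples X Y mu nu ->
        ((1 - delta)%:E <=
         P [set w | `|(crichardson_div (lambda n.+1) k
                         (fun i => X i w) (fun i => Y i w)).1
                      - W2sq mu nu| <= A * eps]%R)%E)).
Proof.
have [L1 L10 HL1] := compact_in_box hmu; have [L2 L20 HL2] := compact_in_box hnu.
pose L := L1 + L2; have L0 : 0 < L by rewrite addr_gt0.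
have muB : mu (box (d := d) L) = 1%E by apply: HL1; rewrite lerDl ltW.
have nuB : nu (box (d := d) L) = 1%E by apply: HL2; rewrite lerDr ltW.
have [K K0 bias] := richardson_bias L0 muB nuB hI.
have [c [C [c0 C0 lam]]] := hlambda; subst d'.
have lam_ge n := (andP (lam n.+1 isT)).1; have lam_le n := (andP (lam n.+1 isT)).2.
have S0 := stat_const_ge0 d L0 c0 C0; have E0 := error_const_ge0 d L0 c0 C0 K0.
split.
  exists (error_const d L c C K + 2 * stat_const d L c C * expR 1) => n dO Omega P X Y XY.
  exact: (expectation_bound L0 c0 C0 muB nuB bias K0 XY (lam_ge n) (lam_le n)).
exists (error_const d L c C K + 4 * stat_const d L c C + 6 * (64 * cost_bound d L ^+ 2 / c)).
(* The power [(d' + 11) / 2] of [t] need not be a natural number; as [t >= 1] it is bounded by the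
   natural power [d' + 11]. *)
exists (12 * (18 * d + 147)%:R), (2 * (d %/ 2) + 11)%N => eps delta /andP[e0 e1] d01.
have /andP[d0 d1] := d01; set t := 1 + ln (1 / delta).
have t1 : 1 <= t by rewrite lerDl ln_ge0 // div1r invf_ge1 // ltW.
have t0 : 0 < t by exact: lt_le_trans t1.
have Y1 : 1 <= t / eps by rewrite ler_pdivlMr // mul1r (le_trans e1).
(* With Y = t / eps, n ~ Y^((d'+8)/4) makes the statistical error of order 1 / Y
   and k ~ Y^(5/4) makes 1 / (lambda k) of order 1 / Y. *)
exists (Num.truncn ((t / eps) `^ ((2 * (d %/ 2) + 8)%N%:R / 4))).
exists (Num.truncn ((t / eps) `^ (5 / 4))).+1; split.
  move=> x y.
  have := crichardson_div_count (lambda (Num.truncn ((t / eps) `^ ((2 * (d %/ 2) + 8)%N%:R / 4))).+1)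
    (Num.truncn ((t / eps) `^ (5 / 4))).+1 x y (ltn0Sn _).
  rewrite -(ler_nat R) => /le_trans; apply; rewrite !natrM -mulrA.
  rewrite -[leRHS]mulrA [12 * _]mulrC -[leRHS]mulrA ler_wpM2l //.
  apply: (le_trans (operations_le d Y1)); rewrite ler_wpM2l //.
  have -> : eps^-1 = eps `^ (- 1) by rewrite powR_inv1 ?ltW.
  rewrite powRM ?powR_ge0 ?(ltW t0) // -powRrM mulN1r.
  rewrite ler_wpM2r ?powR_ge0 // -powR_mulrn ?(ltW t0) // ler_powR //.
  by rewrite ler_pdivrMr // ler_peMr // ler1n.
move=> dO Omega P X Y XY.
apply: (@le_trans _ _ (1 - 2 * expR (1 - 2 * t))%:E).
  by rewrite lee_fin lerD2l lerN2; exact: tail_le.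
apply: (confidence_bound L0 c0 C0 muB nuB bias K0 XY (lam_ge _) (lam_le _)).
have rY := rate_le d Y1; rewrite invf_div in rY.
have sY := sinkhorn_error_le Y1 L c0 (lam_ge _); rewrite invf_div in sY.
have et : eps / t <= eps by rewrite ler_pdivrMr // ler_peMr // ltW.
rewrite [leRHS]mulrDl; apply: lerD; last first.
  rewrite -mulrA ler_pM2l // (le_trans sY) //; apply: ler_wpM2l => //.
  by rewrite divr_ge0 ?(ltW c0) // mulr_ge0 // sqr_ge0.
(* The threshold [a = 2 * t] makes the statistical term [4 * stat_const * t]; since [1 <= t] the
   whole factor is at most a constant times [t], and this [t] cancels against [rate <= eps / t]. *)
apply: (@le_trans _ _ (eps / t * ((error_const d L c C K + 4 * stat_const d L c C) * t))); last first.
  by rewrite mulrC -mulrA [t * _]mulrC divfK // gt_eqF.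
apply: ler_pM => //; first exact: ltW (rate_gt0 _ _ _).
  by apply: addr_ge0 => //; do 3 (apply: mulr_ge0 => //); exact: ltW.
rewrite [leRHS]mulrDl; apply: lerD; first by rewrite ler_peMr.
by rewrite le_eqVlt; apply/orP; left; apply/eqP; ring.
Qed.
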